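(* Let $(F,D)$ be the separated graph associated to the presentation $\langle a,b\mid a+b=a+b\rangle$, i.e. with vertices $v,w_1,w_2$, edges $\alpha_1,\beta_1:v\to w_1$, $\alpha_2,\beta_2:v\to w_2$, and $D=D_v=\{\{\alpha_1,\alpha_2\},\{\beta_1,\beta_2\}\}$. Then $$vC^*_{\mathrm{red}}(F,D)v\cong C^*_r\big((\ast_{\mathbb Z}\mathbb Z_2)\rtimes\mathbb Z\big)\cong \big(C^*_r(\ast_{\mathbb Z}\mathbb Z_2)\big)\rtimes_r\mathbb Z .$$
   Context: $\mathbb Z_2=\mathbb Z/2\mathbb Z$; $\ast_{\mathbb Z}\mathbb Z_2$ is the free product of copies of $\mathbb Z_2$ indexed by $\mathbb Z$, on which $\mathbb Z$ acts by shifting the factors; $C^*_r$ denotes the reduced group C*-algebra and $\rtimes_r$ the reduced crossed product. The reduced graph C*-algebra $C^*_{\mathrm{red}}(F,D)$: Let $A=B=M_2(\mathbb C)\times M_2(\mathbb C)$ with matrix units $e^{(i)}_{jk}$ for $A$ and $f^{(i)}_{jk}$ for $B$ ($i=1,2$, $j,k\in\{0,1\}$). Embed $\mathbb C^3=\mathbb Cw_1\oplus\mathbb Cw_2\oplus\mathbb Cv$ unitally in $A$ by $w_i\mapsto e^{(i)}_{00}$, $v\mapsto e^{(1)}_{11}+e^{(2)}_{11}$, and in $B$ by $w_i\mapsto f^{(i)}_{00}$, $v\mapsto f^{(1)}_{11}+f^{(2)}_{11}$; the edges are $\alpha_i=e^{(i)}_{10}$, $\beta_i=f^{(i)}_{10}$.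 Let $\Phi_A:A\to\mathbb C^3$ be $\Phi_A(\sum a^{(i)}_{jk}e^{(i)}_{jk})=a^{(1)}_{00}w_1+a^{(2)}_{00}w_2+\frac12(a^{(1)}_{11}+a^{(2)}_{11})v$, and $\Phi_B$ the analogous map on $B$. Then $C^*_{\mathrm{red}}(F,D)$ is the (Voiculescu) reduced amalgamated free product $(A,\Phi_A)*_{\mathbb C^3}(B,\Phi_B)$, and $v$ denotes the corresponding projection in it. *)

(* Defs.v *)
From HB Require Import structures.
From mathcomp Require Import all_boot all_order all_algebra finmap.
From mathcomp Require Import complex ring lra.
From mathcomp Require Import all_classical all_reals all_analysis.

Set Implicit Arguments.
Unset Strict Implicit.
Unset Printing Implicit Defensive.
Import Order.TTheory GRing.Theory Num.Theory.
Import numFieldNormedType.Exports.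
Local Open Scope ring_scope.
Local Open Scope classical_set_scope.

(** * Hilbert spaces *)

(* The inner product is linear in its second variable. *)
HB.mixin Record Lmodule_isHilbert (R : realType) V of GRing.Lmodule R[i] V := {
  ip : V -> V -> R[i];
  ip_linear : forall x a y z, ip x (a *: y + z) = a * ip x y + ip x z;
  ip_conj : forall x y, ip y x = Num.conj (ip x y);
  ip_ge0 : forall x, 0 <= ip x x;
  ip_eq0 : forall x, ip x x = 0 -> x = 0;
  ip_complete : forall u : nat -> V,
    (forall e : R[i], 0 < e -> exists N, forall m n, (N <= m)%N -> (N <= n)%N ->
      ip (u m - u n) (u m - u n) < e) ->
    exists l, forall e : R[i], 0 < e -> exists N, forall n, (N <= n)%N ->
      ip (u n - l) (u n - l) < e }.

#[short(type="hilbertType")]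
HB.structure Definition Hilbert (R : realType) :=
  { V of Lmodule_isHilbert R V & GRing.Lmodule R[i] V }.

Definition hnorm (R : realType) (V : hilbertType R) (x : V) : R[i] :=
  sqrtC (ip x x).

Section ip_theory.
Variables (R : realType) (V : hilbertType R).
Implicit Types (x y z : V) (a : R[i]).

Lemma ipDr x y z : ip x (y + z) = ip x y + ip x z.
Proof. by rewrite -[y]scale1r ip_linear mul1r scale1r. Qed.

Lemma ip0r x : ip x 0 = 0.
Proof. by apply: (addIr (ip x 0)); rewrite -ipDr !add0r. Qed.

Lemma ipZr x a y : ip x (a *: y) = a * ip x y.
Proof. by rewrite -[_ *: _]addr0 ip_linear ip0r addr0. Qed.

Lemma ipNr x y : ip x (- y) = - ip x y.
Proof. by rewrite -scaleN1r ipZr mulN1r. Qed.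

Lemma ipDl x y z : ip (y + z) x = ip y x + ip z x.
Proof. by rewrite (ip_conj x) ipDr rmorphD /= -!ip_conj. Qed.

Lemma ipNl x y : ip (- y) x = - ip y x.
Proof. by rewrite (ip_conj x) ipNr rmorphN /= -ip_conj. Qed.

Lemma ipZl x a y : ip (a *: y) x = Num.conj a * ip y x.
Proof. by rewrite (ip_conj x) ipZr rmorphM /= -ip_conj. Qed.

Definition nsq x : R := complex.Re (ip x x).

Lemma nsqE x : ip x x = (nsq x)%:C%C.
Proof.
have := ip_ge0 x; rewrite /nsq; case: (ip x x) => a b /=.
by rewrite lecE /= => /andP[/eqP -> _].
Qed.

Lemma nsq_ge0 x : 0 <= nsq x.
Proof. by have := ip_ge0 x; rewrite nsqE ler0c. Qed.

Lemma nsqD x y :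
  nsq (x + y) = nsq x + nsq y + 2 * complex.Re (ip x y).
Proof.
rewrite /nsq ipDr !ipDl (ip_conj x y).
case: (ip x x) => a b; case: (ip x y) => c d; case: (ip y y) => e f /=.
by rewrite mulr_natl mulr2n -!addrA; congr (_ + _); rewrite addrA addrC.
Qed.

Lemma nsqN x : nsq (- x) = nsq x.
Proof. by rewrite /nsq ipNl ipNr opprK. Qed.

Lemma nsqBC x y : nsq (x - y) = nsq (y - x).
Proof. by rewrite -nsqN opprB. Qed.

Lemma nsqD_le x y : nsq (x + y) <= 2 * nsq x + 2 * nsq y.
Proof.
have := nsq_ge0 (x - y); rewrite !nsqD nsqN ipNr.
case: (ip x y) => a b /=; set u := nsq x; set v := nsq y; lra.
Qed.

Lemma nsqZ a x : nsq (a *: x) = complex.Re (`|a| ^+ 2) * nsq x.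
Proof.
rewrite /nsq ipZl ipZr mulrA [Num.conj a * a]mulrC -normCK nsqE.
case: a => p q; rewrite normCK /=.
by rewrite mulr0 subr0.
Qed.

Lemma ip_Re_le x y : `|complex.Re (ip x y)| <= nsq x + nsq y.
Proof.
have := nsq_ge0 (x - y); have := nsq_ge0 (x + y); rewrite !nsqD nsqN ipNr.
have := nsq_ge0 x; have := nsq_ge0 y.
case: (ip x y) => a b /=; set u := nsq x; set v := nsq y => *.
by rewrite ler_norml; apply/andP; split; lra.
Qed.

Lemma ip_Im_le x y : `|complex.Im (ip x y)| <= nsq x + nsq y.
Proof.
have := ip_Re_le x ('i%C *: y); rewrite nsqZ ipZr.
case: (ip x y) => a b.
rewrite (_ : complex.Re (`|'i%C| ^+ 2) = 1 :> R); last first.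
  by rewrite normCK /= !mul0r mul1r opprK add0r.
by rewrite /= mul0r mul1r add0r normrN mul1r.
Qed.

End ip_theory.

(** * Unordered sums *)

Definition has_sum (I : choiceType) (K : numFieldType) (f : I -> K) (z : K) :=
  forall e : K, 0 < e -> exists F : {fset I}, forall F' : {fset I},
    (F `<=` F')%fset -> `|\sum_(i <- F') f i - z| < e.

Definition usum (I : choiceType) (K : numFieldType) (f : I -> K) : K :=
  xget 0 [set z | has_sum f z].

Section sum_theory.
Variable I : choiceType.

Lemma has_sum_unique (K : numFieldType) (f : I -> K) y z :
  has_sum f y -> has_sum f z -> y = z.
Proof.
move=> fy fz; apply/eqP/contraT => yz.
have e0 : 0 < `|y - z| / 2 by rewrite divr_gt0// normr_gt0 subr_eq0.
have [F HF] := fy _ e0; have [G HG] := fz _ e0.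
have {HF}h1 := HF (F `|` G)%fset (fsubsetUl F G).
have {HG}h2 := HG (F `|` G)%fset (fsubsetUr F G).
set s := \sum_(i <- _) _ in h1 h2.
have := ltrD h1 h2; rewrite -splitr => /(le_lt_trans _) h.
have /h : `|y - z| <= `|s - y| + `|s - z|.
  by rewrite (distrC s y) (le_trans _ (ler_normD _ _))// addrA subrK.
by rewrite ltxx.
Qed.

Lemma has_sum_ext (K : numFieldType) (f g : I -> K) z :
  f =1 g -> has_sum f z -> has_sum g z.
Proof. by move=> /funext ->. Qed.

Lemma usumE (K : numFieldType) (f : I -> K) z : has_sum f z -> usum f = z.
Proof. by move=> fz; apply: (has_sum_unique _ fz); apply: (xgetPex 0); exists z. Qed.

Lemma has_sumD (K : numFieldType) (f g : I -> K) y z :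
  has_sum f y -> has_sum g z -> has_sum (fun i => f i + g i) (y + z).
Proof.
move=> fy gz e e0; have e2 : 0 < e / 2 by rewrite divr_gt0.
have [F HF] := fy _ e2; have [G HG] := gz _ e2.
exists (F `|` G)%fset => F' sub; rewrite big_split /= opprD addrACA.
rewrite (le_lt_trans (ler_normD _ _))// [ltRHS]splitr ltrD//.
- by apply: HF; apply: fsubset_trans sub; apply: fsubsetUl.
- by apply: HG; apply: fsubset_trans sub; apply: fsubsetUr.
Qed.

Lemma has_sumZ (K : numFieldType) a (f : I -> K) y :
  has_sum f y -> has_sum (fun i => a * f i) (a * y).
Proof.
have [-> _ e e0|a0 fy e e0] := eqVneq a 0.
  by exists fset0 => F' _; rewrite mul0r subr0 big1 ?normr0// => i; rewrite mul0r.
have ea : 0 < e / `|a| by rewrite divr_gt0// normr_gt0.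
have [F HF] := fy _ ea.
exists F => F' /HF; rewrite -mulr_sumr -mulrBr normrM.
by rewrite ltr_pdivlMr ?normr_gt0// mulrC.
Qed.

Lemma has_sum_conj (R : realType) (f : I -> R[i]) y :
  has_sum f y -> has_sum (fun i => Num.conj (f i)) (Num.conj y).
Proof.
move=> fy e /fy[F HF]; exists F => F' /HF.
by rewrite -rmorph_sum -rmorphB norm_conjC.
Qed.

Lemma has_sumC (R : realType) (f : I -> R) y :
  has_sum f y -> has_sum (fun i => (f i)%:C%C) y%:C%C.
Proof.
move=> fy e; case: e => a b; rewrite ltcE /= => /andP[/eqP -> /fy[F HF]].
exists F => F' /HF; rewrite -rmorph_sum -rmorphB /= normc_def /= expr0n addr0.
by rewrite sqrtr_sqr ltcE /= eqxx.
Qed.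

Lemma has_sum_ge0 (R : realType) (f : I -> R) M :
  (forall i, 0 <= f i) -> (forall F : {fset I}, \sum_(i <- F) f i <= M) ->
  exists z, has_sum f z.
Proof.
move=> f0 fM; pose S := range (fun F : {fset I} => \sum_(i <- F) f i).
have hS : has_sup S.
  split; first by exists (\sum_(i <- fset0) f i), fset0.
  by exists M => _ [F _ <-].
exists (sup S) => e e0; have [_ [F _ <-] He] := sup_adherent e0 hS.
exists F => F' FF'; have hF' : \sum_(i <- F') f i <= sup S.
  by apply: sup_upper_bound => //; exists F'.
have hle : \sum_(i <- F) f i <= \sum_(i <- F') f i.
  rewrite (big_fsetID _ (mem F) F') /= (_ : [fset x in F' | x \in F]%fset = F).
    by rewrite lerDl sumr_ge0.
  by apply/fsetP => i; rewrite !inE andbC; case: (boolP (i \in F)) => //= /(fsubsetP FF').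
by rewrite distrC ger0_norm ?subr_ge0// ltrBlDr -ltrBlDl (lt_le_trans He).
Qed.

Lemma has_sum_bounded (R : realType) (f : I -> R) M :
  (forall F : {fset I}, \sum_(i <- F) `|f i| <= M) -> exists z, has_sum f z.
Proof.
move=> fM.
have [|F|p hp] := @has_sum_ge0 _ (fun i => (`|f i| + f i) / 2) M.
- by move=> i; rewrite divr_ge0// -lerBlDr sub0r -normrN ler_norm.
- rewrite (le_trans _ (fM F))// ler_sum// => i _.
  have := ler_norm (f i); lra.
have [|F|q hq] := @has_sum_ge0 _ (fun i => (`|f i| - f i) / 2) M.
- by move=> i; rewrite divr_ge0// subr_ge0 ler_norm.
- rewrite (le_trans _ (fM F))// ler_sum// => i _.
  have := ler_norm (- f i); rewrite normrN; lra.
exists (p + (-1) * q); apply: has_sum_ext (has_sumD hp (has_sumZ (-1) hq)) => i.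
lra.
Qed.

Lemma has_sum_complex (R : realType) (f : I -> R[i]) M :
  (forall F : {fset I}, \sum_(i <- F) `|complex.Re (f i)| <= M) ->
  (forall F : {fset I}, \sum_(i <- F) `|complex.Im (f i)| <= M) ->
  exists z, has_sum f z.
Proof.
move=> /has_sum_bounded[p /has_sumC hp] /has_sum_bounded[q /has_sumC hq].
exists (p%:C%C + 'i%C * q%:C%C).
apply: has_sum_ext (has_sumD hp (has_sumZ 'i%C hq)) => i; case: (f i) => a b /=.
by apply/eqP; rewrite eq_complex /= !(mul0r, mul1r, mulr0, mulr1, subr0, addr0, add0r) !eqxx.
Qed.

End sum_theory.

(** * The Hilbert space [l2(I; V)] *)

Definition sq_summable (R : realType) (I : choiceType) (V : hilbertType R)
    (f : I -> V) : Prop :=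
  exists M : R[i], forall F : {fset I}, \sum_(i <- F) ip (f i) (f i) <= M.

Definition ell2_pred (R : realType) (I : choiceType) (V : hilbertType R) :
    pred (I -> V) := fun f => `[< sq_summable f >].

Record ell2 (R : realType) (I : choiceType) (V : hilbertType R) := Ell2 {
  ell2_fun :> I -> V;
  ell2P : @ell2_pred R I V ell2_fun }.

Section ell2.
Variables (R : realType) (I : choiceType) (V : hilbertType R).
Local Notation l2 := (ell2 I V).

HB.instance Definition _ := [isSub for @ell2_fun R I V].
HB.instance Definition _ := [Choice of l2 by <:].

Lemma sq_summableP (f : I -> V) : sq_summable f <->
  exists M : R, forall F : {fset I}, \sum_(i <- F) nsq (f i) <= M.
Proof.
have E (F : {fset I}) : \sum_(i <- F) ip (f i) (f i) = (\sum_(i <- F) nsq (f i))%:C%C.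
  by rewrite rmorph_sum; apply: eq_bigr => i _; exact: nsqE.
split=> [[M HM]|[M HM]].
- by exists (complex.Re M) => F; have := HM F; rewrite E lecE => /andP[].
- by exists M%:C%C => F; rewrite E lecE /= eqxx HM.
Qed.

Lemma ell2_submod_closed : submod_closed (@ell2_pred R I V).
Proof.
split=> [|a f g /asboolP/sq_summableP[M HM] /asboolP/sq_summableP[N HN]].
  apply/asboolP/sq_summableP; exists 0 => F; rewrite big1// => i _.
  by rewrite /nsq ip0r.
apply/asboolP/sq_summableP; exists (2 * (complex.Re (`|a| ^+ 2) * M) + 2 * N) => F.
have a0 : 0 <= complex.Re (`|a| ^+ 2).
  have : 0 <= `|a| ^+ 2 by rewrite exprn_ge0.
  by rewrite lecE => /andP[].
apply: (@le_trans _ _ (\sum_(i <- F) (2 * (complex.Re (`|a| ^+ 2) * nsq (f i)) + 2 * nsq (g i)))).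
  by apply: ler_sum => i _; rewrite (le_trans (nsqD_le _ _))// nsqZ.
rewrite big_split /= -!mulr_sumr lerD// ler_pM2l//.
by rewrite ler_wpM2l.
Qed.

HB.instance Definition _ :=
  GRing.isSubmodClosed.Build R[i] (I -> V)%type (@ell2_pred R I V) ell2_submod_closed.
HB.instance Definition _ := [SubChoice_isSubLmodule of l2 by <:].
End ell2.

Section ell2_hilbert.
Variables (R : realType) (I : choiceType) (V : hilbertType R).
Local Notation l2 := (ell2 I V).
Implicit Types f g h : l2.

Definition ell2_ip f g : R[i] := usum (fun i => ip (f i) (g i)).

Lemma ell2_bound f : exists M : R, forall F : {fset I}, \sum_(i <- F) nsq (f i) <= M.
Proof. by apply/sq_summableP/asboolP; exact: ell2P. Qed.

Lemma has_sum_ip f g : has_sum (fun i => ip (f i) (g i)) (ell2_ip f g).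
Proof.
have [M HM] := ell2_bound f; have [N HN] := ell2_bound g.
have [||z hz] := @has_sum_complex I R (fun i => ip (f i) (g i)) (M + N).
- move=> F; rewrite (le_trans _ (lerD (HM F) (HN F)))// -big_split ler_sum//.
  by move=> i _; exact: ip_Re_le.
- move=> F; rewrite (le_trans _ (lerD (HM F) (HN F)))// -big_split ler_sum//.
  by move=> i _; exact: ip_Im_le.
by rewrite /ell2_ip (usumE hz).
Qed.

Lemma ell2_ipE f g z : has_sum (fun i => ip (f i) (g i)) z -> ell2_ip f g = z.
Proof. exact: usumE. Qed.

Lemma ell2_ip_linear f a g h :
  ell2_ip f (a *: g + h) = a * ell2_ip f g + ell2_ip f h.
Proof.
apply: ell2_ipE.
apply: has_sum_ext (has_sumD (has_sumZ a (has_sum_ip f g)) (has_sum_ip f h)) => i.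
by rewrite -ip_linear.
Qed.

Lemma ell2_ip_conj f g : ell2_ip g f = Num.conj (ell2_ip f g).
Proof.
apply: ell2_ipE; apply: has_sum_ext (has_sum_conj (has_sum_ip f g)) => i.
by rewrite -ip_conj.
Qed.

Lemma ell2_partial_le f (F : {fset I}) :
  \sum_(i <- F) ip (f i) (f i) <= ell2_ip f f.
Proof.
have [M /has_sum_ge0] := ell2_bound f => /(_ (fun i => nsq_ge0 _))[z hz].
have -> : ell2_ip f f = z%:C%C.
  by apply: ell2_ipE; apply: has_sum_ext (has_sumC hz) => i; rewrite nsqE.
rewrite (eq_bigr (fun i => (nsq (f i))%:C%C)) => [|i _]; last exact: nsqE.
rewrite -rmorph_sum lecE /= eqxx /= leNgt; apply/negP => lt.
have [|G HG] := hz (\sum_(i <- F) nsq (f i) - z); first by rewrite subr_gt0.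
have := HG _ (fsubsetUl G F); apply/negP; rewrite -leNgt.
rewrite (le_trans _ (ler_norm _))// lerB//.
rewrite (big_fsetID _ (mem F) (G `|` F)%fset) /=.
rewrite (_ : [fset x in (G `|` F)%fset | x \in F]%fset = F).
  by rewrite lerDl sumr_ge0// => i _; exact: nsq_ge0.
by apply/fsetP => i; rewrite !inE; case: (i \in F); rewrite ?orbT ?andbF.
Qed.

Lemma ell2_ip_le f (M : R[i]) :
  (forall F : {fset I}, \sum_(i <- F) ip (f i) (f i) <= M) -> ell2_ip f f <= M.
Proof.
move=> HM; have [N /has_sum_ge0] := ell2_bound f.
move=> /(_ (fun i => nsq_ge0 _))[z hz].
have -> : ell2_ip f f = z%:C%C.
  by apply: ell2_ipE; apply: has_sum_ext (has_sumC hz) => i; rewrite nsqE.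
have {HM} HM (F : {fset I}) : (\sum_(i <- F) nsq (f i))%:C%C <= M.
  rewrite (le_trans _ (HM F))// rmorph_sum ler_sum// => i _.
  by rewrite nsqE.
have := HM fset0; case: M HM => a b HM; rewrite lecE /= => /andP[/eqP b0 _].
rewrite lecE /= b0 eqxx /= leNgt; apply/negP => lt.
have [|G HG] := hz (z - a); first by rewrite subr_gt0.
have := HG _ (fsubset_refl G); apply/negP; rewrite -leNgt.
rewrite distrC (le_trans _ (ler_norm _))// lerB//.
by have := HM G; rewrite lecE => /andP[].
Qed.

Lemma ell2_ip_ge0 f : 0 <= ell2_ip f f.
Proof. by have := ell2_partial_le f fset0; rewrite big_seq_fset0. Qed.

Lemma ell2_ext f g : f =1 g -> f = g.
Proof. by move=> fg; apply/val_inj/funext. Qed.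

Lemma ell2_ip_coord f i : ip (f i) (f i) <= ell2_ip f f.
Proof. by have := ell2_partial_le f [fset i]%fset; rewrite big_seq_fset1. Qed.

Lemma ell2_ip_eq0 f : ell2_ip f f = 0 -> f = 0.
Proof.
move=> f0; apply: ell2_ext => i; apply: ip_eq0.
by apply/eqP; rewrite eq_le ip_ge0 andbT -f0 ell2_ip_coord.
Qed.

Lemma ell2_ip_complete (u : nat -> l2) :
  (forall e : R[i], 0 < e -> exists N, forall m n, (N <= m)%N -> (N <= n)%N ->
    ell2_ip (u m - u n) (u m - u n) < e) ->
  exists l, forall e : R[i], 0 < e -> exists N, forall n, (N <= n)%N ->
    ell2_ip (u n - l) (u n - l) < e.
Proof.
move=> cu.
have /choice[l Hl] : forall i, exists x : V, forall e : R[i], 0 < e ->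
    exists N, forall n, (N <= n)%N -> ip (u n i - x) (u n i - x) < e.
  move=> i; apply: ip_complete => e /cu[N HN]; exists N => m n Nm Nn.
  exact: le_lt_trans (ell2_ip_coord (u m - u n) i) (HN m n Nm Nn).
have key (e : R[i]) : 0 < e -> exists N, forall n, (N <= n)%N ->
    forall F : {fset I}, \sum_(i <- F) ip (u n i - l i) (u n i - l i) <= 4 * e.
  move=> e0; have [N HN] := cu e e0; exists N => n Nn F.
  have [m [Nm Hm]] : exists m, (N <= m)%N /\
      \sum_(i <- F) ip (u m i - l i) (u m i - l i) <= e.
    pose d := e / (#|` F|.+1)%:R.
    have d0 : 0 < d by rewrite divr_gt0// ltr0n.
    have /choice[K HK] i := Hl i d d0.
    exists (maxn N (\max_(i <- F) K i))%N; split; first exact: leq_maxl.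
    apply: (@le_trans _ _ (\sum_(i <- F) d)).
      rewrite !big_seq; apply: ler_sum => i iF; apply/ltW/HK.
      by apply: leq_trans (leq_maxr _ _); exact: leq_bigmax_seq.
    rewrite big_const_seq count_predT iter_addr_0 -[leRHS](@divfK _ (#|` F|.+1)%:R) ?pnatr_eq0//.
    by rewrite -/d mulr_natr ler_pMn2l.
  apply: (@le_trans _ _ (\sum_(i <- F) (2 * ip (u n i - u m i) (u n i - u m i)
                                     + 2 * ip (u m i - l i) (u m i - l i)))).
    apply: ler_sum => i _; rewrite !nsqE.
    have := nsqD_le (u n i - u m i) (u m i - l i); rewrite addrA subrK => h.
    have -> : (2 : R[i]) = (2 : R)%:C%C by rewrite rmorph_nat.
    by rewrite -!rmorphM -rmorphD /= lecE /= eqxx.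
  rewrite big_split /= -!mulr_sumr.
  rewrite (_ : 4 * e = 2 * e + 2 * e); last by rewrite -mulrDl -natrD.
  rewrite lerD// ler_pM2l// (le_trans _ (ltW (HN n m Nn Nm)))//.
  exact: (ell2_partial_le (u n - u m) F).
have l2l : ell2_pred l.
  have [N /(_ N (leqnn N)) HN] := key 1 ltr01.
  have PN : @ell2_pred R I V (fun i => u N i - l i).
    by apply/asboolP; exists (4 * 1).
  have -> : l = (u N : I -> V) - (fun i => u N i - l i).
    by apply/funext => i; rewrite !fctE opprB addrC subrK.
  by apply: rpredB PN; exact: ell2P.
exists (Ell2 l2l) => e e0.
have e8 : 0 < e / 8 by rewrite divr_gt0.
have [N HN] := key _ e8; exists N => n /HN h.
apply: (@le_lt_trans _ _ (4 * (e / 8))); first exact: ell2_ip_le.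
rewrite mulrCA gtr_pMr// (_ : 8 = 4 * 2)%R; last by rewrite -natrM.
by rewrite invfM mulrA divff ?pnatr_eq0// mul1r invf_lt1// ltr1n.
Qed.

HB.instance Definition _ := Lmodule_isHilbert.Build R l2
  ell2_ip_linear ell2_ip_conj ell2_ip_ge0 ell2_ip_eq0 ell2_ip_complete.
End ell2_hilbert.

Section scalar_hilbert.
Variable R : realType.
Local Notation C := (R[i]^o).

Definition scalar_ip (x y : C) : R[i] := Num.conj x * y.

Lemma scalar_ip_linear (x : C) (a : R[i]) (y z : C) :
  scalar_ip x (a *: y + z) = a * scalar_ip x y + scalar_ip x z.
Proof. by rewrite /scalar_ip mulrDr mulrCA. Qed.

Lemma scalar_ip_conj (x y : C) : scalar_ip y x = Num.conj (scalar_ip x y).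
Proof. by rewrite /scalar_ip rmorphM /= conjCK mulrC. Qed.

Lemma scalar_ipE (x : C) : scalar_ip x x = `|x| ^+ 2.
Proof. by rewrite /scalar_ip mulrC -normCK. Qed.

Lemma scalar_ip_ge0 (x : C) : 0 <= scalar_ip x x.
Proof. by rewrite scalar_ipE exprn_ge0. Qed.

Lemma scalar_ip_eq0 (x : C) : scalar_ip x x = 0 -> x = 0.
Proof. by move/eqP; rewrite scalar_ipE sqrf_eq0 normr_eq0 => /eqP. Qed.

Lemma real_complete (u : nat -> R) :
  (forall e : R, 0 < e -> exists N, forall m n, (N <= m)%N -> (N <= n)%N ->
    `|u m - u n| < e) ->
  exists l, forall e : R, 0 < e -> exists N, forall n, (N <= n)%N -> `|u n - l| < e.
Proof.
move=> cu; have : cvg (u @ \oo).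
  apply/cauchy_cvgP/cauchy_exP => e /cu[N HN]; exists (u N).
  by exists N => // n /= Nn; exact: HN.
move=> /cvg_ex[l /cvgrPdist_lt hl]; exists l => e /hl[N _ HN].
by exists N => n Nn; rewrite distrC; exact: HN.
Qed.

Lemma scalar_ipRI (x : C) :
  scalar_ip x x = (complex.Re x ^+ 2 + complex.Im x ^+ 2)%:C%C.
Proof.
case: x => a b; apply/eqP; rewrite /scalar_ip eq_complex /= !expr2.
by rewrite !(mulNr, opprK) [b * a]mulrC subrr !eqxx.
Qed.

Lemma scalar_ip_complete (u : nat -> C) :
  (forall e : R[i], 0 < e -> exists N, forall m n, (N <= m)%N -> (N <= n)%N ->
    scalar_ip (u m - u n) (u m - u n) < e) ->
  exists l, forall e : R[i], 0 < e -> exists N, forall n, (N <= n)%N ->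
    scalar_ip (u n - l) (u n - l) < e.
Proof.
move=> cu.
have sq (x e : R) : 0 < e -> x ^+ 2 < e ^+ 2 -> `|x| < e.
  by move=> e0; rewrite -[x ^+ 2]real_normK ?num_real// ltr_pXn2r// ?nnegrE// ltW.
have e2C (e : R) : 0 < e -> 0 < (e ^+ 2)%:C%C :> R[i].
  by move=> e0; rewrite ltcE /= eqxx exprn_gt0.
have [|a Ha] := @real_complete (fun n => complex.Re (u n)).
  move=> e e0; have [N HN] := cu _ (e2C e e0); exists N => m n Nm Nn.
  apply: sq => //; have := HN m n Nm Nn; rewrite scalar_ipRI ltcE /= => /andP[_].
  case: (u m) (u n) => a b [c d] /=; apply: le_lt_trans.
  by rewrite lerDl sqr_ge0.
have [|b Hb] := @real_complete (fun n => complex.Im (u n)).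
  move=> e e0; have [N HN] := cu _ (e2C e e0); exists N => m n Nm Nn.
  apply: sq => //; have := HN m n Nm Nn; rewrite scalar_ipRI ltcE /= => /andP[_].
  case: (u m) (u n) => p q [c d] /=; apply: le_lt_trans.
  by rewrite lerDr sqr_ge0.
exists (a +i* b)%C => -[e e']; rewrite ltcE /= => /andP[/eqP-> e0].
have s0 : 0 < Num.sqrt (e / 2) by rewrite sqrtr_gt0 divr_gt0.
have [N HN] := Ha _ s0; have [M HM] := Hb _ s0.
have sq' (x : R) : `|x| < Num.sqrt (e / 2) -> x ^+ 2 < e / 2.
  move=> xs; rewrite -[ltRHS]sqr_sqrtr ?divr_ge0 ?ltW// -[x ^+ 2]real_normK ?num_real//.
  by rewrite ltr_pXn2r// ?nnegrE// ltW.
exists (maxn N M) => n; rewrite geq_max => /andP[/HN/sq' h1 /HM/sq' h2].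
rewrite scalar_ipRI ltcE /= eqxx /=.
by case: (u n) h1 h2 => p q /= h1 h2; rewrite [ltRHS]splitr ltrD.
Qed.

HB.instance Definition _ := Lmodule_isHilbert.Build R C
  scalar_ip_linear scalar_ip_conj scalar_ip_ge0 scalar_ip_eq0 scalar_ip_complete.
End scalar_hilbert.

Section pair_hilbert.
Variables (R : realType) (V W : hilbertType R).
Local Notation P := (V * W)%type.

Definition pair_ip (x y : P) : R[i] := ip x.1 y.1 + ip x.2 y.2.

Lemma pair_ip_linear (x : P) a (y z : P) :
  pair_ip x (a *: y + z) = a * pair_ip x y + pair_ip x z.
Proof. by rewrite /pair_ip !ip_linear addrACA mulrDr. Qed.

Lemma pair_ip_conj (x y : P) : pair_ip y x = Num.conj (pair_ip x y).
Proof. by rewrite /pair_ip rmorphD /= -!ip_conj. Qed.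

Lemma pair_ip_ge0 (x : P) : 0 <= pair_ip x x.
Proof. by rewrite addr_ge0 ?ip_ge0. Qed.

Lemma pair_ip_eq0 (x : P) : pair_ip x x = 0 -> x = 0.
Proof.
case: x => x y /eqP; rewrite paddr_eq0 ?ip_ge0//= => /andP[/eqP/ip_eq0-> /eqP/ip_eq0->].
by [].
Qed.

Lemma pair_ip_complete (u : nat -> P) :
  (forall e : R[i], 0 < e -> exists N, forall m n, (N <= m)%N -> (N <= n)%N ->
    pair_ip (u m - u n) (u m - u n) < e) ->
  exists l, forall e : R[i], 0 < e -> exists N, forall n, (N <= n)%N ->
    pair_ip (u n - l) (u n - l) < e.
Proof.
move=> cu.
have [|a Ha] := @ip_complete R V (fun n => (u n).1).
  move=> e /cu[N HN]; exists N => m n Nm Nn; apply: le_lt_trans (HN m n Nm Nn).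
  by rewrite lerDl ip_ge0.
have [|b Hb] := @ip_complete R W (fun n => (u n).2).
  move=> e /cu[N HN]; exists N => m n Nm Nn; apply: le_lt_trans (HN m n Nm Nn).
  by rewrite lerDr ip_ge0.
exists (a, b) => e e0; have e2 : 0 < e / 2 by rewrite divr_gt0.
have [N HN] := Ha _ e2; have [M HM] := Hb _ e2.
exists (maxn N M) => n; rewrite geq_max => /andP[/HN h1 /HM h2].
by rewrite [ltRHS]splitr ltrD.
Qed.

HB.instance Definition _ := Lmodule_isHilbert.Build R P
  pair_ip_linear pair_ip_conj pair_ip_ge0 pair_ip_eq0 pair_ip_complete.
End pair_hilbert.

(** * C*-algebras of operators on a Hilbert space *)

Section operators.
Variables (R : realType) (H : hilbertType R).
Implicit Types S T : H -> H.

Definition bounded_op T : Prop :=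
  (forall (a : R[i]) x y, T (a *: x + y) = a *: T x + T y) /\
  exists c : R[i], forall x, hnorm (T x) <= c * hnorm x.

Definition adjoint T S : Prop := forall x y, ip (T x) y = ip x (S y).

(* [M] is a norm-closed *-subalgebra of the bounded operators on [H]; it is
   not required to contain the identity operator. *)
Definition cstar_algebra (M : set (H -> H)) : Prop :=
  [/\ forall T, M T -> bounded_op T,
      M (fun=> 0) /\
      (forall (a : R[i]) S T, M S -> M T -> M (fun x => a *: S x + T x)),
      forall S T, M S -> M T -> M (S \o T),
      forall S T, M T -> bounded_op S -> adjoint T S -> M S
    & forall T, bounded_op T ->
        (forall e : R[i], 0 < e ->
          exists2 S, M S & forall x, hnorm (T x - S x) <= e * hnorm x) -> M T].

(* The C*-algebra generated by a set of bounded operators. *)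
Definition cstar_gen (X : set (H -> H)) : set (H -> H) :=
  [set T | forall M, cstar_algebra M -> X `<=` M -> M T].

Definition corner (p : H -> H) (M : set (H -> H)) : set (H -> H) :=
  [set p \o T \o p | T in M].

End operators.

(* [*]-isomorphism; it is automatically isometric. *)
Definition cstar_iso (R : realType) (H K : hilbertType R)
    (M : set (H -> H)) (N : set (K -> K)) : Prop :=
  exists phi : (H -> H) -> (K -> K),
  [/\ set_bij M N phi,
      forall (a : R[i]) S T, M S -> M T ->
        phi (fun x => a *: S x + T x) = (fun y => a *: phi S y + phi T y),
      forall S T, M S -> M T -> phi (S \o T) = phi S \o phi T
    & forall S T, M S -> M T -> adjoint S T -> adjoint (phi S) (phi T)].

(** * Reduced group C*-algebras and reduced crossed products *)

(* The junk value 0 is taken when [f] is not square-summable. *)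
Definition ell2_of (R : realType) (I : choiceType) (V : hilbertType R)
  (f : I -> V) : ell2 I V := insubd 0 f.

Section crossed.
Variables (R : realType) (G : groupType) (H : hilbertType R).

(* The left translation operator on [l2(G; H)]. *)
Definition ltrans (g : G) (xi : ell2 G H) : ell2 G H :=
  ell2_of (fun h => xi (g^-1 * h)%g).

(* For a C*-algebra [M] of operators on [H] and an action [alpha] of [G] on
   [M], the covariant copy [(pi T xi)(h) = alpha_{h^-1}(T)(xi h)] of [M]. *)
Definition crossed_rep (alpha : G -> (H -> H) -> (H -> H)) (T : H -> H)
    (xi : ell2 G H) : ell2 G H :=
  ell2_of (fun h => alpha h^-1%g T (xi h)).

Definition crossed_product (M : set (H -> H))
    (alpha : G -> (H -> H) -> (H -> H)) : set (ell2 G H -> ell2 G H) :=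
  cstar_gen ([set crossed_rep alpha T | T in M] `|` range ltrans).
End crossed.

Definition group_cstar (R : realType) (G : groupType) :
    set (ell2 G (R[i]^o) -> ell2 G (R[i]^o)) :=
  cstar_gen (range (@ltrans R G (R[i]^o))).

Arguments group_cstar R G _ : clear implicits.

(** * Groups *)

(* The additive group of the integers, written multiplicatively. *)
Definition Zgroup : Type := int.
HB.instance Definition _ := Choice.on Zgroup.
HB.instance Definition _ := isGroup.Build Zgroup
  (@addrA int) (@add0r int) (@addr0 int) (@addNr int) (@addrN int).

Record group_action (Q N : groupType) := GroupAction {
  gact :> Q -> N -> N;
  gact1 : forall x, gact 1%g x = x;
  gactM : forall p q x, gact (p * q)%g x = gact p (gact q x);
  gact_mulg : forall q x y, gact q (x * y)%g = (gact q x * gact q y)%g }.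

Section semidirect.
Variables (Q N : groupType) (a : group_action Q N).

Definition sdprod_of (_ : group_action Q N) : Type := (N * Q)%type.
Local Notation S := (sdprod_of a).
HB.instance Definition _ := Choice.copy S (N * Q)%type.

Definition sd_one : S := (1%g, 1%g).
Definition sd_mul (x y : S) : S := (x.1 * a x.2 y.1, x.2 * y.2)%g.
Definition sd_inv (x : S) : S := (a x.2^-1%g x.1^-1%g, x.2^-1%g).

Lemma gact_1 q : a q 1%g = 1%g.
Proof. by apply: (mulgI (a q 1%g)); rewrite -gact_mulg !mulg1. Qed.

Lemma sd_mulA : associative sd_mul.
Proof.
by move=> x y z; rewrite /sd_mul /= gact_mulg -gactM !mulgA.
Qed.
Lemma sd_mul1 : left_id sd_one sd_mul.
Proof. by case=> x q; rewrite /sd_mul /= gact1 !mul1g. Qed.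
Lemma sd_mulr1 : right_id sd_one sd_mul.
Proof. by case=> x q; rewrite /sd_mul /= gact_1 !mulg1. Qed.
Lemma sd_mulV : left_inverse sd_one sd_inv sd_mul.
Proof. by case=> x q; rewrite /sd_mul /= -gact_mulg !mulVg gact_1. Qed.
Lemma sd_mulrV : right_inverse sd_one sd_inv sd_mul.
Proof. by case=> x q; rewrite /sd_mul /= -gactM !mulgV gact1 mulgV. Qed.

HB.instance Definition _ := isGroup.Build S
  sd_mulA sd_mul1 sd_mulr1 sd_mulV sd_mulrV.
End semidirect.

(* The free product of copies of the group [G] indexed by [I], realized on its
   normal forms: words in the non-trivial elements of the copies of [G] in which
   no two consecutive letters come from the same copy. *)
Section free_product.
Variables (I : choiceType) (G : groupType).
Local Notation word := (seq (I * G)).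

Definition reduced (w : word) : bool :=
  all (fun l => l.2 != 1%g) w && sorted (fun l l' => l.1 != l'.1) w.

Record free_product := FreeProduct { fp_word :> word; fpP : reduced fp_word }.
HB.instance Definition _ := [isSub for fp_word].
HB.instance Definition _ := [Choice of free_product by <:].

(* The normal form of the product of a letter and a reduced word. *)
Definition fp_cons (l : I * G) (w : word) : word :=
  if l.2 == 1%g then w else
  if w is l' :: w' then
    if l.1 == l'.1 then
      if (l.2 * l'.2)%g == 1%g then w' else (l.1, (l.2 * l'.2)%g) :: w'
    else l :: w
  else [:: l].

Lemma reduced_behead l w : reduced (l :: w) -> reduced w.
Proof. by rewrite /reduced /= => /andP[/andP[_ ->]] /path_sorted ->. Qed.

Lemma reduced_cons l w :
  reduced (l :: w) = [&& l.2 != 1%g, (if w is l' :: _ then l.1 != l'.1 else true)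
    & reduced w].
Proof. by rewrite /reduced; case: w => [|l' w] /=; rewrite ?andbT// -!andbA; do !bool_congr. Qed.

Lemma fp_cons_reduced l w : reduced w -> reduced (fp_cons l w).
Proof.
rewrite /fp_cons; have [//|l1] := eqVneq l.2 1%g.
case: w => [_|l' w rw]; first by rewrite reduced_cons l1.
have [e|ne] := eqVneq l.1 l'.1; last by rewrite reduced_cons l1 ne.
have [_|n1] := eqVneq (l.2 * l'.2)%g 1%g; first exact: reduced_behead rw.
rewrite reduced_cons in rw; case/and3P: rw => _ h r.
by rewrite reduced_cons /= n1 r e h.
Qed.

Lemma fp_cons1 i w : fp_cons (i, 1%g) w = w.
Proof. by rewrite /fp_cons eqxx. Qed.

Lemma fp_consM i g h w : reduced w ->
  fp_cons (i, g) (fp_cons (i, h) w) = fp_cons (i, (g * h)%g) w.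
Proof.
have [->|g1] := eqVneq g 1%g; first by rewrite fp_cons1 mul1g.
have [->|h1] := eqVneq h 1%g; first by rewrite fp_cons1 mulg1.
rewrite /fp_cons /= (negPf g1) (negPf h1).
case: w => [_|[j k] w] /=; first by rewrite eqxx.
rewrite reduced_cons /= => /and3P[k1 hd _].
have [->|ij] := eqVneq i j; last by rewrite /= eqxx.
have [hk|hk] := eqVneq (h * k)%g 1%g.
  have -> : k = h^-1%g by rewrite -[RHS]mulg1 -hk mulKg.
  have [gh|gh] := eqVneq (g * h)%g 1%g.
    have -> : g = h^-1%g by rewrite -[LHS]mulg1 -(mulgV h) mulgA gh mul1g.
    case: w hd => [|[j' k'] w] //= hd; by rewrite (negPf hd).
  rewrite mulgK (negPf g1).
  by case: w hd => [|[j' k'] w] //= hd; rewrite (negPf hd).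
rewrite /= eqxx mulgA.
have [gh|gh] := eqVneq (g * h)%g 1%g.
  by rewrite gh mul1g (negPf k1).
by [].
Qed.

Lemma fp_foldr_reduced u w : reduced w -> reduced (foldr fp_cons w u).
Proof. by move=> rw; elim: u => //= l u; exact: fp_cons_reduced. Qed.

Definition fp_one : free_product := @FreeProduct [::] isT.
Definition fp_mul (u v : free_product) : free_product :=
  FreeProduct (fp_foldr_reduced u (fpP v)).

Definition word_inv (w : word) : word := rev [seq (l.1, l.2^-1%g) | l <- w].

Lemma word_inv_reduced (u : free_product) : reduced (word_inv u).
Proof.
case: u => u /= /andP[a s]; rewrite /reduced /word_inv all_rev rev_sorted.
rewrite all_map sorted_map; apply/andP; split.
  by apply: sub_all a => l /=; rewrite invg_eq1.
by apply: sub_sorted s => l l' /=; rewrite eq_sym.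
Qed.

Definition fp_inv (u : free_product) : free_product :=
  FreeProduct (word_inv_reduced u).

Lemma fp_foldr_cons l u w : reduced u -> reduced w ->
  foldr fp_cons w (fp_cons l u) = fp_cons l (foldr fp_cons w u).
Proof.
case: l => i g ru rw; rewrite [fp_cons _ u]/fp_cons /=.
have [->|g1] := eqVneq g 1%g; first by rewrite ?eqxx fp_cons1.
case: u ru => [//|[j h] u] /= ru; have [<-|//] := eqVneq i j.
rewrite fp_consM ?fp_foldr_reduced//.
by have [->|_] //= := eqVneq (g * h)%g 1%g; rewrite fp_cons1.
Qed.

Lemma fp_mulA : associative fp_mul.
Proof.
move=> u v w; apply: val_inj => /=.
elim: (fp_word u) => //= l s IH; rewrite IH fp_foldr_cons ?fpP//.
by apply: fp_foldr_reduced; exact: fpP.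
Qed.

Lemma fp_mul1 : left_id fp_one fp_mul.
Proof. by move=> u; exact: val_inj. Qed.

Lemma fp_mulr1 : right_id fp_one fp_mul.
Proof.
move=> [u ru]; apply: val_inj => /=; elim: u ru => //= l u IH ru.
rewrite IH ?(reduced_behead ru)//; move: ru; rewrite reduced_cons /fp_cons.
case/and3P=> /negPf-> + _; by case: u {IH} => // l' u /negPf->.
Qed.

Lemma fp_mulV : left_inverse fp_one fp_inv fp_mul.
Proof.
move=> [u ru]; apply: val_inj => /=; rewrite /word_inv.
elim: u ru => //= l u IH ru; rewrite rev_cons foldr_rcons.
rewrite -[RHS](IH (reduced_behead ru)); congr foldr.
move: ru; rewrite reduced_cons /fp_cons /= => /and3P[l1 _ _].
by rewrite invg_eq1 (negPf l1) eqxx mulVg eqxx.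
Qed.

Lemma fp_mulrV : right_inverse fp_one fp_inv fp_mul.
Proof.
move=> u; rewrite -[LHS]fp_mul1 -{1}(fp_mulV (fp_inv u)) -fp_mulA.
by rewrite (fp_mulA (fp_inv u) u) fp_mulV fp_mul1 fp_mulV.
Qed.

HB.instance Definition _ := isGroup.Build free_product
  fp_mulA fp_mul1 fp_mulr1 fp_mulV fp_mulrV.
End free_product.

Section shift.
Variable G : groupType.
Local Notation FP := (free_product int G).

Definition word_shift (m : int) (w : seq (int * G)) : seq (int * G) :=
  [seq (m + l.1, l.2) | l <- w].

Lemma word_shift_reduced m w : reduced w -> reduced (word_shift m w).
Proof.
case/andP=> a s; rewrite /reduced all_map sorted_map; apply/andP; split=> //.
by apply: sub_sorted s => l l' /=; rewrite (inj_eq (addrI m)).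
Qed.

Definition fp_shift (m : Zgroup) (u : FP) : FP :=
  FreeProduct (word_shift_reduced m (fpP u)).

Lemma fp_shift0 u : fp_shift 1%g u = u.
Proof.
apply: val_inj => /=; rewrite -[RHS]map_id; apply: eq_map => -[i g] /=.
by rewrite add0r.
Qed.

Lemma fp_shiftD m n u : fp_shift (m * n)%g u = fp_shift m (fp_shift n u).
Proof.
apply: val_inj => /=; rewrite /word_shift -map_comp; apply: eq_map => -[i g] /=.
by rewrite addrA.
Qed.

Lemma word_shift_cons m l w :
  word_shift m (fp_cons l w) = fp_cons (m + l.1, l.2) (word_shift m w).
Proof.
case: l w => i g [|[j h] w]; rewrite /fp_cons /=; first by case: ifP.
rewrite (inj_eq (addrI m)); case: ifP => // _; case: ifP => // _.
by case: ifP.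
Qed.

Lemma fp_shiftM m u v : fp_shift m (u * v)%g = (fp_shift m u * fp_shift m v)%g.
Proof.
apply: val_inj => /=; elim: (fp_word u) => //= l s IH.
by rewrite word_shift_cons IH.
Qed.

Definition shift_action : group_action Zgroup FP :=
  GroupAction fp_shift0 fp_shiftD fp_shiftM.
End shift.

(* The action of [Q] on the reduced C*-algebra of [N] induced by an action of
   [Q] on [N]; it maps the left translation by [g] to that by [q.g]. *)
Section induced_action.
Variables (R : realType) (Q N : groupType) (a : group_action Q N).

Definition gperm (q : Q) (xi : ell2 N (R[i]^o)) : ell2 N (R[i]^o) :=
  ell2_of (fun x => xi (a q^-1%g x)).

Definition cstar_action (q : Q) (T : ell2 N (R[i]^o) -> ell2 N (R[i]^o)) :=
  gperm q \o T \o gperm q^-1%g.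
End induced_action.

(** * Reduced amalgamated free products *)

(* Voiculescu's construction of the reduced free product of two unital
   *-algebras [A] and [B], with unital embeddings [iA], [iB] of a common
   subalgebra [D] and conditional expectations [EA], [EB] onto [D]. Voiculescu's
   free product Hilbert D-module [E] is the direct sum of [D] and of the
   alternating tensor products over [D] of the modules [ker EA] and [ker EB]
   (completed for the D-valued inner products [E (a^* a')]). Here [E] is made a
   Hilbert space by tensoring it with a faithful representation [rho] of [D] on
   [L]; the operators on [E] are faithfully represented on the resulting Hilbert
   space, which is determined up to unitary equivalence by the inner products
   of the elementary tensors [a1 (x) ... (x) an (x) x]. *)
Section amalgam.
Variables (R : realType) (D A B : algType R[i]).
Variables (starA : A -> A) (starB : B -> B) (iA : D -> A) (iB : D -> B).
Variables (EA : A -> D) (EB : B -> D).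
Variables (L : hilbertType R) (rho : D -> L -> L).
Local Notation letter := (A + B)%type.

Definition same_side (l l' : letter) : bool :=
  match l, l' with inl _, inl _ | inr _, inr _ => true | _, _ => false end.

Definition letter_mul (l l' : letter) : option letter :=
  match l, l' with
  | inl a, inl a' => Some (inl (a * a'))
  | inr b, inr b' => Some (inr (b * b'))
  | _, _ => None
  end.

Definition letter_E (l : letter) : D :=
  match l with inl a => EA a | inr b => EB b end.

Definition letter_center (l : letter) : letter :=
  match l with inl a => inl (a - iA (EA a)) | inr b => inr (b - iB (EB b)) end.

Definition letter_lact (d : D) (l : letter) : letter :=
  match l with inl a => inl (iA d * a) | inr b => inr (iB d * b) end.

(* [E (l^* d l')]; the two summands of the letters are orthogonal. *)
Definition letter_ip (d : D) (l l' : letter) : option D :=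
  match l, l' with
  | inl a, inl a' => Some (EA (starA a * iA d * a'))
  | inr b, inr b' => Some (EB (starB b * iB d * b'))
  | _, _ => None
  end.

Definition fock_word (w : seq letter) : bool :=
  all (fun l => letter_E l == 0) w && sorted (fun l l' => ~~ same_side l l') w.

(* The inner product of [a1 (x) ... (x) an (x) x] with
   [d a1' (x) ... (x) an' (x) x']. *)
Fixpoint fock_ip (d : D) (w : seq letter) (x : L) (w' : seq letter) (x' : L)
    : R[i] :=
  match w, w' with
  | [::], [::] => ip x (rho d x')
  | l :: s, l' :: s' =>
      if letter_ip d l l' is Some d' then fock_ip d' s x s' x' else 0
  | _, _ => 0
  end.

Section action.
Variables (H : hilbertType R) (tens : seq letter -> L -> H).

(* The left action of [D] on elementary tensors. *)
Definition fock_lact (d : D) (w : seq letter) (x : L) : H :=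
  if w is l :: s then tens (letter_lact d l :: s) x else tens [::] (rho d x).

(* The image of [l (x) w (x) x] when [l] is split into its centered part and
   its expectation. *)
Definition fock_split (l : letter) (w : seq letter) (x : L) : H :=
  tens (letter_center l :: w) x + fock_lact (letter_E l) w x.

Definition fock_act (l : letter) (w : seq letter) (x : L) : H :=
  match w with
  | [::] => fock_split l [::] x
  | l' :: s =>
      if letter_mul l l' is Some l'' then fock_split l'' s x else fock_split l w x
  end.
End action.

Record fock_space := FockSpace {
  fock_H :> hilbertType R;
  fock_tensor : seq letter -> L -> fock_H;
  fock_op : letter -> fock_H -> fock_H;
  fock_tensor_ip : forall w x w' x', fock_word w -> fock_word w' ->
    ip (fock_tensor w x) (fock_tensor w' x') = fock_ip 1 w x w' x';
  fock_total : forall h,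
    (forall w x, fock_word w -> ip (fock_tensor w x) h = 0) -> h = 0;
  fock_op_bounded : forall l, bounded_op (fock_op l);
  fock_opE : forall l w x, fock_word w ->
    fock_op l (fock_tensor w x) = fock_act fock_tensor l w x }.

Definition reduced_amalgam (F : fock_space) : set (F -> F) :=
  cstar_gen (range (@fock_op F)).
End amalgam.

Arguments fock_op {R D A B starA starB iA iB EA EB L rho} F _ _ : rename.
Arguments reduced_amalgam {R D A B starA starB iA iB EA EB L rho} F _.

(** * The separated graph of [<a, b | a + b = a + b>] *)

Section graph.
Variable R : realType.
Local Notation C := (R[i]^o).

(* [C^3]; the coordinates are those on [w1], [w2] and [v], in this order, and
   the product is coordinatewise. *)
Local Notation graphD := (C * C * C)%type.

(* [M_2(C) x M_2(C)]; the edges [alpha_i] and [beta_i] of the graph are the matrix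
   units [e^(i)_10] of the two copies of this algebra in the free product. *)
Local Notation graphA := ('M[R[i]]_2 * 'M[R[i]]_2)%type.

Definition vertex_v : graphD := (0, 0, 1).

Definition mx_star (x : 'M[R[i]]_2) : 'M[R[i]]_2 := map_mx Num.conj x^T.

Definition graph_star (x : graphA) : graphA := (mx_star x.1, mx_star x.2).

(* [w_i] is sent to [e^(i)_00] and [v] to [e^(1)_11 + e^(2)_11]. *)
Definition graph_emb (d : graphD) : graphA :=
  (d.1.1 *: delta_mx 0 0 + d.2 *: delta_mx 1 1,
   d.1.2 *: delta_mx 0 0 + d.2 *: delta_mx 1 1).

Definition graph_E (x : graphA) : graphD :=
  (x.1 0 0, x.2 0 0, (x.1 1 1 + x.2 1 1) / 2).

Definition graph_rho (d x : graphD) : graphD := d * x.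

Definition graph_fock := fock_space graph_star graph_star graph_emb graph_emb
  graph_E graph_E graph_rho.

Definition graph_cstar_red (F : graph_fock) : set (F -> F) := reduced_amalgam F.

Definition proj_v (F : graph_fock) : F -> F :=
  fock_op F (inl (graph_emb vertex_v)).
End graph.

Arguments graph_cstar_red {R} F _.
Arguments proj_v {R} F _.

Definition freeZ2 : groupType := free_product int 'Z_2.

Definition freeZ2_sdprod_Z : groupType := sdprod_of (shift_action 'Z_2).

(* Main.v *)
Require Import Defs.
From mathcomp Require Import all_boot all_order all_algebra finmap.
From mathcomp Require Import complex ring lra zify.
From mathcomp Require Import all_classical all_reals all_analysis.

(** Write [a] and [b] for the sums of the two edges [alpha_i] and [beta_i]. In the corner
    at [v], [U = a b'] (with [b'] the adjoint of [b]) is a unitary, the difference [s] of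
    the projections [beta_i beta_i'] is a symmetry, and [s] and [U] are free: a nontrivial
    reduced word in [s] and the powers of [U] maps the vacuum vector of [v] to an
    elementary tensor orthogonal to it. Since the semidirect product in the statement is
    the free product of [Z_2] and [Z], this gives a unitary representation of that group
    for which the vacuum vector of [v] has an orthonormal orbit. The vector obtained by
    applying [b] to the normalized sum of the vacuum vectors of [w1] and [w2] also has an
    orthonormal orbit, and the two orbits form an orthonormal basis of the range of [v].
    The representation is thus an ampliation of the regular one. It generates the corner
    because the unitary [a + a'] exchanges [v] and [w1 + w2], so that the whole algebra
    consists of two by two matrices over the corner.

    The second isomorphism is implemented by the unitary that maps the basis vector at
    [(n, q)] to the one at [q] and [q^-1 n]. *)

Set Implicit Arguments.
Unset Strict Implicit.
Unset Printing Implicit Defensive.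
Import Order.TTheory GRing.Theory Num.Theory.
Local Open Scope ring_scope.
Local Open Scope classical_set_scope.

(** * Hilbert spaces and bounded operators *)

(** A [fock_space] is known only through the inner products of its elementary tensors, so linearity,
    balancing over C^3 and the relations between the letters must all be derived. For each side [b]
    the Fock space is therefore rewritten as a tensor product over C^3 of the algebra with the words
    that do not start on side [b]; there a letter of side [b] is a left multiplication.

    Spectral theory is avoided: the ampliation has a contractive left inverse, the compression to
    one copy of the regular representation, and this makes the image of a C*-algebra norm-closed.

    Two orbits are needed because C^3 is represented on itself: the vacuum vector of [v] only
    reaches tensors whose last factor is a multiple of [v]. One more vector is enough for both [w1]
    and [w2], since [s] turns the sum of their vacuum vectors, once moved under [v], into their
    difference. *)

Lemma invS_lt (R : archiRealFieldType) (e : R) : 0 < e ->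
  exists N, forall n, (N <= n)%N -> n.+1%:R^-1 < e.
Proof.
move=> e0; have := archi_boundP (ltW (_ : 0 < e^-1)); rewrite invr_gt0 => /(_ e0) h1.
exists (Num.bound e^-1) => n Nn; rewrite invf_plt ?posrE ?ltr0n//.
by apply: lt_le_trans h1 _; rewrite ler_nat; exact: leqW.
Qed.

Section hilbert.
Variables (R : realType) (H : hilbertType R).
Implicit Types x y z h : H.

Lemma ip0l x : ip 0 x = 0.
Proof. by rewrite (ip_conj x) ip0r rmorph0. Qed.

Lemma ip_lin_l x a y z : ip (a *: y + z) x = Num.conj a * ip y x + ip z x.
Proof. by rewrite ipDl ipZl. Qed.

Lemma ip_sumr (I : Type) (r : seq I) (P : pred I) (f : I -> H) x :
  ip x (\sum_(i <- r | P i) f i) = \sum_(i <- r | P i) ip x (f i).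
Proof. exact: (big_morph (ip x) (ipDr x) (ip0r x)). Qed.

Lemma ip_suml (I : Type) (r : seq I) (P : pred I) (f : I -> H) x :
  ip (\sum_(i <- r | P i) f i) x = \sum_(i <- r | P i) ip (f i) x.
Proof. exact: (big_morph (fun y => ip y x) (ipDl x) (ip0l x)). Qed.

Lemma ip_ext x y : (forall z, ip z x = ip z y) -> x = y.
Proof.
move=> e; apply/eqP; rewrite -subr_eq0; apply/eqP/ip_eq0.
by rewrite ipDr ipNr e subrr.
Qed.

Lemma nsq0 : nsq (0 : H) = 0.
Proof. by rewrite /nsq ip0r. Qed.

Lemma nsq_eq0 x : nsq x = 0 -> x = 0.
Proof. by move=> e; apply: ip_eq0; rewrite nsqE e. Qed.

Lemma Re_mulC (r : R) (z : R[i]) : complex.Re (r%:C%C * z) = r * complex.Re z.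
Proof. by case: z => a b /=; rewrite mul0r subr0. Qed.

Lemma ReN (z : R[i]) : complex.Re (- z) = - complex.Re z.
Proof. by case: z. Qed.

Lemma Re_ip_sym x y : complex.Re (ip x y) = complex.Re (ip y x).
Proof. by rewrite (ip_conj y x); case: (ip y x). Qed.

Lemma nsqZr (r : R) x : nsq (r%:C%C *: x) = r ^+ 2 * nsq x.
Proof.
rewrite nsqZ; congr (_ * _); rewrite normCK /=.
by rewrite mulrN mul0r oppr0 subr0 expr2.
Qed.

(** A weighted substitute for Cauchy-Schwarz: expand the nonnegative squared norms of [t x - y] and
    [t x + y]. *)
Lemma young (t : R) x y : 0 < t ->
  2 * `|complex.Re (ip x y)| <= t * nsq x + t^-1 * nsq y.
Proof.
move=> t0.
have h1 := nsq_ge0 (t%:C%C *: x - y); have h2 := nsq_ge0 (t%:C%C *: x + y).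
move: h1 h2; rewrite !nsqD nsqN ipNr !nsqZr ipZl.
have -> : Num.conj (t%:C%C : R[i]) = t%:C%C.
  by apply/eqP; rewrite eq_complex /= oppr0 !eqxx.
rewrite -mulrN !Re_mulC; set r := complex.Re (ip x y).
have -> : complex.Re (- ip x y) = - r by rewrite /r; case: (ip x y).
move=> h1 h2; rewrite -(ler_pM2l t0) mulrDr mulVKf ?gt_eqF//.
by case: (ler0P r) => _; nra.
Qed.

Lemma small_ip y (e : R) : 0 < e -> exists2 d : R, 0 < d &
  forall z, nsq z < d -> `|complex.Re (ip z y)| < e /\ `|complex.Im (ip z y)| < e.
Proof.
move=> e0; have n0 := nsq_ge0 y.
pose t := (nsq y + 1) / e; have t0 : 0 < t by rewrite divr_gt0// ltr_wpDl.
exists (e / t) => [|z hz]; first by rewrite divr_gt0.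
have key y' : nsq y' = nsq y -> `|complex.Re (ip z y')| < e.
  move=> ny; have := young z y' t0; rewrite ny.
  have : t * nsq z < e by rewrite mulrC -ltr_pdivlMr.
  have : t^-1 * nsq y < e.
    by rewrite mulrC ltr_pdivrMr// mulrC divfK ?gt_eqF//; lra.
  lra.
split; first exact: key.
have := key ('i%C *: y); rewrite nsqZ ipZr.
case: (ip z y) => a b.
rewrite (_ : complex.Re (`|'i%C| ^+ 2) = 1 :> R); last first.
  by rewrite normCK /= !mul0r mul1r opprK add0r.
by rewrite /= mul0r !mul1r add0r normrN; apply.
Qed.

Lemma small_eq0 (r : R) : (forall e, 0 < e -> `|r| < e) -> r = 0.
Proof.
move=> h; apply/eqP; apply/negPn/negP => r0.
by have := h `|r|; rewrite normr_gt0 ltxx => /(_ r0).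
Qed.

(** * Orthogonal projection onto a closed subspace *)

Lemma nsq_complete (u : nat -> H) :
  (forall e : R, 0 < e -> exists N, forall m n, (N <= m)%N -> (N <= n)%N ->
    nsq (u m - u n) < e) ->
  exists l, forall e : R, 0 < e -> exists N, forall n, (N <= n)%N -> nsq (u n - l) < e.
Proof.
move=> cu; have [|l Hl] := @ip_complete R H u.
  move=> [e e']; rewrite ltcE /= => /andP[/eqP-> /cu[N HN]].
  by exists N => m n Nm Nn; rewrite nsqE ltcE /= eqxx HN.
exists l => e e0; have [|N HN] := Hl e%:C%C; first by rewrite ltcE /= eqxx.
by exists N => n /HN; rewrite nsqE ltcE /= => /andP[].
Qed.

Definition closed_subspace (Q : H -> Prop) : Prop :=
  [/\ Q 0, forall a x y, Q x -> Q y -> Q (a *: x + y)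
    & forall h, (forall e : R, 0 < e -> exists2 y, Q y & nsq (h - y) < e) -> Q h].

Lemma closed_subspaceD Q x y : closed_subspace Q -> Q x -> Q y -> Q (x + y).
Proof. by case=> _ l _ ? ?; rewrite -[x]scale1r; exact: l. Qed.

Lemma closed_subspaceZ Q a x : closed_subspace Q -> Q x -> Q (a *: x).
Proof. by case=> q0 l _ ?; rewrite -[_ *: _]addr0; exact: l. Qed.

(** A sequence minimizing the distance from [h] to [Q] is Cauchy by the parallelogram law, and
    minimality at its limit gives orthogonality. *)
Lemma closed_projection (Q : H -> Prop) (h : H) : closed_subspace Q ->
  exists2 l, Q l & forall y, Q y -> ip y (h - l) = 0.
Proof.
move=> cQ; have [q0 lin cl] := cQ.
pose S := [set nsq (h - y) | y in [set y | Q y]].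
have hS : has_inf S.
  by split; [exists (nsq (h - 0)), 0 | exists 0 => _ [y _ <-]; exact: nsq_ge0].
pose d := inf S.
have dle y : Q y -> d <= nsq (h - y).
  by move=> qy; apply: ge_inf; [case: hS | exists y].
have /choice[u Hu] n : exists y, Q y /\ nsq (h - y) < d + n.+1%:R^-1.
  have [|_ [y qy <-] ?] := @inf_adherent _ S n.+1%:R^-1 _ hS.
    by rewrite invr_gt0 ltr0n.
  by exists y.
have [|l Hl] := @nsq_complete u.
  move=> e e0; have [|N HN] := @invS_lt R (e / 4); first by rewrite divr_gt0.
  exists N => m n /HN hm /HN hn.
  (* Midpoints stay in [Q], so the parallelogram law bounds [nsq (u m - u n)] by twice the sum of
     the excesses of [nsq (h - u m)] and [nsq (h - u n)] over [d]. *)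
  have qm : Q (2^-1%:C%C *: (u m + u n)).
    apply: closed_subspaceZ => //; apply: closed_subspaceD => //; exact: (Hu _).1.
  have := dle _ qm.
  have -> : h - 2^-1%:C%C *: (u m + u n) = 2^-1%:C%C *: ((h - u m) + (h - u n)).
    rewrite addrACA -opprD scalerBr; congr (_ - _).
    have -> : h + h = (2 : R)%:C%C *: h by rewrite rmorph_nat scaler_nat.
    by rewrite scalerA -rmorphM mulVf ?pnatr_eq0// rmorph1 scale1r.
  have -> : u m - u n = (h - u n) - (h - u m) by rewrite opprB [RHS]addrC addrA subrK.
  have := (Hu m).2; have := (Hu n).2.
  set x := h - u m; set y := h - u n.
  rewrite nsqZr [nsq (x + y)]nsqD [nsq (y - x)]nsqD nsqN ipNr ReN (Re_ip_sym y).
  rewrite (_ : 2^-1 ^+ 2 = 4^-1 :> R); last by rewrite exprVn -natrX.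
  move: hm hn; move: (m.+1%:R^-1) (n.+1%:R^-1) => a b; lra.
have ql : Q l.
  apply: cl => e /Hl[N HN]; exists (u N); first exact: (Hu N).1.
  by rewrite nsqBC; exact: HN.
(* This is [nsq (h - l) <= nsq (h - (l + y))] in expanded form, proved by comparing [u n] with
   [u n + y] for large [n]. *)
have var y : Q y -> 2 * complex.Re (ip y (h - l)) <= nsq y.
  move=> qy; rewrite leNgt; apply/negP => lt.
  pose e := (2 * complex.Re (ip y (h - l)) - nsq y) / 4.
  have e0 : 0 < e by rewrite divr_gt0// subr_gt0.
  have [t t0 Ht] := small_ip y e0; have [N HN] := Hl t t0; have [M HM] := invS_lt e0.
  pose n := maxn N M.
  have hq : Q (u n + y) by apply: closed_subspaceD => //; exact: (Hu n).1.
  have [] := Ht _ (HN n (leq_maxl _ _)); rewrite Re_ip_sym ltr_norml => /andP[h1 h2] _.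
  have := dle _ hq; rewrite opprD addrA.
  have := (Hu n).2; have := HM n (leq_maxr _ _).
  have E : ip y (h - u n) = ip y (h - l) - ip y (u n - l).
    by rewrite -ipNr -ipDr; congr ip; rewrite opprB addrA subrK.
  set x := h - u n in E *; rewrite [nsq (x - y)]nsqD nsqN ipNr ReN Re_ip_sym E.
  move: (n.+1%:R^-1) e0 h1 h2 => a; rewrite /e; move: (nsq x) (nsq y).
  by case: (ip y (h - l)) => p q; case: (ip y _) => p' q' nx ny /=; lra.
exists l => // y qy.
have re y' : Q y' -> complex.Re (ip y' (h - l)) = 0.
  move=> qy'; apply: small_eq0 => e e0.
  (* For a real multiple [t y'] the left side of [var] is linear in [t] and the right side
     quadratic; a small [t] of either sign bounds the real part by [e]. *)
  have := var _ (closed_subspaceZ (e / (nsq y' + 1))%:C%C cQ qy').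
  have := var _ (closed_subspaceZ (- (e / (nsq y' + 1)))%:C%C cQ qy').
  have n0 := nsq_ge0 y'.
  have t0 : 0 < e / (nsq y' + 1) by rewrite divr_gt0// ltr_wpDl.
  have te : e / (nsq y' + 1) * nsq y' < e.
    by rewrite mulrAC ltr_pdivrMr ?ltr_wpDl// ltr_pM2l//; lra.
  move: t0 te; set t := e / _ => t0 te.
  rewrite !nsqZr !ipZl.
  have cj (r : R) : Num.conj (r%:C%C : R[i]) = r%:C%C.
    by apply/eqP; rewrite eq_complex /= oppr0 !eqxx.
  rewrite !cj !Re_mulC sqrrN mulNr mulrN; set r := complex.Re _ => h1 h2.
  have h1' : - (2 * r) <= t * nsq y' by rewrite -(ler_pM2l t0); move: h1; rewrite expr2; lra.
  have h2' : 2 * r <= t * nsq y' by rewrite -(ler_pM2l t0); move: h2; rewrite expr2; lra.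
  by rewrite ltr_norml; apply/andP; split; lra.
have := re _ qy; have := re _ (closed_subspaceZ 'i%C cQ qy); rewrite ipZl.
case: (ip y (h - l)) => a b /=; rewrite mul0r add0r mulN1r opprK => -> ->.
by [].
Qed.

(** The projection of [h] onto [Q] differs from [h] by a vector orthogonal to [Q]. This serves as an
    induction principle: identities between bounded operators are checked on a total family only. *)
Lemma closed_total (Q : H -> Prop) (h : H) : closed_subspace Q ->
  (forall x, (forall y, Q y -> ip y x = 0) -> x = 0) -> Q h.
Proof.
move=> cQ tot; have [l ql /tot /eqP] := closed_projection h cQ.
by rewrite subr_eq0 => /eqP->.
Qed.

End hilbert.

Section bounded_operators.
Variable R : realType.
Implicit Types H K L : hilbertType R.

Definition linear_op H K (T : H -> K) :=
  forall (a : R[i]) x y, T (a *: x + y) = a *: T x + T y.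

(** Equivalent to [bounded_op] when [H = K]; the real bound on squared norms keeps complex square
    roots out of the estimates. *)
Definition bop H K (T : H -> K) :=
  linear_op T /\ exists2 C : R, 0 <= C & forall x, nsq (T x) <= C * nsq x.

Section linear.
Variables (H K : hilbertType R) (T : H -> K).
Hypothesis linT : linear_op T.

Lemma linop0 : T 0 = 0.
Proof.
have := linT 1 0 0; rewrite !scale1r addr0 => /eqP.
by rewrite -subr_eq0 opprD addrA subrr sub0r oppr_eq0 => /eqP.
Qed.

Lemma linopD x y : T (x + y) = T x + T y.
Proof. by rewrite -[x]scale1r linT !scale1r. Qed.

Lemma linopZ a x : T (a *: x) = a *: T x.
Proof. by rewrite -[_ *: _]addr0 linT linop0 addr0. Qed.

Lemma linopB x y : T (x - y) = T x - T y.
Proof. by rewrite linopD -scaleN1r linopZ scaleN1r. Qed.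

Lemma linop_sum (I : Type) (r : seq I) (P : pred I) (f : I -> H) :
  T (\sum_(i <- r | P i) f i) = \sum_(i <- r | P i) T (f i).
Proof. exact: (big_morph T linopD linop0). Qed.
End linear.

Lemma bop_lin H K (T : H -> K) : bop T -> linear_op T.
Proof. by case. Qed.

Lemma hnorm_nsq H (x : H) : hnorm x ^+ 2 = (nsq x)%:C%C.
Proof. by rewrite /hnorm sqrtCK nsqE. Qed.

Lemma hnorm_ge0 H (x : H) : 0 <= hnorm x.
Proof. by rewrite /hnorm sqrtC_ge0 ip_ge0. Qed.

Lemma hnorm_le H K (x : H) (y : K) (C : R) : 0 <= C ->
  nsq x <= C * nsq y -> hnorm x <= sqrtC C%:C%C * hnorm y.
Proof.
move=> C0 le; rewrite -(@ler_pXn2r _ 2)// ?nnegrE ?mulr_ge0 ?sqrtC_ge0 ?hnorm_ge0 ?ip_ge0 ?lecR//.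
by rewrite exprMn !hnorm_nsq sqrtCK -rmorphM lecR.
Qed.

Lemma nsq_le H K (x : H) (y : K) (c : R[i]) : hnorm x <= c * hnorm y ->
  nsq x <= complex.Re (`|c| ^+ 2) * nsq y.
Proof.
move=> le; have {}le : hnorm x <= `|c| * hnorm y.
  have := le_trans (hnorm_ge0 x) le; move/ger0_norm; rewrite normrM (ger0_norm (hnorm_ge0 y)).
  by move=> ->.
have := le; rewrite -(@ler_pXn2r _ 2)// ?nnegrE ?mulr_ge0 ?hnorm_ge0//.
rewrite exprMn !hnorm_nsq.
have : 0 <= `|c| ^+ 2 by rewrite exprn_ge0.
case: (`|c| ^+ 2) => a b; rewrite lecE /= => /andP[/eqP-> _].
by rewrite -[(a +i* 0)%C]/(a%:C%C) -rmorphM lecR.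
Qed.

Lemma bopP H (T : H -> H) : bounded_op T <-> bop T.
Proof.
split=> [[lT [c hc]]|[lT [C C0 hC]]]; split=> //.
  exists (complex.Re (`|c| ^+ 2)) => [|x]; last exact: nsq_le.
  have : 0 <= `|c| ^+ 2 by rewrite exprn_ge0.
  by rewrite lecE => /andP[].
by exists (sqrtC C%:C%C) => x; exact: hnorm_le.
Qed.

Lemma bop_comp H K L (S : K -> L) (T : H -> K) : bop S -> bop T -> bop (S \o T).
Proof.
move=> [lS [C C0 hC]] [lT [D D0 hD]]; split=> [a x y|]; first by rewrite /= lT lS.
exists (C * D) => [|x]; first exact: mulr_ge0.
by rewrite (le_trans (hC _))// -mulrA ler_wpM2l.
Qed.

Lemma bop_id H : bop (@id H).
Proof. by split=> //; exists 1 => // x; rewrite mul1r. Qed.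

Lemma bop0 H K : bop (fun _ : H => 0 : K).
Proof.
split=> [a x y|]; first by rewrite scaler0 addr0.
by exists 0 => // x; rewrite nsq0 mul0r.
Qed.

Lemma bopZD H K a (S T : H -> K) : bop S -> bop T -> bop (fun x => a *: S x + T x).
Proof.
move=> [lS [C C0 hC]] [lT [D D0 hD]]; split=> [b x y|].
  by rewrite lS lT !scalerDr addrACA !scalerA [a * b]mulrC.
have a0 : 0 <= complex.Re (`|a| ^+ 2).
  have : 0 <= `|a| ^+ 2 by rewrite exprn_ge0.
  by rewrite lecE => /andP[].
exists (2 * (complex.Re (`|a| ^+ 2) * C) + 2 * D) => [|x].
  by rewrite addr_ge0 ?mulr_ge0.
apply: le_trans (nsqD_le _ _) _; rewrite [leRHS]mulrDl lerD//; last first.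
  by rewrite -mulrA ler_pM2l.
by rewrite -2!mulrA ler_pM2l// nsqZ ler_wpM2l.
Qed.

Lemma bopD H K (S T : H -> K) : bop S -> bop T -> bop (fun x => S x + T x).
Proof.
move=> bS bT; rewrite (_ : (fun _ => _) = (fun x => 1 *: S x + T x)); first exact: bopZD.
by apply/funext => x; rewrite scale1r.
Qed.

Lemma bopB H K (S T : H -> K) : bop S -> bop T -> bop (fun x => S x - T x).
Proof.
move=> bS bT; rewrite (_ : (fun _ => _) = (fun x => -1 *: T x + S x)); first exact: bopZD.
by apply/funext => x; rewrite scaleN1r addrC.
Qed.

Lemma bop_sum H K (I : Type) (r : seq I) (f : I -> H -> K) :
  (forall i, bop (f i)) -> bop (fun x => \sum_(i <- r) f i x).
Proof.
move=> bf; elim: r => [|i r IH].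
  rewrite (_ : (fun _ => _) = fun=> 0); first exact: bop0.
  by apply/funext => x; rewrite big_nil.
rewrite (_ : (fun _ => _) = fun x => f i x + \sum_(j <- r) f j x); first exact: bopD.
by apply/funext => x; rewrite big_cons.
Qed.

Lemma bop_cvg H K (T : H -> K) (e : R) : bop T -> 0 < e ->
  exists2 d, 0 < d & forall x, nsq x < d -> nsq (T x) < e.
Proof.
move=> [_ [C C0 hC]] e0; have C1 : 0 < C + 1 by rewrite ltr_wpDl.
exists (e / (C + 1)) => [|x hx]; first by rewrite divr_gt0.
apply: le_lt_trans (hC x) _; rewrite ltr_pdivlMr// mulrC in hx.
by apply: le_lt_trans hx; rewrite ler_wpM2r ?nsq_ge0// lerDl.
Qed.

Lemma closed_ker H K (T : H -> K) : bop T -> closed_subspace (fun x => T x = 0).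
Proof.
move=> bT; have lT := bop_lin bT; split=> [|a x y ex ey|h hh]; first exact: linop0.
  by rewrite lT ex ey scaler0 addr0.
apply: nsq_eq0; apply: small_eq0 => e e0; rewrite ger0_norm ?nsq_ge0//.
have [d d0 Hd] := bop_cvg bT e0; have [y ey /Hd] := hh _ d0.
by rewrite linopB// ey subr0.
Qed.

Lemma closed_eq H K (S T : H -> K) : bop S -> bop T -> closed_subspace (fun x => S x = T x).
Proof.
move=> bS bT; have := closed_ker (bopB bS bT).
rewrite (_ : (fun _ => _) = (fun x => S x = T x))//; apply/funext => x; apply/propext.
by split=> [/eqP|->]; rewrite ?subrr// subr_eq0 => /eqP.
Qed.

(** Both sides are conjugate-linear in [x], which still gives a complex subspace. Adjoint relations
    are extended from a total family in this way. *)
Lemma closed_ip H K L (S : H -> K) (T : H -> L) y z : bop S -> bop T ->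
  closed_subspace (fun x => ip (S x) y = ip (T x) z).
Proof.
move=> bS bT; have lS := bop_lin bS; have lT := bop_lin bT.
split=> [|a x x' ex ex'|h hh].
- by rewrite !linop0// !ip0l.
- by rewrite lS lT !ip_lin_l ex ex'.
have key (e : R) : 0 < e -> `|complex.Re (ip (S h) y - ip (T h) z)| < e /\
    `|complex.Im (ip (S h) y - ip (T h) z)| < e.
  move=> e0; have e2 : 0 < e / 2 by rewrite divr_gt0.
  have [d d0 Hd] := small_ip y e2; have [d' d0' Hd'] := small_ip z e2.
  have [c c0 Hc] := bop_cvg bS d0; have [c' c0' Hc'] := bop_cvg bT d0'.
  have [|x ex] := hh (Num.min c c'); first by rewrite lt_min c0 c0'.
  rewrite lt_min => /andP[/Hc/Hd h1 /Hc'/Hd' h2]; move: h1 h2.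
  rewrite !linopB// !ipDl !ipNl ex.
  case: (ip (S h) y) (ip (T h) z) (ip (T x) z) => a b [a' b'] [a'' b''] /=.
  by rewrite !ltr_norml => -[/andP[? ?] /andP[? ?]] [/andP[? ?] /andP[? ?]];
     split; apply/andP; split; lra.
apply/eqP; rewrite -subr_eq0 eq_complex; apply/andP; split; apply/eqP.
  by apply: small_eq0 => e /key[].
by apply: small_eq0 => e /key[].
Qed.

Definition adj H K (T : H -> K) (S : K -> H) := forall x y, ip (T x) y = ip x (S y).

Lemma adj_sym H K (T : H -> K) (S : K -> H) : adj T S -> adj S T.
Proof. by move=> a x y; rewrite (ip_conj y) -a -ip_conj. Qed.

Lemma adj_unique H K (T : H -> K) (S S' : K -> H) : adj T S -> adj T S' -> S = S'.
Proof. by move=> a a'; apply/funext => y; apply: ip_ext => z; rewrite -a a'. Qed.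

End bounded_operators.

(** * Operators between spaces of square-summable families *)

Section ell2_maps.
Variable R : realType.

Section delta.
Variables (I : choiceType) (V : hilbertType R).
Local Notation l2 := (ell2 I V).

Lemma ell2_ofE (f : I -> V) (M : R) :
  (forall F : {fset I}, \sum_(i <- F) nsq (f i) <= M) -> ell2_of f = f :> (I -> V).
Proof.
move=> h; have Pf : ell2_pred f by apply/asboolP/sq_summableP; exists M.
exact: (insubdK _ Pf).
Qed.

Lemma nsq_sum_le (x : l2) (F : {fset I}) : \sum_(i <- F) nsq (x i) <= nsq x.
Proof.
rewrite -lecR -nsqE; apply: le_trans (ell2_partial_le x F).
by rewrite rmorph_sum ler_sum// => i _; rewrite nsqE.
Qed.

Lemma nsq_le_sum (x : l2) (M : R) :
  (forall F : {fset I}, \sum_(i <- F) nsq (x i) <= M) -> nsq x <= M.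
Proof.
move=> h; rewrite -lecR -nsqE; apply: ell2_ip_le => F.
rewrite (eq_bigr (fun i => (nsq (x i))%:C%C)) => [|i _]; last exact: nsqE.
by rewrite -rmorph_sum lecR.
Qed.

Lemma sum_fset1 (F : {fset I}) (i : I) (c : R) :
  \sum_(j <- F) (if j == i then c else 0) = if i \in F then c else 0.
Proof.
case: ifP => [iF|/negP iF].
  rewrite (big_fsetD1 i)//= eqxx big1_seq ?addr0// => j /= /fsetD1P[/negPf-> _].
  by [].
by rewrite big1_seq// => j /= jF; case: eqP => // e; rewrite -e jF in iF.
Qed.

Lemma ell2_linE a (x y : l2) i : (a *: x + y) i = a *: x i + y i.
Proof. reflexivity. Qed.

(* The operators [dl], [rx] and [ell2_map] are sealed, as unification would
   otherwise compare them by unfolding [ell2_of]. *)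
Fact dl_sig : {d : I -> V -> l2 | forall i v j, d i v j = if j == i then v else 0}.
Proof.
exists (fun i v => ell2_of (fun j => if j == i then v else 0)) => i v j.
rewrite (@ell2_ofE _ (nsq v))// => F.
rewrite (eq_bigr (fun j => if j == i then nsq v else 0)) => [|k _].
  by rewrite sum_fset1; case: ifP => //; rewrite nsq_ge0.
by case: ifP => // _; rewrite nsq0.
Qed.

Definition dl : I -> V -> l2 := sval dl_sig.

Lemma dlE i v j : dl i v j = if j == i then v else 0.
Proof. exact: (svalP dl_sig). Qed.

Lemma ip_dl i v (x : l2) : ip (dl i v) x = ip v (x i).
Proof.
apply: ell2_ipE => e e0; exists [fset i]%fset => F; rewrite fsub1set => iF.
rewrite (big_fsetD1 i)//= dlE eqxx big1_seq ?addr0 ?subrr ?normr0// => j /=.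
by move=> /fsetD1P[/negPf ji _]; rewrite dlE ji ip0l.
Qed.

Lemma ell2_ind (Q : l2 -> Prop) (x : l2) : closed_subspace Q ->
  (forall i v, Q (dl i v)) -> Q x.
Proof.
move=> cQ Qd; apply: closed_total => // y hy; apply: ell2_ext => i.
by apply: ip_eq0; rewrite -ip_dl hy.
Qed.
End delta.

Section reindex.
Variable V : hilbertType R.

(** Left translations and the operators [gperm] are both reindexings, so their boundedness and their
    effect on basis vectors are settled once for all. *)
Fact rx_sig (I J : choiceType) : {r : (I -> J) -> ell2 J V -> ell2 I V |
  forall f x, r f x = ell2_of (fun i => x (f i))}.
Proof. by exists (fun f x => ell2_of (fun i => x (f i))). Qed.

Definition rx (I J : choiceType) : (I -> J) -> ell2 J V -> ell2 I V := sval (rx_sig I J).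

Lemma rx_def (I J : choiceType) : @rx I J = fun (f : I -> J) x => ell2_of (fun i => x (f i)).
Proof. by apply/funext => f; apply/funext => x; exact: (svalP (rx_sig I J)). Qed.

Section inj.
Variables (I J : choiceType) (f : I -> J).
Hypothesis injf : injective f.

Lemma sum_rx_le (x : ell2 J V) (F : {fset I}) : \sum_(i <- F) nsq (x (f i)) <= nsq x.
Proof.
rewrite (le_trans _ (nsq_sum_le x [fset f i | i in F]%fset))//.
by rewrite big_imfset//= => i j _ _ /injf.
Qed.

Lemma rxE x i : rx f x i = x (f i).
Proof. by rewrite rx_def (ell2_ofE (sum_rx_le x)). Qed.

Lemma nsq_rx_le x : nsq (rx f x) <= nsq x.
Proof. by apply: nsq_le_sum => F; under eq_bigr do rewrite rxE; exact: sum_rx_le. Qed.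

Lemma bop_rx : bop (rx f).
Proof.
split=> [a x y|]; last by exists 1 => // x; rewrite mul1r nsq_rx_le.
by apply: ell2_ext => i; rewrite rxE !ell2_linE !rxE.
Qed.
End inj.

Lemma rx_comp (I J K : choiceType) (f : I -> J) (g : J -> K) x :
  injective f -> injective g -> rx f (rx g x) = rx (g \o f) x.
Proof.
move=> injf injg; apply: ell2_ext => i.
by rewrite !rxE//; exact: inj_comp.
Qed.

Lemma rx_dl (I J : choiceType) (f : I -> J) (g : J -> I) : cancel f g -> cancel g f ->
  forall j v, rx f (dl j v) = dl (g j) v.
Proof.
move=> fg gf j v; apply: ell2_ext => i; rewrite rxE; last exact: can_inj fg.
by rewrite !dlE (can2_eq fg gf).
Qed.

Lemma adj_rx (I J : choiceType) (f : I -> J) (g : J -> I) : cancel f g -> cancel g f ->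
  adj (rx f) (rx g).
Proof.
move=> fg gf x y; have injf := can_inj fg; have injg := can_inj gf.
apply: (ell2_ind (Q := fun x => ip (rx f x) y = ip (id x) (rx g y))) => [|j v].
  by apply: closed_ip; [exact: bop_rx | exact: bop_id].
by rewrite (rx_dl fg gf) !ip_dl rxE.
Qed.
End reindex.

Fact ell2_map_sig (I : choiceType) (V V' : hilbertType R) :
  {m : (I -> V -> V') -> ell2 I V -> ell2 I V' |
    forall T x, m T x = ell2_of (fun i => T i (x i))}.
Proof. by exists (fun T x => ell2_of (fun i => T i (x i))). Qed.

Definition ell2_map (I : choiceType) (V V' : hilbertType R) :
  (I -> V -> V') -> ell2 I V -> ell2 I V' := sval (ell2_map_sig I V V').

Lemma ell2_map_def (I : choiceType) (V V' : hilbertType R) :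
  @ell2_map I V V' = fun (T : I -> V -> V') x => ell2_of (fun i => T i (x i)).
Proof. by apply/funext => f; apply/funext => x; exact: (svalP (ell2_map_sig I V V')). Qed.

Section pointwise.
Variables (I : choiceType) (V V' : hilbertType R) (T : I -> V -> V') (C : R).
Hypothesis C0 : 0 <= C.
Hypothesis hT : forall i v, nsq (T i v) <= C * nsq v.


Lemma sum_map_le (x : ell2 I V) (F : {fset I}) :
  \sum_(i <- F) nsq (T i (x i)) <= C * nsq x.
Proof.
apply: (@le_trans _ _ (\sum_(i <- F) C * nsq (x i))); first by rewrite ler_sum.
by rewrite -mulr_sumr ler_wpM2l// nsq_sum_le.
Qed.

Lemma ell2_mapE x i : ell2_map T x i = T i (x i).
Proof. by rewrite ell2_map_def (ell2_ofE (sum_map_le x)). Qed.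

Lemma nsq_map_le x : nsq (ell2_map T x) <= C * nsq x.
Proof. by apply: nsq_le_sum => F; under eq_bigr do rewrite ell2_mapE; exact: sum_map_le. Qed.
End pointwise.
End ell2_maps.

(** * Star homomorphisms and C*-algebras of operators *)

Section cstar.
Variable R : realType.
Implicit Types H K : hilbertType R.

Lemma cstarI H (M : set (H -> H)) :
  (forall T, M T -> bop T) -> M (fun=> 0) ->
  (forall (a : R[i]) S T, M S -> M T -> M (fun x => a *: S x + T x)) ->
  (forall S T, M S -> M T -> M (S \o T)) ->
  (forall S T, M T -> bop S -> adj T S -> M S) ->
  (forall T, bop T -> (forall e : R, 0 < e ->
      exists2 S, M S & forall x, nsq (T x - S x) <= e * nsq x) -> M T) ->
  cstar_algebra M.
Proof.
move=> Mb M0 Ml Mc Ma Mcl; split=> //.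
- by move=> T /Mb/bopP.
- by move=> S T MT /bopP bS; exact: Ma.
- move=> T /bopP bT h; apply: Mcl => // e e0.
  have [|S MS hS] := h (sqrtC e%:C%C); first by rewrite sqrtC_gt0 ltcR.
  exists S => // x; have := nsq_le (hS x).
  by rewrite ger0_norm ?sqrtC_ge0 ?lecR ?(ltW e0)// sqrtCK.
Qed.

Lemma cstar_bop H (M : set (H -> H)) T : cstar_algebra M -> M T -> bop T.
Proof. by case=> b _ _ _ _ /b/bopP. Qed.

Lemma cstar_cvg H (M : set (H -> H)) T : cstar_algebra M -> bop T ->
  (forall e : R, 0 < e -> exists2 S, M S & forall x, nsq (T x - S x) <= e * nsq x) -> M T.
Proof.
move=> [_ _ _ _ c] bT h; apply: c; first exact/bopP.
move=> [e e']; rewrite ltcE /= => /andP[/eqP-> e0].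
have [|S MS hS] := h (e ^+ 2); first by rewrite exprn_gt0.
exists S => // x; apply: le_trans (hnorm_le _ (hS x)) _; first by rewrite sqr_ge0.
by rewrite rmorphXn sqrCK// lecR ltW.
Qed.

Lemma cstar_adj H (M : set (H -> H)) S T : cstar_algebra M -> M T -> bop S -> adj T S -> M S.
Proof. by move=> [_ _ _ a _] MT bS; apply: a => //; exact/bopP. Qed.

Lemma cstar0 H (M : set (H -> H)) : cstar_algebra M -> M (fun=> 0).
Proof. by case=> _ []. Qed.

Lemma cstarZD H (M : set (H -> H)) : cstar_algebra M ->
  forall (a : R[i]) S T, M S -> M T -> M (fun x => a *: S x + T x).
Proof. by case=> _ []. Qed.

Lemma cstarD H (M : set (H -> H)) : cstar_algebra M ->
  forall S T, M S -> M T -> M (fun x => S x + T x).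
Proof.
move=> cM S T MS MT; have := cstarZD cM 1 MS MT.
by under eq_fun do rewrite scale1r.
Qed.

Lemma cstarM H (M : set (H -> H)) : cstar_algebra M ->
  forall S T, M S -> M T -> M (S \o T).
Proof. by case. Qed.

Lemma cstar_sum H (M : set (H -> H)) (I : Type) (r : seq I) (f : I -> H -> H) :
  cstar_algebra M -> (forall i, M (f i)) -> M (fun x => \sum_(i <- r) f i x).
Proof.
move=> cM Mf; elim: r => [|i r IH].
  by under eq_fun do rewrite big_nil; exact: cstar0.
under eq_fun do rewrite big_cons.
exact: cstarD.
Qed.

Lemma cstar_all H : cstar_algebra (@bop R H H).
Proof.
apply: cstarI => //; [exact: bop0|exact: bopZD|move=> *; exact: bop_comp].
Qed.

Lemma cstar_gen_sub H (X : set (H -> H)) T : X T -> cstar_gen X T.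
Proof. by move=> XT M _; exact. Qed.

Lemma cstar_gen_min H (X : set (H -> H)) (M : set (H -> H)) : cstar_algebra M ->
  X `<=` M -> cstar_gen X `<=` M.
Proof. by move=> cM XM T; exact. Qed.

Lemma cstar_genP H (X : set (H -> H)) : (forall T, X T -> bop T) ->
  cstar_algebra (cstar_gen X).
Proof.
move=> Xb; apply: cstarI.
- by move=> T; apply; first exact: cstar_all.
- by move=> M cM _; exact: cstar0.
- by move=> a S T hS hT M cM XM; apply: cstarZD => //; [exact: hS|exact: hT].
- by move=> S T hS hT M cM XM; apply: cstarM => //; [exact: hS|exact: hT].
- by move=> S T hT bS aTS M cM XM; apply: cstar_adj bS aTS => //; exact: hT.
- move=> T bT h M cM XM; apply: cstar_cvg => // e /h[S hS ?]; exists S => //; exact: hS.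
Qed.

(** Contractivity, the last clause, is part of the definition rather than a consequence of
    multiplicativity: compressions have it without being multiplicative. *)
Definition star_linear H K (f : (K -> K) -> H -> H) : Prop :=
  [/\ forall S, bop S -> bop (f S),
      forall (a : R[i]) S T, bop S -> bop T ->
        f (fun x => a *: S x + T x) = (fun y => a *: f S y + f T y),
      forall S T, bop S -> bop T -> adj S T -> adj (f S) (f T)
    & forall S (e : R), bop S -> 0 <= e -> (forall x, nsq (S x) <= e * nsq x) ->
        forall y, nsq (f S y) <= e * nsq y].

Definition star_hom H K (f : (K -> K) -> H -> H) : Prop :=
  star_linear f /\ forall S T, bop S -> bop T -> f (S \o T) = f S \o f T.

Section star_linear.
Variables (H K : hilbertType R) (f : (K -> K) -> H -> H).
Hypothesis hf : star_linear f.

Lemma star_linear0 : f (fun=> 0) = fun=> 0.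
Proof.
have [_ l _ _] := hf; have := l (-1) id id (@bop_id _ K) (@bop_id _ K).
have -> : (fun x : K => -1 *: id x + id x) = fun=> 0.
  by apply/funext => x; rewrite scaleN1r addNr.
by move=> e; apply/funext => y; rewrite e /= scaleN1r addNr.
Qed.

Lemma star_linearB S T y : bop S -> bop T -> f S y - f T y = f (fun x => S x - T x) y.
Proof.
have [_ l _ _] := hf; move=> bS bT.
have -> : (fun x => S x - T x) = fun x => -1 *: T x + S x.
  by apply/funext => x; rewrite scaleN1r addrC.
by rewrite l//= scaleN1r addrC.
Qed.

Lemma star_linear_contract S T (e : R) : bop S -> bop T -> 0 <= e ->
  (forall x, nsq (S x - T x) <= e * nsq x) ->
  forall y, nsq (f S y - f T y) <= e * nsq y.
Proof.
have [_ _ _ c] := hf; move=> bS bT e0 h y; rewrite star_linearB//.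
by apply: c => //; exact: bopB.
Qed.
End star_linear.

(** Together with [cstar_gen_min], this shows that [f] maps a generated C*-algebra into [M] by
    looking at the generators only. *)
Lemma cstar_preimage H K (f : (K -> K) -> H -> H) (M : set (H -> H)) :
  star_hom f -> cstar_algebra M -> cstar_algebra [set S | bop S /\ M (f S)].
Proof.
move=> [hf fM] cM; have [fb fl fa _] := hf; apply: cstarI.
- by move=> T [].
- by split; [exact: bop0 | rewrite (star_linear0 hf); exact: cstar0].
- by move=> a S T [bS MS] [bT MT]; split; [exact: bopZD | rewrite fl//; exact: cstarZD].
- by move=> S T [bS MS] [bT MT]; split; [exact: bop_comp | rewrite fM//; exact: cstarM].
- move=> S T [bT MT] bS a; split=> //.
  by apply: (cstar_adj cM MT); [exact: fb | exact: fa].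
- move=> T bT h; split=> //; apply: (cstar_cvg cM); first exact: fb.
  move=> e e0; have [S [bS MS] hS] := h e e0; exists (f S) => //.
  by apply: star_linear_contract => //; exact: ltW.
Qed.

Section isomorphism.
Variables (H K : hilbertType R) (f : (K -> K) -> H -> H) (g : (H -> H) -> K -> K).
Hypotheses (hf : star_hom f) (hg : star_linear g) (gf : forall S, bop S -> g (f S) = S).
Variable N : set (K -> K).
Hypothesis cN : cstar_algebra N.

(** The image is closed because of [g]: if the [f S] approximate [T], then the [S = g (f S)]
    approximate [g T], which is thus in [N], and [T = f (g T)]. *)
Lemma cstar_image : cstar_algebra [set f S | S in N].
Proof.
have [lf fM] := hf; have [fb fl fa fc] := lf; have [gb gl ga gc] := hg.
have Nb S : N S -> bop S := cstar_bop cN.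
apply: cstarI.
- by move=> _ [S NS <-]; exact/fb/Nb.
- by exists (fun=> 0); [exact: cstar0 | exact: star_linear0].
- move=> a _ _ [S NS <-] [T NT <-]; exists (fun x => a *: S x + T x).
    exact: cstarZD.
  by rewrite fl//; exact: Nb.
- move=> _ _ [S NS <-] [T NT <-]; exists (S \o T); first exact: cstarM.
  by rewrite fM//; exact: Nb.
- move=> T' _ [S NS <-] bT' a; have bS := Nb _ NS.
  have a' : adj S (g T') by rewrite -{1}(gf bS); apply: ga => //; exact: fb.
  exists (g T'); first by apply: (cstar_adj cN NS) => //; exact: gb.
  by apply: adj_unique a; apply: fa => //; exact: gb.
- move=> T bT h; exists (g T).
    apply: (cstar_cvg cN); first exact: gb.
    move=> e e0; have [_ [S NS <-] hS] := h e e0; exists S => // x.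
    rewrite -[S x]/(id S x) -[id S](gf (Nb _ NS)).
    by apply: star_linear_contract => //; [exact/fb/Nb | exact: ltW].
  (* Both [T] and [f (g T)] are approximated by the same [f S]. The two errors give at most
     [4 * d * nsq y], which is below [e] by the choice of [d]. *)
  apply/funext => y; apply/eqP; rewrite -subr_eq0; apply/eqP/nsq_eq0/small_eq0 => e e0.
  rewrite ger0_norm ?nsq_ge0//.
  have n0 := nsq_ge0 y.
  pose d := e / (4 * nsq y + 1); have d0 : 0 < d by rewrite divr_gt0// ltr_wpDl// mulr_ge0.
  have [_ [S NS <-] hS] := h d d0; have bS := Nb _ NS.
  have h1 : nsq (f (g T) y - f S y) <= d * nsq y.
    apply: star_linear_contract => //; [exact: gb | exact: ltW|] => x.
    rewrite -[S x]/(id S x) -[id S](gf bS).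
    by apply: star_linear_contract => //; [exact/fb | exact: ltW].
  have := nsqD_le (f (g T) y - f S y) (f S y - T y); rewrite addrA subrK => h2.
  have := hS y; rewrite nsqBC => h3.
  have : d * (4 * nsq y + 1) = e by rewrite divfK// gt_eqF// ltr_wpDl// mulr_ge0.
  lra.
Qed.

Lemma cstar_iso_image : cstar_iso N [set f S | S in N].
Proof.
have [[fb fl fa _] fM] := hf; have Nb S : N S -> bop S := cstar_bop cN.
exists f; split.
- split; first by move=> S NS; exists S.
    by move=> S T /set_mem NS /set_mem NT e; rewrite -(gf (Nb _ NS)) e gf//; exact: Nb.
  by move=> _ [S NS <-]; exists S.
- by move=> a S T /Nb bS /Nb bT; exact: fl.
- by move=> S T /Nb bS /Nb bT; exact: fM.
- by move=> S T /Nb bS /Nb bT; exact: fa.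
Qed.

Lemma cstar_image_iso : cstar_iso [set f S | S in N] N.
Proof.
have [[fb fl fa _] fM] := hf; have Nb S : N S -> bop S := cstar_bop cN.
have [gb gl ga _] := hg.
have ib T : [set f S | S in N] T -> bop T by move=> [S /Nb/fb ? <-].
exists g; split.
- split.
  + by move=> _ [S NS <-]; have bS := Nb _ NS; rewrite gf.
  + move=> _ _ /set_mem[S NS <-] /set_mem[T NT <-].
    by have bS := Nb _ NS; have bT := Nb _ NT; rewrite !gf// => ->.
  + by move=> S NS; have bS := Nb _ NS; exists (f S); [exists S | rewrite gf].
- by move=> a S T /ib bS /ib bT; exact: gl.
- move=> _ _ [S /Nb bS <-] [T /Nb bT <-].
  by rewrite -fM// !gf//; exact: bop_comp.
- by move=> S T /ib bS /ib bT; exact: ga.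
Qed.
End isomorphism.

(* The condition says that [T] is a matrix over [M]. *)
Lemma cstar_matrix H (M : set (H -> H)) (I : finType) (u u' : I -> H -> H) :
  cstar_algebra M -> (forall i, bop (u i)) -> (forall i, bop (u' i)) ->
  (forall i, adj (u i) (u' i)) -> (forall x, \sum_i u' i (u i x) = x) ->
  cstar_algebra [set T | bop T /\ forall i j, M (u i \o T \o u' j)].
Proof.
move=> cM bu bu' au id_u; have lu i := bop_lin (bu i); have lu' i := bop_lin (bu' i).
apply: cstarI.
- by move=> T [].
- split; first exact: bop0.
  move=> i j; rewrite (_ : _ \o _ = fun=> 0); first exact: cstar0.
  by apply/funext => x /=; rewrite linop0.
- move=> a S T [bS hS] [bT hT]; split=> [|i j]; first exact: bopZD.
  rewrite (_ : _ \o _ = fun x => a *: (u i \o S \o u' j) x + (u i \o T \o u' j) x).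
    exact: cstarZD.
  by apply/funext => x /=; rewrite lu.
- move=> S T [bS hS] [bT hT]; split=> [|i j]; first exact: bop_comp.
  (* The product rule for matrices: the decomposition [id_u] of the identity is inserted between [S]
     and [T]. *)
  rewrite (_ : _ \o _ = fun x => \sum_k ((u i \o S \o u' k) \o (u k \o T \o u' j)) x).
    by apply: cstar_sum => // k; exact: (cstarM cM (hS i k) (hT k j)).
  apply/funext => x /=; rewrite -{1}[T _]id_u (linop_sum (bop_lin bS)).
  by rewrite (linop_sum (lu i)).
- move=> S T [bT hT] bS a; split=> // i j.
  apply: (cstar_adj cM (hT j i)); first by apply: bop_comp => //; exact: bop_comp.
  by move=> x y /=; rewrite au a; have := adj_sym (au i); apply.
- move=> T bT h; split=> // i j; apply: (cstar_cvg cM); first by apply: bop_comp => //;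
    exact: bop_comp.
  have [_ [C C0 hC]] := bu i; have [_ [D D0 hD]] := bu' j.
  move=> e e0; pose d := e / (C * D + 1).
  have CD0 : 0 <= C * D by rewrite mulr_ge0.
  have d0 : 0 < d by rewrite divr_gt0// ltr_wpDl.
  have [S [bS hS] hTS] := h d d0; exists (u i \o S \o u' j) => // x /=.
  rewrite -linopB//; apply: le_trans (hC _) _.
  apply: (@le_trans _ _ (C * (d * (D * nsq x)))).
    rewrite ler_wpM2l//; apply: le_trans (hTS _) _; rewrite ler_wpM2l//; exact: ltW.
  have -> : C * (d * (D * nsq x)) = (d * (C * D)) * nsq x by ring.
  rewrite ler_wpM2r ?nsq_ge0// /d mulrAC ler_pdivrMr ?ltr_wpDl//.
  by rewrite ler_wpM2l ?lerDl//; exact: ltW.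
Qed.
End cstar.

(** * Ampliations *)

Section synthesis.
Variables (R : realType) (I : choiceType) (H : hilbertType R) (e : I -> H).
Local Notation C := (R[i]^o).
Hypothesis oe : forall i j, ip (e i) (e j) = (i == j)%:R.

Lemma bessel y (F : {fset I}) : \sum_(i <- F) nsq (ip (e i) y : C) <= nsq y.
Proof.
pose x := \sum_(i <- F) ip (e i) y *: e i.
pose S := \sum_(i <- F) nsq (ip (e i) y : C).
have ex i : i \in F -> ip (e i) x = ip (e i) y.
  move=> iF; rewrite /x ip_sumr (big_fsetD1 i)//= ipZr oe eqxx mulr1 big1_seq ?addr0//.
  by move=> j /= /fsetD1P[ji _]; rewrite ipZr oe eq_sym (negPf ji) mulr0.
have xS z : (forall i, i \in F -> ip (e i) z = ip (e i) y) -> ip x z = S%:C%C.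
  move=> ez; rewrite /x ip_suml rmorph_sum; apply: eq_big_seq => i iF.
  by rewrite ipZl ez//; exact: nsqE (ip (e i) y : C).
have := ip_ge0 (y - x); rewrite ipDr ipNr !ipDl !ipNl (ip_conj x y) !xS// nsqE.
rewrite (_ : Num.conj S%:C%C = S%:C%C).
  by rewrite subrr oppr0 addr0 -rmorphB -[0]/(0%:C%C) lecR subr_ge0.
by apply/eqP; rewrite eq_complex /= oppr0 !eqxx.
Qed.

Fact analysis_sig : {A : H -> ell2 I C | forall y i, A y i = ip (e i) y}.
Proof.
exists (fun y => ell2_of (fun i => ip (e i) y : C)) => y i.
by rewrite (ell2_ofE (bessel y)).
Qed.

Definition analysis : H -> ell2 I C := sval analysis_sig.

Lemma analysisE y i : analysis y i = ip (e i) y.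
Proof. exact: (svalP analysis_sig). Qed.

Lemma nsq_analysis_le y : nsq (analysis y) <= nsq y.
Proof. by apply: nsq_le_sum => F; under eq_bigr do rewrite analysisE; exact: bessel. Qed.

Lemma bop_analysis : bop analysis.
Proof.
split=> [a x y|]; last by exists 1 => // x; rewrite mul1r nsq_analysis_le.
by apply: ell2_ext => i; rewrite ell2_linE !analysisE ip_linear.
Qed.

Lemma analysis_basis i : analysis (e i) = dl i (1 : C).
Proof.
apply: ell2_ext => j; rewrite analysisE dlE oe.
by case: (j == i).
Qed.

Lemma ip_dl1 i (x : ell2 I C) : ip (dl i (1 : C)) x = x i.
Proof.
rewrite ip_dl; transitivity (Num.conj (1 : R[i]) * (x i : R[i])); first by reflexivity.
by rewrite rmorph1 mul1r.
Qed.

Lemma ell2_ind1 (Q : ell2 I C -> Prop) (x : ell2 I C) : closed_subspace Q ->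
  (forall i, Q (dl i (1 : C))) -> Q x.
Proof.
move=> cQ Qd; apply: closed_total => // y hy; apply: ell2_ext => i.
by rewrite -ip_dl1 hy.
Qed.

(** The family [e] need not be total; the second clause places [y] in its closed span. There
    [analysis] is isometric, so that preimages of a convergent sequence converge and the set of
    attained [x] is closed. *)
Lemma synthesis_ex (x : ell2 I C) :
  exists y, analysis y = x /\ forall z, ip y z = ip x (analysis z).
Proof.
apply: (ell2_ind1 (Q := fun x => exists y, analysis y = x /\
  forall z, ip y z = ip x (analysis z))) => [|i]; last first.
  exists (e i); split; first exact: analysis_basis.
  by move=> z; rewrite ip_dl1 analysisE.
have lA := bop_lin bop_analysis.
split.
- by exists 0; split; [exact: linop0 | move=> z; rewrite !ip0l].
- move=> a x1 x2 [y1 [e1 a1]] [y2 [e2 a2]]; exists (a *: y1 + y2); split.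
    by rewrite lA e1 e2.
  by move=> z; rewrite !ip_lin_l a1 a2.
move=> h hh; have pos n : 0 < n.+1%:R^-1 :> R by rewrite invr_gt0 ltr0n.
have /choice[y Hy] n : exists y, nsq (h - analysis y) < n.+1%:R^-1 /\
    forall z, ip y z = ip (analysis y) (analysis z).
  by have [x1 [y [<- a]] ?] := hh _ (pos n); exists y.
have [|l Hl] := @nsq_complete _ _ y.
  move=> d d0; have [|N HN] := @invS_lt R (d / 4); first by rewrite divr_gt0.
  exists N => m n /HN hm /HN hn.
  have -> : nsq (y m - y n) = nsq (analysis (y m - y n)).
    rewrite /nsq linopB//; congr complex.Re.
    by rewrite !(ipDl, ipDr, ipNl, ipNr) !(Hy _).2.
  have := nsqD_le (analysis (y m) - h) (h - analysis (y n)).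
  rewrite addrA subrK -linopB// [nsq (analysis (y m) - h)]nsqBC.
  move: hm hn (Hy m).1 (Hy n).1; move: (m.+1%:R^-1) (n.+1%:R^-1) (nsq (analysis _)).
  by move: (nsq _) (nsq _) => a b p q c; lra.
exists l; split=> [|z].
  apply/eqP; rewrite -subr_eq0; apply/eqP/nsq_eq0/small_eq0 => d d0.
  rewrite ger0_norm ?nsq_ge0//.
  have d4 : 0 < d / 4 by rewrite divr_gt0.
  have [N HN] := invS_lt d4; have [M HM] := Hl _ d4; pose n := maxn N M.
  have := nsqD_le (analysis l - analysis (y n)) (analysis (y n) - h).
  rewrite addrA subrK -linopB//; have := nsq_analysis_le (l - y n).
  have := HM n (leq_maxr _ _); have := HN n (leq_maxl _ _).
  have := (Hy n).1; rewrite [nsq (l - _)]nsqBC [nsq (h - _)]nsqBC.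
  move: (nsq (analysis l - h)) (nsq (analysis _ - h)) (nsq (analysis (l - _))) (nsq (y n - l)).
  by move: (n.+1%:R^-1) => p a b c c'; lra.
have key (d : R) : 0 < d -> `|complex.Re (ip l z - ip h (analysis z))| < d /\
    `|complex.Im (ip l z - ip h (analysis z))| < d.
  move=> d0; have d2 : 0 < d / 2 by rewrite divr_gt0.
  have [t t0 Ht] := small_ip z d2; have [s s0 Hs] := small_ip (analysis z) d2.
  have [N HN] := invS_lt s0; have [M HM] := Hl _ t0; pose n := maxn N M.
  have [] := Ht _ (HM n (leq_maxr _ _)).
  have [|] := Hs (h - analysis (y n)).
    by apply: lt_trans (HN n (leq_maxl _ _)); exact: (Hy n).1.
  rewrite !ipDl !ipNl (Hy n).2.
  case: (ip l z) (ip h _) (ip (analysis (y n)) _) => a b [a' b'] [a'' b''] /=.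
  rewrite !ltr_norml => /andP[? ?] /andP[? ?] /andP[? ?] /andP[? ?].
  by split; apply/andP; split; lra.
apply/eqP; rewrite -subr_eq0 eq_complex; apply/andP; split; apply/eqP.
  by apply: small_eq0 => d /key[].
by apply: small_eq0 => d /key[].
Qed.

Lemma synthesis_choice : exists V : ell2 I C -> H,
  forall x, analysis (V x) = x /\ forall z, ip (V x) z = ip x (analysis z).
Proof. by have /choice[V hV] := synthesis_ex; exists V. Qed.

Fact synthesis_sig : {V : ell2 I C -> H |
  forall x, analysis (V x) = x /\ forall z, ip (V x) z = ip x (analysis z)}.
Proof. exact: cid synthesis_choice. Qed.

Definition synthesis : ell2 I C -> H := sval synthesis_sig.

Lemma synthesisK x : analysis (synthesis x) = x.
Proof. exact: (svalP synthesis_sig x).1. Qed.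

Lemma adj_synthesis : adj synthesis analysis.
Proof. by move=> x z; rewrite (svalP synthesis_sig x).2. Qed.

Lemma nsq_synthesis x : nsq (synthesis x) = nsq x.
Proof. by rewrite /nsq adj_synthesis synthesisK. Qed.

Lemma bop_synthesis : bop synthesis.
Proof.
split=> [a x y|]; last by exists 1 => // x; rewrite nsq_synthesis mul1r.
have sA z w : ip z (synthesis w) = ip (analysis z) w by rewrite (adj_sym adj_synthesis).
by apply: ip_ext => z; rewrite ipDr ipZr !sA ip_linear.
Qed.

Lemma synthesis_basis i : synthesis (dl i (1 : C)) = e i.
Proof.
apply: ip_ext => z; rewrite [LHS]ip_conj [RHS]ip_conj; congr (Num.conj _).
by have := adj_synthesis (dl i (1 : C)) z; rewrite ip_dl1 analysisE.
Qed.
End synthesis.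

Section ampliation.
Variables (R : realType) (I : choiceType) (J : finType) (H : hilbertType R).
Local Notation C := (R[i]^o).
Variable e : J -> I -> H.
Hypothesis oe : forall i j g h, ip (e i g) (e j h) = ((i == j) && (g == h))%:R.

Let oe1 j g h : ip (e j g) (e j h) = (g == h)%:R.
Proof. by rewrite oe eqxx. Qed.

Local Notation K := (ell2 I C).
Local Notation V j := (synthesis (oe1 j)).
Local Notation W j := (analysis (oe1 j)).

Lemma bop_W j : bop (W j). Proof. exact: bop_analysis. Qed.
Lemma bop_V j : bop (V j). Proof. exact: bop_synthesis. Qed.

Lemma WV i j x : W i (V j x) = if i == j then x else 0.
Proof.
case: eqP => [->|/eqP ij]; first exact: synthesisK.
apply: (ell2_ind1 (Q := fun x => W i (V j x) = 0)).
  by apply: closed_ker; apply: bop_comp; [exact: bop_W | exact: bop_V].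
by move=> g; rewrite synthesis_basis; apply: ell2_ext => h; rewrite analysisE oe (negPf ij).
Qed.

(** On the closed span of the family, which is a sum of copies of [K] indexed by [J], this is [S] on
    each copy; it vanishes on the orthogonal complement. Hence [ampl id] is the projection onto that
    span. *)
Definition ampl (S : K -> K) (y : H) : H := \sum_j V j (S (W j y)).

Definition compress (j0 : J) (T : H -> H) : K -> K := W j0 \o T \o V j0.

Lemma bop_ampl S : bop S -> bop (ampl S).
Proof.
move=> bS; apply: bop_sum => j; have := bop_comp (bop_V j) (bop_comp bS (bop_W j)).
by [].
Qed.

Lemma W_ampl i S y : bop S -> W i (ampl S y) = S (W i y).
Proof.
move=> bS; rewrite /ampl (linop_sum (bop_lin (bop_W i))) (bigD1 i)//= WV eqxx big1 ?addr0// => j ji.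
by rewrite WV eq_sym (negPf ji).
Qed.

Lemma nsq_ampl S y : bop S -> nsq (ampl S y) = \sum_j nsq (S (W j y)).
Proof.
move=> bS; apply/complexI; rewrite -nsqE {1}/ampl ip_suml rmorph_sum /=.
apply: eq_bigr => j _; rewrite (adj_synthesis (oe1 j)).
by rewrite W_ampl// nsqE.
Qed.

(** Pythagoras: [y - ampl id y] is orthogonal to [ampl id y], whose squared norm is the sum on the
    left. *)
Lemma nsq_W_le y : \sum_j nsq (W j y) <= nsq y.
Proof.
have bi := @bop_id R K.
have h0 : ip (ampl id y) (y - ampl id y) = 0.
  rewrite {1}/ampl ip_suml big1// => j _; rewrite (adj_synthesis (oe1 j)).
  by rewrite (linopB (bop_lin (bop_W j))) W_ampl// subrr ip0r.
rewrite -(nsq_ampl y bi) -{2}[y](subrK (ampl id y)) addrC nsqD h0 /= mulr0 addr0.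
by rewrite lerDl nsq_ge0.
Qed.

Lemma ampl_star_hom : star_hom ampl.
Proof.
split; last first.
  move=> S T bS bT; apply/funext => y /=; rewrite {1 2}/ampl.
  by apply: eq_bigr => j _; rewrite W_ampl.
split.
- exact: bop_ampl.
- move=> a S T bS bT; apply/funext => y; rewrite /ampl scaler_sumr -big_split.
  by apply: eq_bigr => j _; rewrite (bop_lin (bop_V j)).
- move=> S T bS bT a x y; rewrite /ampl ip_suml ip_sumr; apply: eq_bigr => j _.
  by rewrite (adj_synthesis (oe1 j)) a (adj_sym (adj_synthesis (oe1 j))).
- move=> S d bS d0 h y; rewrite nsq_ampl//.
  apply: (@le_trans _ _ (\sum_j d * nsq (W j y))); first exact: ler_sum.
  by rewrite -mulr_sumr ler_wpM2l// nsq_W_le.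
Qed.

Lemma compress_star_linear j : star_linear (compress j).
Proof.
split.
- by move=> T bT; apply: bop_comp (bop_V j); apply: bop_comp bT; exact: bop_W.
- by move=> a S T bS bT; apply/funext => x; rewrite /compress /= (bop_lin (bop_W j)).
- move=> S T bS bT a x y; rewrite /compress /=.
  by rewrite (adj_sym (adj_synthesis (oe1 j))) a (adj_synthesis (oe1 j)).
- move=> S d bS d0 h y; rewrite /compress /=.
  apply: le_trans (nsq_analysis_le (oe1 j) _) _; apply: le_trans (h _) _.
  by rewrite nsq_synthesis.
Qed.

Lemma compressK j S : bop S -> compress j (ampl S) = S.
Proof. by move=> bS; apply/funext => x; rewrite /compress /= W_ampl// WV eqxx. Qed.


End ampliation.

Section left_translations.
Variable R : realType.

Lemma ltransE (V : hilbertType R) (G : groupType) (g : G) :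
  @ltrans R G V g = rx (fun h => (g^-1 * h)%g).
Proof. by rewrite rx_def. Qed.
End left_translations.

Section group_representation.
Variables (R : realType) (G : groupType).
Local Notation C := (R[i]^o).

Lemma ltrans_can (g : G) : cancel (fun h => (g^-1 * h)%g) (fun h => (g * h)%g).
Proof. exact: mulVKg. Qed.

Lemma ltrans_can' (g : G) : cancel (fun h => (g * h)%g) (fun h => (g^-1 * h)%g).
Proof. exact: mulKg. Qed.

Lemma bop_ltrans (V : hilbertType R) (g : G) : bop (@ltrans R G V g).
Proof. rewrite ltransE; exact: bop_rx (can_inj (ltrans_can g)). Qed.

Lemma ltrans_dl (V : hilbertType R) (g h : G) (v : V) : ltrans g (dl h v) = dl (g * h)%g v.
Proof. rewrite ltransE; exact: (rx_dl (ltrans_can g) (ltrans_can' g)). Qed.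

Lemma group_cstarP : cstar_algebra (group_cstar R G).
Proof. by apply: cstar_genP => _ [g _ <-]; exact: bop_ltrans. Qed.

Variables (J : finType) (H : hilbertType R) (e : J -> G -> H).
Hypothesis oe : forall i j g h, ip (e i g) (e j h) = ((i == j) && (g == h))%:R.

(** On each copy of the regular representation both sides agree on basis vectors. The factor
    [ampl id] is there because [T] is arbitrary outside the span of the family. *)
Lemma ampl_ltrans g (T : H -> H) : bop T -> (forall j h, T (e j h) = e j (g * h)%g) ->
  ampl oe (ltrans g) = T \o ampl oe id.
Proof.
move=> bT hT; apply/funext => y /=; rewrite /ampl (linop_sum (bop_lin bT)).
apply: eq_bigr => j _; set V := synthesis _.
have bV : bop V by exact: bop_synthesis.
apply: (ell2_ind1 (Q := fun x => V (ltrans g x) = T (V x))).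
  by apply: (closed_eq (S := V \o ltrans g) (T := T \o V));
    apply: bop_comp => //; exact: bop_ltrans.
by move=> h; rewrite ltrans_dl /V !synthesis_basis hT.
Qed.

(** Totality is asked relative to [y] alone: for the graph, the family spans the range of [v] and
    not the whole Fock space. *)
Lemma ampl_id_total y : (forall x : H, (forall j g, ip (e j g) x = 0) -> ip x y = 0) ->
  ampl oe id y = y.
Proof.
move=> h; have bi := @bop_id R (ell2 G C).
have z : forall j g, ip (e j g) (y - ampl oe id y) = 0.
  move=> j g; have := W_ampl oe j y bi; move/(congr1 (fun x : ell2 G C => x g)).
  by rewrite analysisE /= analysisE => h'; rewrite ipDr ipNr h' subrr.
apply/eqP; rewrite eq_sym -subr_eq0; apply/eqP/ip_eq0; rewrite ipDr ipNr (h _ z) sub0r.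
rewrite {2}/ampl ip_sumr big1 ?oppr0// => j _.
rewrite ip_conj adj_synthesis (_ : analysis _ (y - _) = 0) ?ip0r ?rmorph0//.
by apply: ell2_ext => g; rewrite analysisE z.
Qed.
End group_representation.

(** * Crossed products *)

Section crossed_rep.
Variables (R : realType) (Q : groupType) (K : hilbertType R) (u : Q -> K -> K).
Hypotheses (bu : forall q, bop (u q)) (nsq_u_le : forall q x, nsq (u q x) <= nsq x).
Hypotheses (uK : forall q x, u q (u q^-1%g x) = x) (adj_u : forall q, adj (u q) (u q^-1%g)).
Implicit Types (S T : K -> K).

Definition conj_action (q : Q) T : K -> K := u q \o T \o u q^-1%g.

Lemma bop_conj_action q T : bop T -> bop (conj_action q T).
Proof. by move=> bT; exact: (bop_comp (bop_comp (bu q) bT) (bu q^-1%g)). Qed.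

Lemma nsq_conj_action_le q T (c : R) : 0 <= c ->
  (forall x, nsq (T x) <= c * nsq x) -> forall x, nsq (conj_action q T x) <= c * nsq x.
Proof.
move=> c0 h x; apply: le_trans (nsq_u_le _ _) _; apply: le_trans (h _) _.
by apply: ler_wpM2l.
Qed.

Local Notation cr := (crossed_rep conj_action).

Lemma crossed_repM T : cr T = ell2_map (fun q => conj_action q^-1%g T).
Proof. by rewrite ell2_map_def. Qed.

Lemma crossed_repE T x q : bop T -> cr T x q = conj_action q^-1%g T (x q).
Proof.
move=> [_ [c c0 hc]]; rewrite crossed_repM.
have h p := nsq_conj_action_le p^-1%g c0 hc.
by rewrite (ell2_mapE c0 h x).
Qed.

Lemma crossed_rep_dl T q v : bop T -> cr T (dl q v) = dl q (conj_action q^-1%g T v).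
Proof.
move=> bT; apply: ell2_ext => p; rewrite (crossed_repE _ _ bT) !dlE; case: eqP => [->//|_].
exact: (linop0 (bop_lin (bop_conj_action _ bT))).
Qed.

Lemma nsq_crossed_rep_le T (c : R) : 0 <= c -> (forall x, nsq (T x) <= c * nsq x) ->
  forall x, nsq (cr T x) <= c * nsq x.
Proof.
move=> c0 hc x; rewrite crossed_repM.
have h q := nsq_conj_action_le q^-1%g c0 hc.
exact: (nsq_map_le c0 h x).
Qed.

Lemma bop_crossed_rep T : bop T -> bop (cr T).
Proof.
move=> bT; split; last first.
  by have [_ [c c0 hc]] := bT; exists c => //; exact: nsq_crossed_rep_le.
move=> b x y; apply: ell2_ext => q; rewrite [RHS]ell2_linE !(crossed_repE _ _ bT) ell2_linE.
exact: (bop_lin (bop_conj_action _ bT)).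
Qed.

Lemma crossed_rep_star_hom : star_hom cr.
Proof.
split; [split|].
- exact: bop_crossed_rep.
- move=> b S T bS bT; apply/funext => x; apply: ell2_ext => q.
  rewrite [RHS]ell2_linE (crossed_repE _ _ bS) (crossed_repE _ _ bT).
  rewrite (crossed_repE _ _ (bopZD b bS bT)).
  exact: (bop_lin (bu _)).
- move=> S T bS bT aST x y.
  have cQ := closed_ip y (cr T y) (bop_crossed_rep bS) (@bop_id R _).
  have ind := ell2_ind x cQ; apply: ind => q v.
  rewrite (crossed_rep_dl _ _ bS) 2!ip_dl (crossed_repE _ _ bT) /conj_action /=.
  by rewrite adj_u aST adj_u invgK.
- by move=> S c bS c0 hc; exact: nsq_crossed_rep_le.
- move=> S T bS bT; apply/funext => x; apply: ell2_ext => q /=.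
  rewrite (crossed_repE _ _ (bop_comp bS bT)) (crossed_repE _ _ bS) (crossed_repE _ _ bT).
  by rewrite /conj_action /= !invgK uK.
Qed.

Lemma crossed_rep_id : cr id = id.
Proof.
apply/funext => x; apply: ell2_ext => q; rewrite (crossed_repE _ _ (@bop_id R K)).
by rewrite /conj_action /= uK.
Qed.
End crossed_rep.

Lemma ltrans1 (R : realType) (V : hilbertType R) (L : groupType) : @ltrans R L V 1%g = id.
Proof.
apply/funext => x; apply: ell2_ext => h; rewrite ltransE rxE; last exact: can_inj (ltrans_can _).
by rewrite invg1 mul1g.
Qed.

Section semidirect_crossed.
Variables (R : realType) (Q N : groupType) (a : group_action Q N).
Local Notation C := (R[i]^o).
Local Notation K := (ell2 N C).
Local Notation H := (ell2 Q K).
Local Notation G := (sdprod_of a).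
Local Notation gp := (@gperm R Q N a).
Local Notation cr := (crossed_rep (conj_action gp)).

Lemma gactK q : cancel (a q) (a q^-1%g).
Proof. by move=> x; rewrite -gactM mulVg gact1. Qed.

Lemma gactVK q : cancel (a q^-1%g) (a q).
Proof. by move=> x; rewrite -gactM mulgV gact1. Qed.

Lemma gpermE q : gp q = rx (a q^-1%g).
Proof. by rewrite rx_def. Qed.

Lemma bop_gperm q : bop (gp q).
Proof. rewrite gpermE; exact: bop_rx (can_inj (gactVK q)). Qed.

Lemma nsq_gperm_le q (x : K) : nsq (gp q x) <= nsq x.
Proof. rewrite gpermE; exact: nsq_rx_le (can_inj (gactVK q)) x. Qed.

Lemma gperm_dl q n v : gp q (dl n v) = dl (a q n) v.
Proof. rewrite gpermE; exact: (rx_dl (gactVK q) (gactK q)). Qed.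

Lemma gpermK q (x : K) : gp q (gp q^-1%g x) = x.
Proof.
rewrite !gpermE rx_comp; [|exact: can_inj (gactVK _)..].
apply: ell2_ext => n; rewrite rxE /=; last by apply: inj_comp; exact: can_inj (gactVK _).
by rewrite -gactM mulVg gact1.
Qed.

Lemma adj_gperm q : adj (gp q) (gp q^-1%g).
Proof. rewrite !gpermE invgK; exact: adj_rx (gactVK q) (gactK q). Qed.

Lemma cstar_actionE : @cstar_action R Q N a = conj_action gp.
Proof. by []. Qed.

(** The dummy index of type [unit] makes the resulting representation an ampliation of multiplicity
    one. *)
Definition sd_basis (_ : unit) (g : G) : H := dl g.2 (dl (a g.2^-1%g g.1) (1 : C)).

Lemma sd_basis_orth i j g h : ip (sd_basis i g) (sd_basis j h) = ((i == j) && (g == h))%:R.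
Proof.
case: i j => [] []; case: g h => m p [n q] /=; rewrite /sd_basis ip_dl dlE /=.
rewrite -[(m, p) == (n, q)]/((m == n) && (p == q)).
have [->|_] := eqVneq p q; last by rewrite andbF ip0r.
rewrite ip_dl1 dlE (inj_eq (can_inj (gactK _))) andbT.
by case: (m == n).
Qed.

Definition sd_rep (g : G) : H -> H := cr (ltrans g.1) \o ltrans g.2.

Let bop_cr T : bop T -> bop (cr T).
Proof. exact: bop_crossed_rep bop_gperm nsq_gperm_le T. Qed.

Lemma bop_sd_rep g : bop (sd_rep g).
Proof. exact: (bop_comp (bop_cr (bop_ltrans _ g.1)) (bop_ltrans _ g.2)). Qed.

Lemma sd_rep_basis g j h : sd_rep g (sd_basis j h) = sd_basis j (g * h)%g.
Proof.
case: g h => n q [m p]; rewrite /sd_rep /sd_basis /= ltrans_dl.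
rewrite (crossed_rep_dl bop_gperm nsq_gperm_le _ _ (bop_ltrans _ n)).
congr dl; rewrite /conj_action /= gperm_dl ltrans_dl gperm_dl; congr dl.
rewrite !gact_mulg -!gactM invgK; congr (_ * a _ _)%g.
by rewrite mulVg mul1g invgM -mulgA mulVg mulg1.
Qed.

Lemma sd_ampl g : ampl sd_basis_orth (ltrans g) = sd_rep g.
Proof.
rewrite (ampl_ltrans _ (bop_sd_rep g) (sd_rep_basis g)); apply/funext => x /=.
rewrite ampl_id_total// => y hy; rewrite (_ : y = 0) ?ip0l//.
apply: ell2_ext => q; apply: ell2_ext => m.
have := hy tt (a q m, q); rewrite /sd_basis ip_dl ip_dl1 /=.
by rewrite gactK.
Qed.

Theorem group_cstar_sdprod :
  cstar_iso (group_cstar R G) (crossed_product (group_cstar R N) (@cstar_action R Q N a)).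
Proof.
rewrite cstar_actionE.
have cN := group_cstarP R N; have cG := group_cstarP R G.
have hA := ampl_star_hom sd_basis_orth.
have hC := compress_star_linear sd_basis_orth tt.
have cI := cstar_image hA hC (compressK sd_basis_orth tt) cG.
have bN T : group_cstar R N T -> bop T := cstar_bop cN.
have cP : cstar_algebra (crossed_product (group_cstar R N) (conj_action gp)).
  by apply: cstar_genP => T [[S /bN bS <-]|[q _ <-]]; [exact: bop_cr|exact: bop_ltrans].
have img g : [set ampl sd_basis_orth S | S in group_cstar R G] (sd_rep g).
  exists (ltrans g); last exact: sd_ampl.
  by apply: cstar_gen_sub; exists g.
suff -> : crossed_product (group_cstar R N) (conj_action gp) =
    [set ampl sd_basis_orth S | S in group_cstar R G].
  exact: (cstar_iso_image hA (compressK sd_basis_orth tt) cG).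
apply/seteqP; split.
- apply: cstar_gen_min => // _ [[T NT <-]|[q _ <-]].
    (* Here [T] is any element of the C*-algebra of [N]; pulling the target back along [crossed_rep]
       reduces it to a translation by some [n], whose copy represents [(n, 1)]. *)
    have hcr := crossed_rep_star_hom bop_gperm nsq_gperm_le gpermK adj_gperm.
    have cpre := cstar_preimage hcr cI.
    have [] // := cstar_gen_min cpre _ NT => _ [n _ <-]; split; first exact: bop_ltrans.
    by have := img (n, 1%g); rewrite /sd_rep /= ltrans1.
  have := img (1%g, q); rewrite /sd_rep /= ltrans1.
  by rewrite (crossed_rep_id nsq_gperm_le gpermK).
- move=> _ [T NT <-].
  have [] // := cstar_gen_min (cstar_preimage hA cP) _ NT => _ [g _ <-].
  split; first exact: bop_ltrans.
  rewrite /= sd_ampl; apply: (cstarM cP).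
    by apply: cstar_gen_sub; left; exists (ltrans g.1) => //; apply: cstar_gen_sub; exists g.1.
  by apply: cstar_gen_sub; right; exists g.2.
Qed.
End semidirect_crossed.

(** * The representation on the Fock space *)

Section fock.
Variables (R : realType) (D A : algType R[i]) (starD : D -> D) (star : A -> A).
Variables (i : D -> A) (E : A -> D) (L : hilbertType R) (rho : D -> L -> L).

(** Both factors of the free product carry the same data, as in the graph. These are the algebraic
    facts from which the relations between the operators [fock_op] follow. *)
Record expectation : Prop := Expectation {
  i_lin : forall c d d', i (c *: d + d') = c *: i d + i d';
  i_mul : forall d d', i (d * d') = i d * i d';
  i_1 : i 1 = 1;
  E_lin : forall c a a', E (c *: a + a') = c *: E a + E a';
  E_1 : E 1 = 1;
  E_mull : forall d a, E (i d * a) = d * E a;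
  E_mulr : forall d a, E (a * i d) = E a * d;
  star_D : forall a a', star (a + a') = star a + star a';
  star_N : forall a, star (- a) = - star a;
  star_M : forall a a', star (a * a') = star a' * star a;
  starK : forall a, star (star a) = a;
  star_i : forall d, star (i d) = i (starD d);
  E_star : forall a, E (star a) = starD (E a);
  rho_lin : forall c d d' x, rho (c *: d + d') x = c *: rho d x + rho d' x;
  rho_mul : forall d d' x, rho (d * d') x = rho d (rho d' x);
  rho_1 : forall x, rho 1 x = x;
  rho_star : forall d x y, ip (rho d x) y = ip x (rho (starD d) y) }.

Hypothesis h : expectation.
Variable F : fock_space star star i i E E rho.

Local Notation letter := (A + A)%type.
Local Notation vec := (seq letter * L)%type.

(* [true] stands for the side of the first algebra of the free product. *)
Definition mk (b : bool) (a : A) : letter := if b then inl a else inr a.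
Definition side (l : letter) : bool := if l is inl _ then true else false.
Definition entry (l : letter) : A := match l with inl a => a | inr a => a end.

Lemma mkK l : mk (side l) (entry l) = l.
Proof. by case: l. Qed.

Local Notation fw := (fock_word E E).
(** The words to which a centered letter of side [b] can be prepended. *)
Definition ok (b : bool) (w : seq letter) :=
  fw w && (if w is l :: _ then side l != b else true).

Lemma fw_cons b a w : fw (mk b a :: w) = (E a == 0) && ok b w.
Proof.
have -> : fw (mk b a :: w) = [&& E a == 0, all (fun l => letter_E E E l == 0) w &
    path (fun l l' => ~~ same_side l l') (mk b a) w].
  by rewrite andbA; case: b.
rewrite /ok /fock_word; case: w => [|l w] /=; first by rewrite andbT.
rewrite -!andbA; do !bool_congr; rewrite andbC; congr (_ && _).
by case: b l => [] [].
Qed.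

Lemma fw_ok b w : ok b w -> fw w.
Proof. by case/andP. Qed.

Definition tvec (p : vec) : F := fock_tensor F p.1 p.2.
Definition fip (d : D) (p q : vec) : R[i] := fock_ip star star i i E E rho d p.1 p.2 q.1 q.2.
Definition cons_vec (l : letter) (p : vec) : vec := (l :: p.1, p.2).
Definition lact (d : D) (p : vec) : vec :=
  if p.1 is l :: s then (letter_lact i i d l :: s, p.2) else ([::], rho d p.2).

Lemma ip_t p q : fw p.1 -> fw q.1 -> ip (tvec p) (tvec q) = fip 1 p q.
Proof. exact: fock_tensor_ip. Qed.

Lemma i_0 : i 0 = 0.
Proof. by have := i_lin h (-1) 0 0; rewrite scaler0 addr0 scaleN1r addNr. Qed.

Lemma E_0 : E 0 = 0.
Proof. by have := E_lin h (-1) 0 0; rewrite scaler0 addr0 scaleN1r addNr. Qed.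

Lemma EB a a' : E (a - a') = E a - E a'.
Proof. by rewrite addrC -scaleN1r (E_lin h) scaleN1r addrC. Qed.

Lemma E_i d : E (i d) = d.
Proof. by rewrite -[i d]mulr1 (E_mull h) (E_1 h) mulr1. Qed.

Lemma E_center a : E (a - i (E a)) = 0.
Proof. by rewrite EB E_i subrr. Qed.

Lemma ok_lact b d p : ok b p.1 -> ok b (lact d p).1.
Proof.
case: p => [[|l w] x] //=; rewrite /ok /fock_word /= => /andP[/andP[/andP[e al] s] n].
have -> : letter_E E E (letter_lact i i d l) == 0.
  by case: l {s n} e => a /= /eqP e; rewrite (E_mull h) e mulr0.
rewrite al /=; apply/andP; split; last by case: l {s e} n.
case: w {al} s => //= l' w /andP[s ->]; rewrite andbT.
by case: l {n e} s.
Qed.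

Lemma fw_lact d p : fw p.1 -> fw (lact d p).1.
Proof.
case: p => [[|l w] x] // hw.
have hb : ok (~~ side l) (l :: w) by rewrite /ok hw /=; case: l {hw}.
exact: fw_ok (ok_lact d (p := (l :: w, x)) hb).
Qed.

Lemma fip_lin c d d' p q : fip (c *: d + d') p q = c * fip d p q + fip d' p q.
Proof.
case: p q => w x [w' x']; rewrite /fip /=.
elim: w w' d d' => [|l w IH] [|l' w'] d d' //=; rewrite ?mulr0 ?addr0//.
  by rewrite (rho_lin h) ip_linear.
by case: l l' => a [a'|a'] //=; rewrite ?mulr0 ?addr0// -IH (i_lin h) mulrDr mulrDl
   -scalerAr -scalerAl (E_lin h).
Qed.

Lemma fip_0 p q : fip 0 p q = 0.
Proof. by have := fip_lin (-1) 0 0 p q; rewrite scaler0 addr0 mulN1r addNr. Qed.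

Lemma fip_lactr d d' p q : fip d p (lact d' q) = fip (d * d') p q.
Proof.
case: p q => w x [[|l' w'] x']; rewrite /fip /=; case: w => [|l w] //=.
  by rewrite (rho_mul h).
by case: l l' => a [a'|a'] //=; rewrite (i_mul h) !mulrA.
Qed.

Lemma fip_lactl d d' p q : fip d (lact d' p) q = fip (starD d' * d) p q.
Proof.
case: p q => [[|l w] x] [[|l' w'] x'] //; rewrite /fip /=.
  by rewrite (rho_star h) (rho_mul h).
by case: l l' => a [a'|a'] //=; rewrite (star_M h) (star_i h) (i_mul h) !mulrA.
Qed.

Lemma fip_cons d b a a' p q :
  fip d (cons_vec (mk b a) p) (cons_vec (mk b a') q) = fip (E (star a * i d * a')) p q.
Proof. by case: b. Qed.

Lemma fip_side d b a p q : ok b q.1 -> fip d (cons_vec (mk b a) p) q = 0.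
Proof. by case: q => [[|[a'|a'] w] x]; case: b => //= /andP[]. Qed.

Lemma fip_side' d b a p q : ok b p.1 -> fip d p (cons_vec (mk b a) q) = 0.
Proof. by case: p => [[|[a'|a'] w] x]; case: b => //= /andP[]. Qed.

Lemma t_total u : (forall p, fw p.1 -> ip (tvec p) u = 0) -> u = 0.
Proof. by move=> e; apply: fock_total => w x hw; exact: (e (w, x)). Qed.

Lemma t_ext u v : (forall p, fw p.1 -> ip (tvec p) u = ip (tvec p) v) -> u = v.
Proof.
move=> e; apply/eqP; rewrite -subr_eq0; apply/eqP/t_total => p hp.
by rewrite ipDr ipNr e// subrr.
Qed.

(** Against a fixed [q], a prepended letter is seen only through an expectation linear in [a], or
    not at all. Relations in the first letter can thus be tested without looking at [q]. *)
Lemma fip_cons_r q b :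
  (exists a0 q0, forall d a p,
     fip d q (cons_vec (mk b a) p) = fip (E (star a0 * i d * a)) q0 p) \/
  (forall d a p, fip d q (cons_vec (mk b a) p) = 0).
Proof.
case: q => [[|l w] x]; first by right.
have [e|n] := eqVneq (side l) b; last first.
  by right => d a p; case: l n => a0; case: b.
left; exists (entry l), (w, x) => d a p; rewrite -e.
by case: l {e}.
Qed.

(** Relations of the tensor product over [D], such as this one and [t_balanced], are not fields of
    [fock_space]: they hold because both sides have the same inner products with the elementary
    tensors, which are total. *)
Lemma t_lin b c a a' p : ok b p.1 -> E a = 0 -> E a' = 0 ->
  tvec (cons_vec (mk b (c *: a + a')) p) =
  c *: tvec (cons_vec (mk b a) p) + tvec (cons_vec (mk b a') p).
Proof.
move=> op ea ea'; apply: t_ext => q hq; rewrite ipDr ipZr.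
rewrite !ip_t ?fw_cons ?op ?(E_lin h) ?ea ?ea' ?scaler0 ?addr0 ?eqxx//.
have [[a0 [q0 e]]|e] := fip_cons_r q b; rewrite !e ?mulr0 ?addr0//.
by rewrite -fip_lin -(E_lin h) mulrDr -scalerAr.
Qed.

Lemma t_0 b p : ok b p.1 -> tvec (cons_vec (mk b 0) p) = 0.
Proof.
by move=> op; have := t_lin (-1) op E_0 E_0; rewrite scaler0 addr0 scaleN1r addNr.
Qed.

Lemma t_lact_lin c d d' p : fw p.1 ->
  tvec (lact (c *: d + d') p) = c *: tvec (lact d p) + tvec (lact d' p).
Proof.
move=> hp; apply: t_ext => q hq; rewrite ipDr ipZr !ip_t ?fw_lact// !fip_lactr.
by rewrite !mul1r fip_lin.
Qed.

Lemma t_lact0 p : fw p.1 -> tvec (lact 0 p) = 0.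
Proof.
by move=> hp; have := t_lact_lin (-1) 0 0 hp; rewrite scaler0 addr0 scaleN1r addNr.
Qed.

Lemma t_balanced b a d p : ok b p.1 -> E a = 0 ->
  tvec (cons_vec (mk b (a * i d)) p) = tvec (cons_vec (mk b a) (lact d p)).
Proof.
move=> op ea; apply: t_ext => q hq.
rewrite !ip_t ?fw_cons ?(E_mulr h) ?ea ?mul0r ?eqxx ?op ?ok_lact//.
have [[a0 [q0 e]]|e] := fip_cons_r q b; rewrite !e//.
by rewrite fip_lactr mulrA (E_mulr h).
Qed.

(* The element [a (x) p] of [A (x)_D E], for [p] in the part of the Fock space [E]
   whose words do not start on the side [b]. *)
Definition mulvec b a p : F := tvec (cons_vec (mk b (a - i (E a))) p) + tvec (lact (E a) p).

Lemma X_lin b c a a' p : ok b p.1 -> mulvec b (c *: a + a') p = c *: mulvec b a p + mulvec b a' p.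
Proof.
move=> op; rewrite /mulvec (E_lin h) t_lact_lin ?(fw_ok op)//.
have -> : c *: a + a' - i (c *: E a + E a') = c *: (a - i (E a)) + (a' - i (E a')).
  by rewrite (i_lin h) scalerBr opprD addrACA.
by rewrite t_lin// ?E_center// scalerDr addrACA.
Qed.

Lemma fock_op_bop l : bop (fock_op F l).
Proof. by apply/bopP; exact: fock_op_bounded. Qed.

Lemma fock_opD l u v : fock_op F l (u + v) = fock_op F l u + fock_op F l v.
Proof. exact: (linopD (bop_lin (fock_op_bop l))). Qed.

Lemma fock_lactE d p : fock_lact i i rho (fock_tensor F) d p.1 p.2 = tvec (lact d p).
Proof. by case: p => [[|l w] x]. Qed.

Lemma op_ok b a p : ok b p.1 -> fock_op F (mk b a) (tvec p) = mulvec b a p.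
Proof.
move=> op; rewrite /tvec fock_opE ?(fw_ok op)// -[mulvec b a p]/(_ + _) -fock_lactE.
by case: p op => [[|[a'|a'] w] x]; case: b => //= /andP[].
Qed.

Lemma op_cons b a a' p : ok b p.1 -> E a' = 0 ->
  fock_op F (mk b a) (tvec (cons_vec (mk b a') p)) = mulvec b (a * a') p.
Proof.
move=> op ea'; rewrite /tvec fock_opE; last by rewrite fw_cons ea' eqxx.
by rewrite -[mulvec b _ p]/(_ + _) -fock_lactE; case: b {op}.
Qed.

Lemma lact_lact d d' p : lact d (lact d' p) = lact (d * d') p.
Proof.
case: p => [[|l w] x] /=; first by rewrite /lact /= (rho_mul h).
by rewrite /lact /=; case: l => a /=; rewrite (i_mul h) mulrA.
Qed.

Lemma lact_1 p : lact 1 p = p.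
Proof.
case: p => [[|l w] x] /=; first by rewrite /lact /= (rho_1 h).
by rewrite /lact /=; case: l => a /=; rewrite (i_1 h) mul1r.
Qed.

Lemma X_lact b a d p : ok b p.1 -> mulvec b a (lact d p) = mulvec b (a * i d) p.
Proof.
move=> op; rewrite /mulvec (E_mulr h) lact_lact (i_mul h) -mulrBl t_balanced//.
exact: E_center.
Qed.

(** Split [a'] into its centered part and its expectation; [fock_act] multiplies the first by [a]
    and moves the second across the tensor sign, and [X_lin] recombines the results. *)
Lemma op_X b a a' p : ok b p.1 -> fock_op F (mk b a) (mulvec b a' p) = mulvec b (a * a') p.
Proof.
move=> op; rewrite {1}/mulvec fock_opD op_cons ?E_center// op_ok ?ok_lact// X_lact//.
by rewrite -[mulvec b (a * (_ - _)) p]scale1r -X_lin// scale1r -mulrDr subrK.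
Qed.

Lemma X_center b a p : ok b p.1 -> E a = 0 -> mulvec b a p = tvec (cons_vec (mk b a) p).
Proof.
by move=> op ea; rewrite /mulvec ea i_0 subr0 t_lact0 ?addr0// (fw_ok op).
Qed.

Lemma X_i b d p : ok b p.1 -> mulvec b (i d) p = tvec (lact d p).
Proof. by move=> op; rewrite /mulvec E_i subrr t_0// add0r. Qed.

(** A word starting on side [b] is its first letter times the rest; any other word is [1] times
    itself. *)
Lemma t_X b p : fw p.1 -> exists a q, ok b q.1 /\ tvec p = mulvec b a q.
Proof.
move=> hp; have triv : ok b p.1 -> exists a q, ok b q.1 /\ tvec p = mulvec b a q.
  by move=> op; exists 1, p; rewrite -(i_1 h) X_i// lact_1.
case: p hp triv => [[|l w] x] //= hp triv; first exact: triv.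
have [e|n] := eqVneq (side l) b; last by apply: triv; rewrite /ok hp.
move: hp; rewrite -{1}(mkK l) e fw_cons => /andP[/eqP el ow].
exists (entry l), (w, x); split; first exact: ow.
rewrite X_center; [|exact: ow|exact: el].
by rewrite /cons_vec -e mkK.
Qed.

(** The cross terms pair words starting on different sides and vanish. The other two are the
    expectation of the product of the centered parts and the product of the expectations, with sum
    [E (star a * a')]. *)
Lemma ip_X b a a' p q : ok b p.1 -> ok b q.1 ->
  ip (mulvec b a p) (mulvec b a' q) = fip (E (star a * a')) p q.
Proof.
move=> op oq; rewrite /mulvec ipDr !ipDl.
have fp := fw_ok op; have fq := fw_ok oq.
have fc a1 p1 : ok b p1.1 -> fw (cons_vec (mk b (a1 - i (E a1))) p1).1.
  by move=> o; rewrite fw_cons E_center eqxx.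
rewrite !ip_t ?fw_lact ?fc// fip_cons fip_side ?ok_lact// fip_side' ?ok_lact// addr0 add0r.
rewrite fip_lactl fip_lactr mulr1 -[fip (E _) p q]mul1r -fip_lin scale1r; congr fip.
rewrite (i_1 h) mulr1 (star_D h) (star_N h) (star_i h) mulrBl !mulrBr !EB.
rewrite !(E_mulr h) !(E_mull h) (E_star h) E_i.
by rewrite subrr subr0 subrK.
Qed.

Lemma closed_fock (Q : F -> Prop) u : closed_subspace Q -> (forall p, fw p.1 -> Q (tvec p)) -> Q u.
Proof. by move=> cQ Qt; apply: closed_total => // v hv; apply: t_total => p /Qt/hv. Qed.

Local Notation op b a := (fock_op F (mk b a)).

Lemma op_lin b c a a' u : op b (c *: a + a') u = c *: op b a u + op b a' u.
Proof.
have cQ := closed_eq (fock_op_bop (mk b (c *: a + a')))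
  (bopZD c (fock_op_bop (mk b a)) (fock_op_bop (mk b a'))).
have := closed_fock u cQ; apply => p /(t_X b)[a0 [q [oq ->]]].
by rewrite !op_X// mulrDl -scalerAl X_lin.
Qed.

Lemma opM b a a' u : op b (a * a') u = op b a (op b a' u).
Proof.
have cQ := closed_eq (fock_op_bop (mk b (a * a')))
  (bop_comp (fock_op_bop (mk b a)) (fock_op_bop (mk b a'))).
have := closed_fock u cQ; apply => p /(t_X b)[a0 [q [oq ->]]].
by rewrite /= !op_X// mulrA.
Qed.

Lemma op_lact b d p : fw p.1 -> op b (i d) (tvec p) = tvec (lact d p).
Proof.
case: p => [[|l w] x] hp; first by rewrite op_ok// X_i.
have [e|n] := eqVneq (side l) b; last first.
  have o : ok b (l :: w, x).1 by rewrite /ok hp.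
  by rewrite op_ok// X_i.
move: hp; rewrite -(mkK l) e fw_cons => /andP[/eqP el ow].
rewrite -[(mk b (entry l) :: w, x)]/(cons_vec (mk b (entry l)) (w, x)).
rewrite op_cons// X_center ?(E_mull h) ?el ?mulr0//.
by congr tvec; rewrite /lact /cons_vec /=; case: b {e ow}.
Qed.

(** The amalgamation: on elementary tensors both copies of [d] act by [lact d]. *)
Lemma op_i b b' d u : op b (i d) u = op b' (i d) u.
Proof.
have cQ := closed_eq (fock_op_bop (mk b (i d))) (fock_op_bop (mk b' (i d))).
by have := closed_fock u cQ; apply => p hp; rewrite !op_lact.
Qed.

Lemma op_1 b u : op b 1 u = u.
Proof.
have cQ := closed_eq (fock_op_bop (mk b 1)) (@bop_id R F).
have := closed_fock u cQ; apply => p hp.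
by rewrite -(i_1 h) op_lact// lact_1.
Qed.

Lemma adj_op b a : adj (op b a) (op b (star a)).
Proof.
move=> u v.
have cQ v' := closed_ip v' (op b (star a) v') (fock_op_bop (mk b a)) (@bop_id R F).
have := closed_fock u (cQ v); apply => p hp.
have cQ' := closed_ip (tvec p) (op b a (tvec p)) (fock_op_bop (mk b (star a))) (@bop_id R F).
rewrite [LHS]ip_conj [RHS]ip_conj; congr (Num.conj _); apply/esym.
have := closed_fock v cQ'; apply => q hq.
have [a0 [p' [op ->]]] := t_X b hp; have [a1 [q' [oq ->]]] := t_X b hq.
by rewrite !op_X// !ip_X// (star_M h) (starK h) mulrA.
Qed.
End fock.

Arguments mk : simpl never.

(** * The algebras of the graph in coordinates *)

Section matrix2.
Variable R : realType.
Local Notation K := (R[i]).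

(** Explicit entries reduce identities between matrices to scalar ones within reach of [ring] and
    [field]. *)
Definition m2 (a b c d : K) : 'M[K]_2 :=
  \matrix_(i, j) if i == 0 then (if j == 0 then a else b) else (if j == 0 then c else d).

Lemma m2E a b c d : (m2 a b c d 0 0 = a) * (m2 a b c d 0 1 = b) *
  (m2 a b c d 1 0 = c) * (m2 a b c d 1 1 = d).
Proof. by rewrite !mxE. Qed.

Lemma mx2P (x y : 'M[K]_2) : x 0 0 = y 0 0 -> x 0 1 = y 0 1 -> x 1 0 = y 1 0 ->
  x 1 1 = y 1 1 -> x = y.
Proof.
move=> e00 e01 e10 e11; apply/matrixP => i j.
have h (k : 'I_2) : k = 0 \/ k = 1.
  by case: k => [[|[|k]] hk] //; [left|right]; apply: val_inj.
by case: (h i) (h j) => -> [] ->.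
Qed.

Lemma m2P (x : 'M[K]_2) : x = m2 (x 0 0) (x 0 1) (x 1 0) (x 1 1).
Proof. by apply: mx2P; rewrite m2E. Qed.

Lemma m2D a b c d a' b' c' d' :
  m2 a b c d + m2 a' b' c' d' = m2 (a + a') (b + b') (c + c') (d + d').
Proof. by apply: mx2P; rewrite mxE !m2E. Qed.

Lemma m2N a b c d : - m2 a b c d = m2 (- a) (- b) (- c) (- d).
Proof. by apply: mx2P; rewrite mxE !m2E. Qed.

Lemma m2Z z a b c d : z *: m2 a b c d = m2 (z * a) (z * b) (z * c) (z * d).
Proof. by apply: mx2P; rewrite mxE !m2E. Qed.

Lemma m2M a b c d a' b' c' d' :
  m2 a b c d * m2 a' b' c' d' =
  m2 (a * a' + b * c') (a * b' + b * d') (c * a' + d * c') (c * b' + d * d').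
Proof.
have ord2 : lift ord0 ord0 = 1 :> 'I_2 by apply: val_inj.
by apply: mx2P; rewrite mxE !big_ord_recl big_ord0 addr0 ?ord2 -?[ord0]/(0 : 'I_2) !m2E.
Qed.

Lemma m2_1 : 1 = m2 1 0 0 1.
Proof. by apply: mx2P; rewrite mxE !m2E. Qed.

Lemma m2_0 : 0 = m2 0 0 0 0.
Proof. by apply: mx2P; rewrite mxE !m2E. Qed.

Lemma delta00 : delta_mx 0 0 = m2 1 0 0 0.
Proof. by apply: mx2P; rewrite mxE !m2E. Qed.

Lemma delta11 : delta_mx 1 1 = m2 0 0 0 1.
Proof. by apply: mx2P; rewrite mxE !m2E. Qed.

Lemma m2_star a b c d :
  mx_star (m2 a b c d) = m2 (Num.conj a) (Num.conj c) (Num.conj b) (Num.conj d).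
Proof. by apply: mx2P; rewrite 2!mxE !m2E. Qed.

Local Notation C := (R[i]^o).
Local Notation graphD := (C * C * C)%type.
Local Notation graphA := ('M[R[i]]_2 * 'M[R[i]]_2)%type.

(* The entries are listed row by row. *)
Definition mx22 (a b c d a' b' c' d' : K) : graphA := (m2 a b c d, m2 a' b' c' d').

Variant g_spec : graphA -> Prop := GSpec a b c d a' b' c' d' : g_spec (mx22 a b c d a' b' c' d').

Lemma gP x : g_spec x.
Proof. by case: x => x y; rewrite (m2P x) (m2P y). Qed.

Definition v3 (a b c : K) : graphD := (a, b, c).

Variant v3_spec : graphD -> Prop := V3Spec a b c : v3_spec (v3 a b c).

Lemma v3P x : v3_spec x.
Proof. by case: x => [[a b] c]. Qed.

Lemma gM a b c d e f k l a' b' c' d' e' f' k' l' :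
  mx22 a b c d e f k l * mx22 a' b' c' d' e' f' k' l' =
  mx22 (a * a' + b * c') (a * b' + b * d') (c * a' + d * c') (c * b' + d * d')
    (e * e' + f * k') (e * f' + f * l') (k * e' + l * k') (k * f' + l * l').
Proof. by rewrite /mx22 -!m2M. Qed.

Lemma gD a b c d e f k l a' b' c' d' e' f' k' l' :
  mx22 a b c d e f k l + mx22 a' b' c' d' e' f' k' l' =
  mx22 (a + a') (b + b') (c + c') (d + d') (e + e') (f + f') (k + k') (l + l').
Proof. by rewrite /mx22 -!m2D. Qed.

Lemma gN a b c d e f k l :
  - mx22 a b c d e f k l = mx22 (- a) (- b) (- c) (- d) (- e) (- f) (- k) (- l).
Proof. by rewrite /mx22 -!m2N. Qed.

Lemma gZ z a b c d e f k l : z *: mx22 a b c d e f k l =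
  mx22 (z * a) (z * b) (z * c) (z * d) (z * e) (z * f) (z * k) (z * l).
Proof. by rewrite /mx22 -!m2Z. Qed.

Lemma g1 : 1 = mx22 1 0 0 1 1 0 0 1.
Proof. by rewrite /mx22 -!m2_1. Qed.

Lemma g0 : 0 = mx22 0 0 0 0 0 0 0 0.
Proof. by rewrite /mx22 -!m2_0. Qed.

Lemma g_star a b c d e f k l : graph_star (mx22 a b c d e f k l) =
  mx22 (Num.conj a) (Num.conj c) (Num.conj b) (Num.conj d)
    (Num.conj e) (Num.conj k) (Num.conj f) (Num.conj l).
Proof. by rewrite /graph_star /mx22 /= !m2_star. Qed.

Lemma g_emb a b c : graph_emb (v3 a b c) = mx22 a 0 0 c b 0 0 c.
Proof.
rewrite /graph_emb /mx22 /= delta00 delta11 !m2Z !m2D.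
by rewrite !(mulr0, mulr1, addr0, add0r).
Qed.

Lemma g_E a b c d e f k l : graph_E (mx22 a b c d e f k l) = v3 a e ((d + l) / 2).
Proof. by rewrite /graph_E /mx22 /= !m2E. Qed.

Lemma v3M a b c a' b' c' : v3 a b c * v3 a' b' c' = v3 (a * a') (b * b') (c * c').
Proof. by []. Qed.

Lemma v3D a b c a' b' c' : v3 a b c + v3 a' b' c' = v3 (a + a') (b + b') (c + c').
Proof. by []. Qed.

Lemma v3Z z a b c : z *: v3 a b c = v3 (z * a) (z * b) (z * c).
Proof. by []. Qed.

Lemma v3_1 : 1 = v3 1 1 1. Proof. by []. Qed.
Lemma v3_0 : 0 = v3 0 0 0. Proof. by []. Qed.

Lemma ip_v3 a b c a' b' c' : ip (v3 a b c) (v3 a' b' c') =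
  Num.conj a * a' + Num.conj b * b' + Num.conj c * c'.
Proof. by []. Qed.

Definition starD (d : graphD) : graphD :=
  v3 (Num.conj d.1.1) (Num.conj d.1.2) (Num.conj d.2).

Lemma v3_star a b c : starD (v3 a b c) = v3 (Num.conj a) (Num.conj b) (Num.conj c).
Proof. by []. Qed.

Opaque mx22 v3 starD.

Lemma conj2 : Num.conj 2^-1 = 2^-1 :> K.
Proof. by rewrite rmorphV ?unitfE ?pnatr_eq0// rmorph_nat. Qed.

Lemma graph_expectation : expectation starD (@graph_star R) (@graph_emb R)
  (@graph_E R) (@graph_rho R).
Proof.
have two0 : (2 : K) != 0 by rewrite pnatr_eq0.
split; rewrite /graph_rho.
- move=> c d d'; case: (v3P d) => a1 a2 a3; case: (v3P d') => b1 b2 b3.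
  by rewrite v3Z v3D !g_emb gZ gD; congr mx22; ring.
- move=> d d'; case: (v3P d) => a1 a2 a3; case: (v3P d') => b1 b2 b3.
  by rewrite v3M !g_emb gM; congr mx22; ring.
- by rewrite v3_1 g_emb -g1.
- move=> c a a'; case: (gP a) => *; case: (gP a') => *.
  by rewrite gZ gD !g_E v3Z v3D; congr v3; ring.
- by rewrite g1 g_E v3_1; congr v3; field.
- move=> d a; case: (v3P d) => *; case: (gP a) => *.
  by rewrite g_emb gM !g_E v3M; congr v3; ring.
- move=> d a; case: (v3P d) => *; case: (gP a) => *.
  by rewrite g_emb gM !g_E v3M; congr v3; ring.
- move=> a a'; case: (gP a) => *; case: (gP a') => *.
  by rewrite gD !g_star gD !rmorphD.
- by move=> a; case: (gP a) => *; rewrite gN !g_star gN !rmorphN.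
- move=> a a'; case: (gP a) => *; case: (gP a') => *.
  by rewrite gM !g_star gM !rmorphD !rmorphM; congr mx22; ring.
- by move=> a; case: (gP a) => *; rewrite !g_star !conjCK.
- by move=> d; case: (v3P d) => *; rewrite v3_star !g_emb g_star !rmorph0.
- move=> a; case: (gP a) => *; rewrite g_star !g_E v3_star rmorphM rmorphD.
  by congr (v3 _ _ (_ * _)); exact: esym conj2.
- by move=> c d d' x; rewrite mulrDl -scalerAl.
- by move=> d d' x; rewrite mulrA.
- by move=> x; rewrite mul1r.
- move=> d x y; case: (v3P d) => *; case: (v3P x) => *; case: (v3P y) => *.
  by rewrite v3_star !v3M !ip_v3 !rmorphM; ring.
Qed.
End matrix2.

(** * Actions of the semidirect product and normal forms *)

Section integer_powers.
Variables (T : Type) (f f' : T -> T).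
Hypotheses (fK : cancel f f') (f'K : cancel f' f).

Definition zpow (n : int) : T -> T :=
  match n with Posz k => iter k f | Negz k => iter k.+1 f' end.

Lemma zpowS n x : zpow (1 + n) x = f (zpow n x).
Proof.
case: n => [n|[|n]]; first by rewrite -PoszD.
  by rewrite (_ : 1 + Negz 0 = 0)//= f'K.
by rewrite (_ : 1 + Negz n.+1 = Negz n)/= ?f'K// !NegzE; lia.
Qed.

Lemma zpowP n x : zpow (-1 + n) x = f' (zpow n x).
Proof. by rewrite -[in RHS](subrK 1 n) addrC [in RHS]addrC addrC zpowS fK addrC. Qed.

Lemma zpowD m n x : zpow (m + n) x = zpow m (zpow n x).
Proof.
elim: m => [|m IH|m IH]; first by rewrite add0r.
  by rewrite intS -addrA !zpowS IH.
by rewrite intS opprD -addrA !zpowP IH.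
Qed.


End integer_powers.

Lemma Z2_mul (x y : 'Z_2) : x != 1%g -> y != 1%g -> (x * y)%g = 1%g.
Proof.
by case: x y => [[|[|k]] hx] [[|[|l]] hy] // _ _; apply: val_inj.
Qed.

Section sdprod_action.
Variables (T : Type) (f f' s : T -> T).
Hypotheses (fK : cancel f f') (f'K : cancel f' f) (sK : involutive s).
Local Notation G := freeZ2_sdprod_Z.
Local Notation pw := (zpow f f').

(** The action of the generator of the copy of ['Z_2] with index [k]: in the semidirect product the
    shift by [k] is a conjugation. *)
Definition shifted (k : int) : T -> T := pw k \o s \o pw (- k).

Lemma pwD m n x : pw (m + n) x = pw m (pw n x).
Proof. exact: zpowD. Qed.

Lemma shiftedK k : involutive (shifted k).
Proof. by move=> x; rewrite /shifted /= -[pw (- k) _]pwD addNr sK -pwD subrr. Qed.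

Lemma pw_shifted n k x : pw n (shifted k x) = shifted (n + k) (pw n x).
Proof.
rewrite /shifted /= pwD; congr (pw n (pw k (s _))).
by rewrite -pwD opprD addrAC addNr add0r.
Qed.

Definition letter_act (l : int * 'Z_2) (x : T) : T := if l.2 == 1%g then x else shifted l.1 x.

Definition word_act (w : seq (int * 'Z_2)) (x : T) : T := foldr letter_act x w.

Lemma word_act_cons l w x : word_act (fp_cons l w) x = letter_act l (word_act w x).
Proof.
rewrite /fp_cons /letter_act; case: eqP => // /eqP l1.
case: w => [|[k z] w] /=; first by rewrite /letter_act (negPf l1).
case: l l1 => k' z' /= z'1; case: eqP => [<-|_]; last by rewrite /= {1}/letter_act /= (negPf z'1).
have [->|z1] := eqVneq z 1%g.
  by rewrite mulg1 (negPf z'1) /= /letter_act /= (negPf z'1) ?eqxx.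
by rewrite Z2_mul// eqxx /letter_act /= (negPf z1) shiftedK.
Qed.

Lemma word_act_mul u w x : word_act (foldr (@fp_cons _ _) w u) x = word_act u (word_act w x).
Proof. by elim: u => //= l u IH; rewrite word_act_cons IH. Qed.

Lemma word_act_shift n w x : pw n (word_act w x) = word_act (word_shift n w) (pw n x).
Proof.
elim: w => //= l w IH; rewrite -IH /letter_act /=; case: ifP => // _.
by rewrite pw_shifted.
Qed.

Definition sd_act (g : G) (x : T) : T := word_act g.1 (pw g.2 x).

Lemma sd_actM g h x : sd_act (g * h)%g x = sd_act g (sd_act h x).
Proof.
case: g h => u m [w n]; rewrite /sd_act [in RHS]/= word_act_shift.
by rewrite -pwD -word_act_mul.
Qed.

Lemma sd_act_ind (P : (T -> T) -> Prop) : P id -> (forall a b, P a -> P b -> P (a \o b)) ->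
  P f -> P f' -> P s -> forall g, P (sd_act g).
Proof.
move=> Pid Pc Pf Pf' Ps [w n].
have Pi a k : P a -> P (iter k a).
  move=> Pa; elim: k => [|k IH]; first exact: Pid.
  by rewrite (_ : iter k.+1 a = a \o iter k a)//; exact: Pc.
have Pp k : P (pw k) by case: k => k; exact: Pi.
apply: (Pc (word_act w) (pw n)) => //; elim: (fp_word w) => [|l u IH]; first exact: Pid.
apply: (Pc (letter_act l) (word_act u)) => //; have [e|e] := eqVneq l.2 1%g.
  by rewrite (_ : letter_act l = id)//; apply/funext => x; rewrite /letter_act e eqxx.
rewrite (_ : letter_act l = shifted l.1).
  by apply: (Pc (_ \o _)) (Pp _); exact: Pc.
by apply/funext => x; rewrite /letter_act (negPf e).
Qed.

(* Classes [P], [M] and [S] of vectors that start with a positive power of [f], a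
   negative one, and with [s]; every non-trivial element moves [x] to one of them. *)
Lemma sd_act_class (P M S : T -> Prop) (x : T) :
  (forall y, P y -> P (f y)) -> (forall y, S y -> P (f y)) -> P (f x) ->
  (forall y, M y -> M (f' y)) -> (forall y, S y -> M (f' y)) -> M (f' x) ->
  (forall y, P y -> S (s y)) -> (forall y, M y -> S (s y)) -> S (s x) ->
  forall g : G, g != 1%g -> [\/ P (sd_act g x), M (sd_act g x) | S (sd_act g x)].
Proof.
move=> PP SP xP MM SM xM PS MS xS [[w rw] n].
have pos y k : P (f y) -> P (pw k.+1 y).
  by move=> Py; elim: k => //= k IH; exact: PP.
have neg y k : M (f' y) -> M (pw (Negz k) y).
  by move=> Py; elim: k => //= k IH; exact: MM.
have dich y d : d != 0 -> P (f y) -> M (f' y) -> P (pw d y) \/ M (pw d y).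
  by case: d => [[|k]|k] // _ Py My; [left; exact: (pos y k Py) | right; exact: (neg y k My)].
(* Consecutive letters of indices [k] and [k'] leave the power [- k + k'] of [f] between two [s]; it
   is non-trivial because the word is reduced. Only the innermost power can be trivial, and then [s]
   meets [x] itself. *)
have key k z v : reduced ((k, z) :: v) -> S (s (pw (- k) (word_act v (pw n x)))).
  elim: v k z => [|[k' z'] v IH] k z rv.
    rewrite /= -pwD; have [->//|d0] := eqVneq (- k + n) 0.
    by have [/PS|/MS] := dich x _ d0 xP xM.
  move: (rv); rewrite reduced_cons => /and3P[_ /= kk' rv'].
  have z1 : z' != 1%g by move: rv'; rewrite reduced_cons => /andP[].
  have Sy := IH _ _ rv'.
  rewrite /= {1}/letter_act /= (negPf z1) /shifted /= -pwD.
  have d0 : - k + k' != 0 by rewrite addrC subr_eq0 eq_sym.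
  by have [/PS|/MS] := dich _ _ d0 (SP _ Sy) (SM _ Sy).
case: w rw => [|[k z] v] rw g1.
  have n0 : n != 0 by apply: contra_neq g1 => ->; congr (_, _); exact: val_inj.
  by have [?|?] := dich x n n0 xP xM; [constructor 1|constructor 2].
have z1 : z != 1%g by move: (rw); rewrite reduced_cons => /andP[].
have Sy := key _ _ _ rw.
rewrite (_ : sd_act _ x = pw k (s (pw (- k) (word_act v (pw n x))))); last first.
  by rewrite /sd_act /= {1}/letter_act /= (negPf z1).
(* The outermost power of [f] may be trivial too: the vector then starts with [s]. *)
have [k0|k0] := eqVneq k 0; first by constructor 3; rewrite k0 in Sy *.
by have [?|?] := dich _ _ k0 (SP _ Sy) (SM _ Sy); [constructor 1 | constructor 2].
Qed.
End sdprod_action.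

(** * The corner of the graph algebra *)

Section graph_operators.
Variables (R : realType) (F : graph_fock R).
Local Notation K := (R[i]).
Local Notation graphA := ('M[R[i]]_2 * 'M[R[i]]_2)%type.
Local Notation graphE := (@graph_E R).

Let h := graph_expectation R.
Local Notation op b a := (fock_op F (mk b (a : graphA))).

(* [gv] and [gw] are [v] and [w1 + w2]; in the first algebra [b10] is [alpha_1 + alpha_2]
   and [sx] is the unitary [b10 + b01], likewise for the second one. The prefix [s] is a
   multiplication by the central symmetry [sg]. *)
Definition gv : graphA := mx22 0 0 0 1 0 0 0 1.
Definition gw : graphA := mx22 1 0 0 0 1 0 0 0.
Definition sx : graphA := mx22 0 1 1 0 0 1 1 0.
Definition sg : graphA := mx22 1 0 0 1 (-1) 0 0 (-1).
Definition b10 : graphA := mx22 0 0 1 0 0 0 1 0.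
Definition b01 : graphA := mx22 0 1 0 0 0 1 0 0.
Definition sb10 : graphA := mx22 0 0 1 0 0 0 (-1) 0.
Definition sb01 : graphA := mx22 0 1 0 0 0 (-1) 0 0.
Definition s11 : graphA := mx22 0 0 0 1 0 0 0 (-1).
Definition s00 : graphA := mx22 1 0 0 0 (-1) 0 0 0.

Ltac gring := rewrite /gv /gw /sx /sg /b10 /b01 /sb10 /sb01 /s11 /s00
  ?(gM, gD, gN, gZ, g_emb, g_star, rmorph0, rmorph1, rmorphN); congr mx22; ring.
Ltac gcent := rewrite /sx /b10 /b01 /sb10 /sb01 /s11 g_E v3_0; congr v3; field.

Lemma opMe b a a' a'' u : a * a' = a'' -> op b a (op b a' u) = op b a'' u.
Proof. by move=> <-; rewrite -(opM h). Qed.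
Arguments opMe {b a a'} a'' u _.

Lemma op_bop b a : bop (op b a).
Proof. exact: fock_op_bop. Qed.

Definition uA : F -> F := op true sx.
Definition uB : F -> F := op false sx.
Definition opU : F -> F := uA \o uB.
Definition opU' : F -> F := uB \o uA.
Definition sigma : F -> F := op false sg.
Definition pv : F -> F := op true gv.

Lemma op_0 b u : op b 0 u = 0.
Proof.
by have := op_lin h b (-1) 0 0 u; rewrite scaler0 addr0 scaleN1r addNr.
Qed.

Lemma proj_vE : proj_v F = pv.
Proof.
rewrite /proj_v /pv /mk; congr (fock_op F (inl _)).
by rewrite -[vertex_v R]/(v3 0 0 1) g_emb.
Qed.

Lemma op_gv b u : op b gv u = pv u.
Proof.
rewrite /pv (_ : gv = graph_emb (v3 0 0 1)); last by rewrite g_emb.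
exact: op_i h _ _ _ _ _.
Qed.

Lemma op_gw b b' u : op b gw u = op b' gw u.
Proof.
rewrite (_ : gw = graph_emb (v3 1 1 0)); last by rewrite g_emb.
exact: op_i h _ _ _ _ _.
Qed.

Lemma uAK : involutive uA.
Proof. by move=> u; rewrite /uA (opMe 1) ?(op_1 h)// g1; gring. Qed.

Lemma uBK : involutive uB.
Proof. by move=> u; rewrite /uB (opMe 1) ?(op_1 h)// g1; gring. Qed.

Lemma sigmaK : involutive sigma.
Proof. by move=> u; rewrite /sigma (opMe 1) ?(op_1 h)// g1; gring. Qed.

Lemma opUK : cancel opU opU'.
Proof. by move=> u; rewrite /opU /opU' /= uAK uBK. Qed.

Lemma opU'K : cancel opU' opU.
Proof. by move=> u; rewrite /opU /opU' /= uBK uAK. Qed.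

Lemma pvK u : pv (pv u) = pv u.
Proof. by rewrite /pv (opMe gv)//; gring. Qed.

Lemma pv_u b u : pv (op b sx u) = op b b10 u.
Proof. by rewrite -(op_gv b) (opMe b10)//; gring. Qed.

Lemma u_pv b u : op b sx (pv u) = op b b01 u.
Proof. by rewrite -(op_gv b) (opMe b01)//; gring. Qed.

Lemma w_b01 b b' u : op b gw (op b' b01 u) = op b' b01 u.
Proof. by rewrite (op_gw b b') (opMe b01)//; gring. Qed.

Lemma b10_w b b' u : op b b10 (op b' gw u) = op b b10 u.
Proof. by rewrite (op_gw b' b) (opMe b10)//; gring. Qed.

Lemma u_w b u : op b sx (op b gw u) = op b b10 u.
Proof. by rewrite (opMe b10)//; gring. Qed.

(** Both [uA] and [uB] exchange the ranges of [gv] and [gw], which are the same on the two sides, so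
    their product preserves each. *)
Lemma pv_opU u : pv (opU u) = opU (pv u).
Proof.
rewrite /opU /uA /uB /= pv_u u_pv -(w_b01 true) u_w.
by rewrite -[LHS](b10_w true false) (opMe b01)//; gring.
Qed.

Lemma pv_opU' u : pv (opU' u) = opU' (pv u).
Proof. by rewrite -[LHS]opUK -pv_opU opU'K. Qed.

Lemma pv_sigma u : pv (sigma u) = sigma (pv u).
Proof. by rewrite /sigma -!(op_gv false) (opMe s11) ?(@opMe _ sg _ s11)//; gring. Qed.

Lemma sigma_pv u : sigma (pv u) = op false s11 u.
Proof. by rewrite /sigma -(op_gv false) (opMe s11)//; gring. Qed.

Lemma opU'_pv u : opU' (pv u) = op false b10 (op true b01 u).
Proof. by rewrite /opU' /uA /uB /= u_pv -(w_b01 false) u_w b10_w. Qed.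

Lemma pv_opU'_pv u : pv (opU' (pv u)) = opU' (pv u).
Proof. by rewrite pv_opU' pvK. Qed.

(** * Freeness: the orbits of the two base vectors *)

Local Notation vec := (seq (graphA + graphA) * (K^o * K^o * K^o))%type.
Local Notation okb := (ok graphE).
Local Notation T := (tvec F).
Local Notation lactd := (lact (@graph_emb R) (@graph_rho R)).
Implicit Types (q : vec).

Lemma op_t b a q : okb b q.1 -> graph_E a = 0 ->
  op b a (T q) = T (cons_vec (mk b a) q).
Proof. by move=> oq ea; rewrite (op_ok F a oq) (X_center h). Qed.

Lemma op_tc b a a' a'' q : okb b q.1 -> graph_E a' = 0 -> a * a' = a'' -> graph_E a'' = 0 ->
  op b a (T (cons_vec (mk b a') q)) = T (cons_vec (mk b a'') q).
Proof. by move=> oq ea' <- ea; rewrite (op_cons F a oq ea') (X_center h). Qed.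

Lemma op_tci b a a' d q : okb b q.1 -> graph_E a' = 0 -> a * a' = graph_emb d ->
  op b a (T (cons_vec (mk b a') q)) = T (lactd d q).
Proof. by move=> oq ea' e; rewrite (op_cons F a oq ea') e (X_i h). Qed.

Lemma ok_cons b b' a q : graph_E a = 0 -> okb b q.1 -> b' = ~~ b -> okb b' (cons_vec (mk b a) q).1.
Proof.
move=> ea oq ->; have : fock_word graphE graphE (mk b a :: q.1) by rewrite fw_cons ea eqxx.
by move=> hw; apply/andP; split; [exact: hw | case: b {oq hw}].
Qed.

Lemma E_sx : graph_E sx = 0. Proof. by gcent. Qed.
Lemma E_b10 : graph_E b10 = 0. Proof. by gcent. Qed.
Lemma E_b01 : graph_E b01 = 0. Proof. by gcent. Qed.
Lemma E_sb10 : graph_E sb10 = 0. Proof. by gcent. Qed.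
Lemma E_sb01 : graph_E sb01 = 0. Proof. by gcent. Qed.
Lemma E_s11 : graph_E s11 = 0. Proof. by gcent. Qed.

(* Any complex number of modulus [1 / sqrt 2] would do. *)
Definition half_root : K := (2^-1 +i* 2^-1)%C.

Definition xv : vec := ([::], v3 0 0 1).
Definition wv : vec := ([::], v3 half_root half_root 0).
Definition ev : vec := cons_vec (mk false b10) wv.
Definition base (j : bool) : F := if j then T xv else T ev.

(* Vectors obtained from a base vector by words starting with a positive power of [opU],
   a negative power of [opU], and [sigma]. The last two cases of [starts_flip] are the
   images by [sigma] of the base vectors themselves. *)
Definition starts_pos (y : F) := pv y = y /\
  exists a q, [/\ okb true q.1, graph_E a = 0 & y = T (cons_vec (mk true a) q)].

Definition starts_neg (y : F) := pv y = y /\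
  exists q, okb true q.1 /\ y = T (cons_vec (mk false b10) (cons_vec (mk true b01) q)).

Definition starts_flip (y : F) := pv y = y /\
  [\/ exists q, [/\ okb false q.1, q.1 <> [::] & y = T (cons_vec (mk false s11) q)],
      exists q, okb true q.1 /\ y = T (cons_vec (mk false sb10) (cons_vec (mk true b01) q)),
      y = T (cons_vec (mk false s11) xv)
    | y = T (cons_vec (mk false sb10) wv)].

Lemma fw_tc b a q : graph_E a = 0 -> okb b q.1 -> fock_word graphE graphE (cons_vec (mk b a) q).1.
Proof. by move=> ea oq; have := ok_cons ea oq erefl => /andP[]. Qed.

Lemma fw_ev : fock_word graphE graphE ev.1.
Proof. by apply: fw_tc; [exact: E_b10 | ]. Qed.

Lemma lact_cons d b a q : lactd d (cons_vec (mk b a) q) = cons_vec (mk b (graph_emb d * a)) q.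
Proof. by case: b. Qed.

Lemma pv_base j : pv (base j) = base j.
Proof.
rewrite -(op_gv (~~ j)) (_ : gv = graph_emb (v3 0 0 1)); last by rewrite g_emb.
case: j => /=; rewrite (op_lact h)//; last exact: fw_ev.
  by rewrite /lact /= /graph_rho v3M; congr (T (_, _)); congr v3; ring.
rewrite /ev lact_cons (_ : graph_emb (v3 0 0 1) * b10 = b10)//.
by gring.
Qed.

Lemma cent_ok b a q : graph_E a = 0 -> okb b q.1 -> okb (~~ b) (cons_vec (mk b a) q).1.
Proof. by move=> ea oq; exact: ok_cons. Qed.

Lemma pos_opU y : starts_pos y -> starts_pos (opU y).
Proof.
move=> [py [a [q [oq ea ey]]]]; split; first by rewrite pv_opU py.
have oa := cent_ok ea oq; have os := cent_ok E_sx oa.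
exists sx, (cons_vec (mk false sx) (cons_vec (mk true a) q)); split=> //; first exact: E_sx.
by rewrite ey /opU /= /uB op_t// ?E_sx// /uA op_t// E_sx.
Qed.

Lemma u_s11 : sx * s11 = sb01. Proof. by gring. Qed.
Lemma u_sb10 : sx * sb10 = graph_emb (v3 1 (-1) 0). Proof. by gring. Qed.
Lemma u_sb01 : sx * sb01 = s11. Proof. by gring. Qed.
Lemma s_b01 : graph_emb (v3 1 (-1) 0) * b01 = sb01. Proof. by gring. Qed.
Lemma u_b10 : sx * b10 = graph_emb (v3 1 1 0). Proof. by gring. Qed.
Lemma s_b10 : sg * b10 = sb10. Proof. by gring. Qed.

(** The critical case is a leading [sb10]: [uB] cancels it and leaves [w1 - w2] in C^3, which passes
    to the vacuum vector or to the next letter [b01], making it [sb01]. In the latter case [uA]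
    yields [s11], which is centered; without the sign it would yield [gv], which is not. *)
Lemma flip_opU y : starts_flip y -> starts_pos (opU y).
Proof.
move=> [py cy]; split; first by rewrite pv_opU py.
case: cy => [[q [oq _ ey]]|[q [oq ey]]|ey|ey].
- have o1 := cent_ok E_sb01 oq; exists sx, (cons_vec (mk false sb01) q).
  split=> //; first exact: E_sx.
  by rewrite ey /opU /= /uB (op_tc oq E_s11 u_s11 E_sb01) /uA op_t// E_sx.
- have o1 := cent_ok E_b01 oq; exists s11, q; split=> //; first exact: E_s11.
  rewrite ey /opU /= /uB (op_tci o1 E_sb10 u_sb10) lact_cons s_b01.
  by rewrite /uA (op_tc oq E_sb01 u_sb01 E_s11).
- have o0 : okb false xv.1 by [].
  have o1 := cent_ok E_sb01 o0; exists sx, (cons_vec (mk false sb01) xv).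
  split=> //; first exact: E_sx.
  by rewrite ey /opU /= /uB (op_tc o0 E_s11 u_s11 E_sb01) /uA op_t// E_sx.
- have o0 : okb false wv.1 by [].
  exists sx, (lactd (v3 1 (-1) 0) wv); split=> //; first exact: E_sx.
  by rewrite ey /opU /= /uB (op_tci o0 E_sb10 u_sb10) /uA op_t// E_sx.
Qed.

Lemma base_opU j : starts_pos (opU (base j)).
Proof.
split; first by rewrite pv_opU pv_base.
case: j; rewrite /base /opU /=.
  have o0 : okb false xv.1 by [].
  have o1 := cent_ok E_sx o0; exists sx, (cons_vec (mk false sx) xv); split=> //; first exact: E_sx.
  by rewrite /uB op_t// ?E_sx// /uA op_t// E_sx.
have o0 : okb false wv.1 by [].
exists sx, (lactd (v3 1 1 0) wv); split=> //; first exact: E_sx.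
by rewrite /uB (op_tci o0 E_b10 u_b10) /uA op_t// E_sx.
Qed.

(** On the range of [v], [opU'] is [b10] of the second algebra times [b01] of the first. Both are
    centered, so nothing cancels when the word does not start on the first side. *)
Lemma vec_opU' y q : pv y = y -> okb true q.1 -> y = T q -> starts_neg (opU' y).
Proof.
move=> py oq ey; split; first by rewrite pv_opU' py.
exists q; split=> //; rewrite -py opU'_pv ey.
by rewrite op_t ?E_b01// op_t ?E_b10//; exact: cent_ok E_b01 oq.
Qed.

Lemma neg_opU' y : starts_neg y -> starts_neg (opU' y).
Proof.
move=> [py [q [oq ey]]]; apply: vec_opU' ey => //.
exact: cent_ok E_b10 (cent_ok E_b01 oq).
Qed.

Lemma flip_opU' y : starts_flip y -> starts_neg (opU' y).
Proof.
move=> [py cy]; case: cy => [[q [oq _ ey]]|[q [oq ey]]|ey|ey]; apply: vec_opU' ey => //.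
- exact: cent_ok E_s11 oq.
- exact: cent_ok E_sb10 (cent_ok E_b01 oq).
- exact: (@cent_ok false _ xv E_s11).
- exact: (@cent_ok false _ wv E_sb10).
Qed.

Lemma base_opU' j : starts_neg (opU' (base j)).
Proof.
apply: (vec_opU' (q := if j then xv else ev)); first exact: pv_base; last by case: j.
by case: j => //; exact: (@cent_ok false _ wv E_b10).
Qed.

Lemma pos_sigma y : starts_pos y -> starts_flip (sigma y).
Proof.
move=> [py [a [q [oq ea ey]]]]; split; first by rewrite pv_sigma py.
have oa := cent_ok ea oq; constructor 1; exists (cons_vec (mk true a) q); split=> //.
by rewrite -py sigma_pv ey op_t// E_s11.
Qed.

Lemma neg_sigma y : starts_neg y -> starts_flip (sigma y).
Proof.
move=> [py [q [oq ey]]]; split; first by rewrite pv_sigma py.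
constructor 2; exists q; split=> //.
by rewrite ey /sigma (op_tc (cent_ok E_b01 oq) E_b10 s_b10 E_sb10).
Qed.

Lemma base_sigma j : starts_flip (sigma (base j)).
Proof.
split; first by rewrite pv_sigma pv_base.
case: j; [constructor 3 | constructor 4].
  by rewrite -pv_base sigma_pv op_t// E_s11.
by rewrite /sigma (@op_tc _ _ _ _ wv _ E_b10 s_b10 E_sb10).
Qed.

Local Notation fipd := (fip (@graph_star R) (@graph_emb R) graphE (@graph_rho R)).

Lemma ip_T q q' : fock_word graphE graphE q.1 -> fock_word graphE graphE q'.1 ->
  ip (T q) (T q') = fipd 1 q q'.
Proof. exact: ip_t. Qed.

Lemma fip_ev a q : fipd 1 ev (cons_vec (mk false a) q) = fipd (graph_E (b01 * a)) wv q.
Proof.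
have e : graph_star b10 * graph_emb 1 = b01 by rewrite (i_1 h) mulr1; gring.
by rewrite /ev fip_cons e.
Qed.

Lemma fw_base j : fock_word graphE graphE (if j then xv else ev).1.
Proof. by case: j => //; exact: fw_ev. Qed.

Lemma baseE j : base j = T (if j then xv else ev).
Proof. by case: j. Qed.

Lemma P_orth y j : starts_pos y -> ip (base j) y = 0.
Proof.
move=> [_ [a [q [oq ea ->]]]]; rewrite baseE ip_T ?fw_base//; last exact: fw_tc.
by case: j.
Qed.

(** The word of [y] has at least two letters and that of a base vector at most one; words of
    different lengths are orthogonal. *)
Lemma M_orth y j : starts_neg y -> ip (base j) y = 0.
Proof.
move=> [_ [q [oq ->]]]; have o1 := cent_ok E_b01 oq.
rewrite baseE ip_T ?fw_base//; last exact: fw_tc E_b10 o1.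
by case: j => //; rewrite fip_ev.
Qed.

Lemma S_orth y j : starts_flip y -> ip (base j) y = 0.
Proof.
move=> [_ [[q [oq nq ->]]|[q [oq ->]]|->|->]].
- rewrite baseE ip_T ?fw_base//; last exact: fw_tc E_s11 oq.
  by case: j => //; rewrite fip_ev; case: q nq {oq} => [[|l w] x].
- have o1 := cent_ok E_b01 oq.
  rewrite baseE ip_T ?fw_base//; last exact: fw_tc E_sb10 o1.
  by case: j => //; rewrite fip_ev.
- rewrite baseE ip_T ?fw_base//; last exact: (@fw_tc false _ xv E_s11).
  case: j => //; rewrite fip_ev (_ : graphE _ = 0) ?(fip_0 h)//.
  by rewrite (_ : b01 * s11 = sb01) ?E_sb01//; gring.
- rewrite baseE ip_T ?fw_base//; last exact: (@fw_tc false _ wv E_sb10).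
  case: j => //; rewrite fip_ev (_ : b01 * sb10 = s00); last by gring.
  (* The expectation of [s00] is [w1 - w2], and the entries of [wv] at [w1] and [w2] are equal, so
     their contributions cancel. *)
  rewrite /s00 g_E.
  rewrite -[fipd _ _ _]/(ip (v3 half_root half_root 0) (graph_rho _ (v3 half_root half_root 0))).
  by rewrite /graph_rho v3M ip_v3 rmorph0; ring.
Qed.

Lemma half_rootP : Num.conj half_root * half_root = 2^-1.
Proof.
have -> : (2^-1 : K) = (2^-1 : R)%:C%C by rewrite rmorphV ?rmorph_nat ?unitfE ?pnatr_eq0.
by apply/eqP; rewrite eq_complex /=; apply/andP; split; apply/eqP; field.
Qed.

Lemma base_orth i j : ip (base i) (base j) = (i == j)%:R.
Proof.
rewrite !baseE ip_T ?fw_base//; case: i j => [] [] //=.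
- rewrite -[fipd _ _ _]/(ip (v3 0 0 1) (graph_rho 1 (v3 0 0 1))).
  by rewrite /graph_rho v3_1 v3M ip_v3 !rmorph0 rmorph1; ring.
- rewrite fip_ev (_ : b01 * b10 = gw); last by gring.
  rewrite /gw g_E.
  rewrite -[fipd _ _ _]/(ip (v3 half_root half_root 0) (graph_rho _ (v3 half_root half_root 0))).
  rewrite /graph_rho v3M ip_v3 rmorph0 !mul1r half_rootP.
  by field.
Qed.

Local Notation G := freeZ2_sdprod_Z.
Local Notation s := sigma.

Definition act (g : G) : F -> F := sd_act opU opU' s g.

Lemma star_sx : graph_star sx = sx :> graphA. Proof. by gring. Qed.
Lemma star_sg : graph_star sg = sg :> graphA. Proof. by gring. Qed.
Lemma star_gv : graph_star gv = gv :> graphA. Proof. by gring. Qed.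

Lemma adj_u b : adj (op b sx) (op b sx).
Proof. by have := @adj_op _ _ _ _ _ _ _ _ _ h F b sx; rewrite star_sx. Qed.

Lemma adj_pv : adj pv pv.
Proof. by have := @adj_op _ _ _ _ _ _ _ _ _ h F true gv; rewrite star_gv. Qed.

Lemma adj_sigma : adj s s.
Proof. by have := @adj_op _ _ _ _ _ _ _ _ _ h F false sg; rewrite star_sg. Qed.

Lemma actM g k x : act (g * k)%g x = act g (act k x).
Proof. exact: (sd_actM opUK opU'K sigmaK g k x). Qed.

Lemma act1 x : act 1%g x = x.
Proof. by []. Qed.

Lemma actK g x : act g (act g^-1%g x) = x.
Proof. by rewrite -actM mulgV. Qed.

Lemma act_isometry g x y : ip (act g x) (act g y) = ip x y.
Proof.
pose P (f : F -> F) := forall x y, ip (f x) (f y) = ip x y.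
have Pc a b : P a -> P b -> P (a \o b) by move=> Pa Pb u v; rewrite /= Pa Pb.
have PA : P uA by move=> u v; rewrite [LHS](adj_u true) -/(uA _) uAK.
have PB : P uB by move=> u v; rewrite [LHS](adj_u false) -/(uB _) uBK.
have Ps : P s by move=> u v; rewrite adj_sigma sigmaK.
by apply: (sd_act_ind (P := P)) => //; exact: Pc.
Qed.

Lemma bop_act g : bop (act g).
Proof.
have bA : bop uA := op_bop true sx; have bB : bop uB := op_bop false sx.
apply: (sd_act_ind (P := fun f => bop f)).
- exact: bop_id.
- by move=> a b; exact: bop_comp.
- exact: bop_comp bA bB.
- exact: bop_comp bB bA.
- exact: op_bop false sg.
Qed.

Lemma bop_pv : bop pv. Proof. exact: op_bop. Qed.

Lemma pv_act g u : pv (act g u) = act g (pv u).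
Proof.
move: u; apply: (sd_act_ind (P := fun f => forall u, pv (f u) = f (pv u))) => //.
- by move=> a b ea eb u; rewrite /= ea eb.
- exact: pv_opU.
- exact: pv_opU'.
- exact: pv_sigma.
Qed.

Lemma adj_act g : adj (act g) (act g^-1%g).
Proof. by move=> x y; rewrite -{1}[y](actK g) act_isometry. Qed.

Definition basis (j : bool) (g : G) : F := act g (base j).

Lemma basis_orth i j g k : ip (basis i g) (basis j k) = ((i == j) && (g == k))%:R.
Proof.
rewrite /basis adj_act -actM; have [->|gk] := eqVneq g k.
  by rewrite mulVg act1 base_orth andbT.
rewrite andbF.
have n1 : (g^-1 * k)%g != 1%g.
  by apply: contra_neq gk => e; rewrite -[RHS](mulVKg g) e mulg1.
have [c|c|c] := sd_act_class opUK opU'K pos_opU flip_opU (base_opU j)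
  neg_opU' flip_opU' (base_opU' j) pos_sigma neg_sigma (base_sigma j) n1.
- exact: P_orth.
- exact: M_orth.
- exact: S_orth.
Qed.

(* The rows of the two by two matrix decomposition: [pv + uA pv uA = 1]. *)
Definition cor (x : bool) : F -> F := if x then pv \o uA else pv.
Definition cor' (x : bool) : F -> F := if x then uA \o pv else pv.

Lemma bop_cor x : bop (cor x).
Proof. by case: x; [apply: bop_comp|]; exact: op_bop. Qed.

Lemma bop_cor' x : bop (cor' x).
Proof. by case: x; [apply: bop_comp|]; exact: op_bop. Qed.

Lemma adj_cor x : adj (cor x) (cor' x).
Proof.
case: x => x y; last exact: adj_pv.
by rewrite [LHS]adj_pv; exact: (adj_u true).
Qed.

Lemma sum_cor u : \sum_x cor' x (cor x u) = u.
Proof.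
rewrite big_bool /= !pvK.
have -> : uA (pv (uA u)) = op true gw u.
  by rewrite /uA /pv (opMe b01) ?(opMe gw)//; gring.
rewrite -[op true gw u]scale1r -[pv u]/(op true gv u) -(op_lin h) scale1r.
by rewrite (_ : gw + gv = 1) ?(op_1 h)// g1; gring.
Qed.

(** * Matrix entries of the letters *)

Section compress_letter.
Variable P : (F -> F) -> Prop.
Hypotheses (PL : forall (c : K) a b, P a -> P b -> P (fun u => c *: a u + b u))
  (Pc : forall a b, P a -> P b -> P (a \o b))
  (Pp : P pv) (Ps : P (s \o pv)) (PU : P (opU \o pv)) (PU' : P (opU' \o pv)).

(** Conjugation by [opU] carries the difference of the projections [beta_i beta_i'] to that of the
    [alpha_i alpha_i']: both come from [w1 - w2], which lies in the common subalgebra. *)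
Lemma s11_true u : op true s11 u = opU (s (opU' (pv u))).
Proof.
rewrite opU'_pv /sigma (opMe sb10); last by gring.
rewrite /opU /uA /uB /= (opMe s00); last by gring.
have e : s00 = graph_emb (v3 1 (-1) 0) :> graphA by gring.
rewrite e (op_i h false true) -e (opMe sb10); last by gring.
by rewrite (opMe s11)//; gring.
Qed.

Lemma P_s11 b : P (op b s11).
Proof.
case: b; last first.
  by rewrite (_ : op false s11 = s \o pv)//; apply/funext => u; rewrite /= sigma_pv.
rewrite (_ : op true s11 = (opU \o pv) \o ((s \o pv) \o (opU' \o pv))).
  by apply: (Pc PU (Pc Ps PU')).
by apply/funext => u; rewrite s11_true /= !(pv_opU', pv_sigma, pv_opU, pvK).
Qed.

Lemma P_corner b a : P (op b (gv * a * gv)).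
Proof.
case: (gP a) => a1 a2 a3 d a4 a5 a6 l.
have two0 : (2 : K) != 0 by rewrite pnatr_eq0.
(* The corner of [a] is spanned by [s11] and [gv]. As [PL] only forms [c a + b], the coefficient
   [(d + l) / 2] of [gv] is written [c + 1]. *)
pose c := (d + l) / 2 - 1.
rewrite (_ : gv * _ * gv = ((d - l) / 2) *: s11 + (c *: gv + gv)); last first.
  by rewrite /gv /s11 /c ?(gM, gD, gZ); congr mx22; field.
rewrite (_ : op b _ = fun u => ((d - l) / 2) *: op b s11 u + (c *: pv u + pv u)).
  exact: PL (P_s11 b) (PL c Pp Pp).
by apply/funext => u; rewrite !(op_lin h) op_gv.
Qed.
Lemma op_corner b c u : op b (gv * c * gv) u = pv (op b c (pv u)).
Proof. by rewrite !(opM h) !op_gv. Qed.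

(** [P] is abstract because it is used twice: for membership in the image of the group algebra, and
    for preservation of [orth_orbit]. On the first side each entry is a letter cut down by [gv],
    because [uA] is itself a letter of that side. *)
Lemma P_letter b a x y : P (cor x \o op b a \o cor' y).
Proof.
pose m (z : bool) : graphA := if z then sx else 1.
have uE z u : op b (m z) u = if z then op b sx u else u by case: z => //; rewrite (op_1 h).
have key := P_corner b (m x * a * m y).
case: b uE key => uE key.
  rewrite (_ : _ \o _ = op true (gv * (m x * a * m y) * gv))//.
  apply/funext => u; rewrite op_corner !(opM h) !uE.
  by case: x y {key} => [] [].
(* On the second side [uA] is foreign; it is replaced by [opU \o uB] on the left and by [uB \o opU']
   on the right, and [uB] is absorbed by the letter. *)
pose L (z : bool) : F -> F := if z then opU \o pv else pv.
pose L' (z : bool) : F -> F := if z then opU' \o pv else pv.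
have PLx : P (L x) by case: x {key}.
have PLy : P (L' y) by case: y {key}.
rewrite (_ : _ \o _ = L x \o (op false (gv * (m x * a * m y) * gv) \o L' y)).
  exact: Pc PLx (Pc key PLy).
apply/funext => u; rewrite /comp op_corner !(opM h) !uE.
have e1 : op false sx (pv (L' true u)) = uA (pv u).
  by rewrite /L' /= pv_opU'_pv /opU' /= -/(uB _) uBK.
have e2 v : L true (pv (op false sx v)) = pv (uA v).
  by rewrite /L /= !pvK -pv_opU /opU /= -/(uB _) uBK.
by case: x y {key PLx PLy} => [] []; rewrite ?e1 ?e2 /L /L' /= ?pvK.
Qed.
End compress_letter.

Definition gU : G := (fp_one int 'Z_2, (1 : int)).
Definition gU' : G := (fp_one int 'Z_2, (-1 : int)).
(** The group unit of ['Z_2] is [0], so [1%R] is its generator. *)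
Definition gs : G := (FreeProduct (isT : reduced [:: ((0 : int), (1%R : 'Z_2))]), (0 : int)).

Lemma act_gU u : act gU u = opU u. Proof. by []. Qed.
Lemma act_gU' u : act gU' u = opU' u. Proof. by []. Qed.
Lemma act_gs u : act gs u = s u. Proof. by []. Qed.

(** * The two orbits span the range of the projection v *)

Section total.
Variable x : F.
Hypothesis hx : forall j g, ip (basis j g) x = 0.

Definition orth_orbit (v : F) := forall g, ip (act g (pv v)) x = 0.

Lemma orth_lin c u v : orth_orbit u -> orth_orbit v -> orth_orbit (c *: u + v).
Proof.
move=> hu hv g; rewrite (bop_lin bop_pv) (bop_lin (bop_act g)) ip_lin_l hu hv.
by rewrite mulr0 addr0.
Qed.

Lemma orth_add u v : orth_orbit u -> orth_orbit v -> orth_orbit (u + v).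
Proof. by move=> hu hv; rewrite -[u]scale1r; exact: orth_lin. Qed.

Lemma orth_scale c u : orth_orbit u -> orth_orbit (c *: u).
Proof.
move=> hu g; rewrite (linopZ (bop_lin bop_pv)) (linopZ (bop_lin (bop_act g))) ipZl hu.
by rewrite mulr0.
Qed.

Lemma orth_pv u : orth_orbit u -> orth_orbit (pv u).
Proof. by move=> hu g; rewrite pvK. Qed.

Lemma orth_act k u : orth_orbit u -> orth_orbit (act k u).
Proof. by move=> hu g; rewrite pv_act -actM. Qed.

Lemma orth_base j : orth_orbit (base j).
Proof. by move=> g; rewrite pv_base; exact: hx. Qed.

Lemma orth_letter b a y z u : orth_orbit u -> orth_orbit (cor y (op b a (cor' z u))).
Proof.
pose P f := forall u, orth_orbit u -> orth_orbit (f u).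
suff : P (cor y \o op b a \o cor' z) by apply.
apply: P_letter.
- by move=> c f f' hf hf' v hv; apply: orth_lin; [exact: hf | exact: hf'].
- by move=> f f' hf hf' v hv; apply: hf; exact: hf'.
- exact: orth_pv.
- by move=> v hv; rewrite /= -act_gs; exact/orth_act/orth_pv.
- by move=> v hv; rewrite /= -act_gU; exact/orth_act/orth_pv.
- by move=> v hv; rewrite /= -act_gU'; exact/orth_act/orth_pv.
Qed.

(** Linearity in the vacuum argument is not part of [fock_space]; it is inherited from the operators
    through this formula. *)
Lemma T_nil d : T ([::], d) = op true (graph_emb d) (T ([::], v3 1 1 1)).
Proof. by rewrite (op_lact h)// /lact /= /graph_rho -v3_1 mulr1. Qed.

Lemma T_nil_lin c d d' : T ([::], c *: d + d') = c *: T ([::], d) + T ([::], d').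
Proof. by rewrite [LHS]T_nil (i_lin h) (op_lin h) -!T_nil. Qed.

Lemma pv_nil a b c : pv (T ([::], v3 a b c)) = c *: base true.
Proof.
rewrite -(op_gv true) (_ : gv = graph_emb (v3 0 0 1)); last by rewrite g_emb.
rewrite (op_lact h)// /lact /= /graph_rho v3M.
have -> : v3 (0 * a) (0 * b) (1 * c) = c *: v3 0 0 1 + 0 by rewrite addr0 v3Z; congr v3; ring.
rewrite T_nil_lin (_ : T ([::], 0) = 0) ?addr0//.
by rewrite T_nil (i_0 h) op_0.
Qed.

Lemma U_base : opU (base false) = uA (T ([::], v3 half_root half_root 0)).
Proof.
have o0 : okb false wv.1 by [].
rewrite /base /opU /= /uB (op_tci o0 E_b10 u_b10) /lact /= /graph_rho v3M.
by congr (uA (T (_, _))); congr v3; ring.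
Qed.

Lemma U_sig_base : opU (s (base false)) = uA (T ([::], v3 half_root (- half_root) 0)).
Proof.
have o0 : okb false wv.1 by [].
rewrite /base /sigma (op_tc o0 E_b10 s_b10 E_sb10) /opU /= /uB (op_tci o0 E_sb10 u_sb10).
by rewrite /lact /= /graph_rho v3M; congr (uA (T (_, _))); congr v3; ring.
Qed.

Lemma pv_uA_base : pv (uA (base true)) = 0.
Proof.
rewrite -(pv_base true) /uA pv_u -(op_gv true) (opMe 0) ?op_0//.
by rewrite g0; gring.
Qed.

(** One base vector serves both [w1] and [w2]: by [U_base] and [U_sig_base] its orbit contains the
    images by [uA] of the sum and of the difference of their vacuum vectors, up to the factor
    [half_root]. *)
Lemma orth_nil y d : orth_orbit (cor y (T ([::], d))).
Proof.
case: (v3P d) => a b c; case: y => /=; last first.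
  by rewrite pv_nil; apply: orth_scale; exact: orth_base.
have half_root0 : half_root != 0 by rewrite eq_complex /= negb_and invr_eq0 pnatr_eq0.
have two0 : (2 : K) != 0 by rewrite pnatr_eq0.
have -> : v3 a b c = ((a + b) / (2 * half_root)) *: v3 half_root half_root 0 +
    (((a - b) / (2 * half_root)) *: v3 half_root (- half_root) 0 + (c *: v3 0 0 1 + 0)).
  by rewrite v3_0 !v3Z [X in _ + (_ + X)]v3D [X in _ + X]v3D v3D; congr v3; field.
rewrite !T_nil_lin (_ : T ([::], 0) = 0); last by rewrite T_nil (i_0 h) op_0.
have lA : linear_op uA := bop_lin (op_bop true sx).
rewrite !lA (linop0 lA) -U_base -U_sig_base -[T _]/(base true) !(bop_lin bop_pv) pv_uA_base.
rewrite (linop0 (bop_lin bop_pv)) scaler0 !addr0.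
apply: orth_lin; last apply: orth_scale; apply: orth_pv.
  by rewrite -act_gU; exact/orth_act/orth_base.
by rewrite -act_gU -act_gs; exact/orth_act/orth_act/orth_base.
Qed.

(** Induction on the word, for both rows [y] at once: inserting [sum_cor] after the first letter
    leaves matrix entries of that letter applied to rows of the shorter word. *)
Lemma orth_T y q : fock_word graphE graphE q.1 -> orth_orbit (cor y (T q)).
Proof.
case: q => w d; elim: w y => [|l w IH] y hw; first exact: orth_nil.
move: hw; rewrite -(mkK l) fw_cons => /andP[/eqP el ow].
have ow' : okb (side l) (w, d).1 by [].
rewrite -[T _]/(T (cons_vec (mk (side l) (entry l)) (w, d))) -(op_t ow' el).
rewrite -[T (w, d)]sum_cor (linop_sum (bop_lin (op_bop _ _))) (linop_sum (bop_lin (bop_cor y))).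
rewrite big_bool; apply: orth_add; apply: orth_letter; apply: IH; exact: fw_ok ow.
Qed.

Lemma pv_orth_eq0 : pv x = 0.
Proof.
apply: ip_eq0; rewrite [LHS]adj_pv pvK.
have cQ := closed_ip x (0 : F) (bop_comp bop_pv bop_pv) (@bop_id R F).
have /= Q := closed_fock x cQ.
rewrite (_ : ip x (pv x) = ip (pv (pv x)) x); last by rewrite pvK [RHS]adj_pv.
rewrite Q ?ip0r// => q hq; rewrite ip0r pvK.
by have := orth_T false hq 1%g; rewrite act1 /= pvK.
Qed.
End total.

Lemma ampl_id : ampl basis_orth id = pv.
Proof.
apply/funext => y.
have -> : ampl basis_orth id y = ampl basis_orth id (pv y).
  apply: eq_bigr => j _; congr (synthesis _ _); apply: ell2_ext => g.
  rewrite !analysisE; apply/esym; rewrite -[LHS]adj_pv.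
  by rewrite /basis pv_act pv_base.
apply: ampl_id_total => x hx.
by rewrite -[LHS]adj_pv pv_orth_eq0// ip0l.
Qed.

Lemma ampl_act g : ampl basis_orth (ltrans g) = act g \o pv.
Proof.
rewrite -ampl_id; apply: ampl_ltrans; first exact: bop_act.
by move=> j k; rewrite /basis -actM.
Qed.

Theorem graph_corner_iso :
  cstar_iso (corner (proj_v F) (graph_cstar_red F)) (group_cstar R G).
Proof.
rewrite proj_vE.
have cN := group_cstarP R G.
have hA := ampl_star_hom basis_orth.
have hC := compress_star_linear basis_orth true.
have cI := cstar_image hA hC (compressK basis_orth true) cN.
pose I : set (F -> F) := [set ampl basis_orth S | S in group_cstar R G].
have img g : I (act g \o pv).
  by exists (ltrans g); [apply: cstar_gen_sub; exists g | exact: ampl_act].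
have cRed : cstar_algebra (graph_cstar_red F).
  by apply: cstar_genP => _ [l _ <-]; exact: fock_op_bop.
have Mop b a : graph_cstar_red F (op b a).
  by apply: cstar_gen_sub; exists (mk b a).
suff -> : corner pv (graph_cstar_red F) = I.
  exact: (cstar_image_iso hA hC (compressK basis_orth true) cN).
apply/seteqP; split.
- move=> _ [S neg_sigma <-].
  have cmx := cstar_matrix cI bop_cor bop_cor' adj_cor sum_cor.
  have [] := cstar_gen_min cmx _ neg_sigma.
    move=> _ [l _ <-]; split=> [|x y]; first exact: fock_op_bop.
    have PL := cstarZD cI; have Pc := cstarM cI.
    have := P_letter PL Pc (img 1%g) (img gs) (img gU) (img gU') (side l) (entry l) x y.
    by rewrite mkK.
  (* This entry is [pv \o S \o pv], because [cor false] and [cor' false] are both [pv]. *)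
  by move=> _ /(_ false false).
(* As [pv] is [ampl id], compressing [ampl S] by [pv] does not change it. That [ampl S] lies in the
   graph algebra is checked on translations. *)
- move=> _ [S NS <-]; exists (ampl basis_orth S); last first.
    have [_ AM] := hA; have bS := cstar_bop cN NS.
    have bi := @bop_id R (ell2 G (R[i]^o)).
    by rewrite -ampl_id -(AM _ _ bi bS) -(AM _ _ (bop_comp bi bS) bi).
  have [] // := cstar_gen_min (cstar_preimage hA cRed) _ NS => _ [g _ <-].
  split; first exact: bop_ltrans.
  rewrite /= ampl_act; apply: (cstarM cRed); last exact: Mop.
  apply: (sd_act_ind (P := fun f => graph_cstar_red F f)).
  + by rewrite (_ : id = op true 1) //; apply/funext => u; rewrite (op_1 h).
  + by move=> a b Ma Mb; exact: (cstarM cRed).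
  + exact: (cstarM cRed (Mop true sx) (Mop false sx)).
  + exact: (cstarM cRed (Mop false sx) (Mop true sx)).
  + exact: Mop.
Qed.
End graph_operators.

Theorem proposition5p6 (R : realType) (F : graph_fock R) :
  cstar_iso (corner (proj_v F) (graph_cstar_red F))
            (group_cstar R freeZ2_sdprod_Z) /\
  cstar_iso (group_cstar R freeZ2_sdprod_Z)
            (crossed_product (group_cstar R freeZ2)
               (cstar_action (shift_action 'Z_2))).
Proof.
split; first exact: graph_corner_iso.
exact: group_cstar_sdprod.
Qed.
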